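(* Let $n\ge 2$ be an integer. The Clifford algebra $\mathbb{R}_n$ endowed with the Clifford conjugation satisfies: (i) $\mathcal{N}(\mathbb{R}_2)=\mathcal{N}(\mathbb{H})=1$, where $\mathbb{H}$ is the division algebra of quaternions with the standard conjugation; (ii) $\mathcal{N}(\mathbb{R}_3)=\mathcal{N}(\mathbb{R}_4)=2$; (iii) if $n\equiv 1\bmod 4$, then $\mathcal{N}(\mathbb{R}_n)=2$; (iv) if $n\ge 6$ and $n\equiv 0,2,3\bmod 4$, then $3\le\mathcal{N}(\mathbb{R}_n)\le 4$. Here $\mathcal{N}$ denotes the Nash number.
   Context: **Clifford algebras.** $\mathbb{R}_n:=\mathbb{R}_{0,n}$ is the associative real algebra of dimension $2^n$ with basis $\{e_K\}_{K\in\mathcal{P}(n)}$ ($\mathcal{P}(n)$ is the power set of $\{1,\dots,n\}$), where $e_\varnothing=1$, $e_K=e_{k_1}\cdots e_{k_s}$ for $K=\{k_1<\dots<k_s\}$ (with $e_k:=e_{\{k\}}$), $e_k^2=-1$ for all $k$, and $e_ke_h=-e_he_k$ for $k\ne h$. The Clifford conjugation is the real linear involution $x\mapsto x^c$ with $e_K^c=e_K$ if $|K|\equiv 0,3\bmod 4$ and $e_K^c=-e_K$ if $|K|\equiv 1,2\bmod 4$. The quaternions $\mathbb{H}$ are equipped with the basis $e_\varnothing=1,\ e_{\{1\}}=j,\ e_{\{2\}}=i,\ e_{\{1,2\}}=ji$; $\mathbb{R}_2$ is $*$-isomorphic to $\mathbb{H}$ with the standard conjugation. Let $A$ be one of these algebras,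 with its involution $x\mapsto x^c$, and $\mathbb{S}_A:=\{J\in A:J^c=-J,\ J^2=-1\}$. **Slice regular functions.** For $J\in\mathbb{S}_A$ let $\mathbb{C}_J:=\{\alpha+\beta J:\alpha,\beta\in\mathbb{R}\}$, and let $Q_A:=\bigcup_{J\in\mathbb{S}_A}\mathbb{C}_J$. For $D\subset\mathbb{C}$ non-empty, open and invariant under complex conjugation, let $\Omega_D:=\{\alpha+\beta J:\alpha,\beta\in\mathbb{R},\ \alpha+i\beta\in D,\ J\in\mathbb{S}_A\}\subset Q_A$ (an open circular set). A stem function on $D$ is $F=F_1+\iota F_2:D\to A\otimes_{\mathbb{R}}\mathbb{C}$ ($\iota$ the imaginary unit of the second factor, $F_1,F_2:D\to A$) with $F_1(\bar z)=F_1(z)$, $F_2(\bar z)=-F_2(z)$. It induces the slice function $f=\mathcal{I}(F):\Omega_D\to A$, $f(\alpha+\beta J)=F_1(\alpha+i\beta)+JF_2(\alpha+i\beta)$; $F$ is uniquely determined by $f$. $f$ is slice regular if $F$ is of class $C^1$ and $\frac{\partial F}{\partial\alpha}+\iota\frac{\partial F}{\partial\beta}=0$. The real components of $f$ are the functions $f_K:\Omega_D\to\mathbb{R}$ with $f=\sum_K f_Ke_K$. **Nash functions.** Let $k=\mathbb{R}$ or $\mathbb{C}$ and $U\subset k^m$ open. $h:U\to k$ is a $k$-Nash function (real Nash, resp. complex Nash) on $U$ if every point of $U$ has an open neighbourhood $V\subset U$ on which $h$ is $k$-analytic and a non-zero polynomial $P\in k[x_1,\dots,x_m,t]$ with $P(x,h(x))=0$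 for all $x\in V$. Identify $A$ with $\mathbb{R}^{\dim A}$ through the basis $\{e_K\}$; a function $g:\Omega\to\mathbb{R}$ on an open circular set $\Omega\subset Q_A$ is a real Nash function on $\Omega$ if every point of $\Omega$ has an open neighbourhood $V$ in $A$ and a real Nash function on $V$ which coincides with $g$ on $V\cap\Omega$. **Slice-Nash functions.** Let $J\in\mathbb{S}_A$; left multiplication makes $A$ a $\mathbb{C}_J$-vector space, of dimension $u_A+1=\dim(A)/2$. If $\{J_0=1,J_1,\dots,J_{u_A}\}$ is a $\mathbb{C}_J$-basis of $A$, the real basis $\{1,J,J_1,JJ_1,\dots,J_{u_A},JJ_{u_A}\}$ is called a splitting basis of $A$ associated to $J$. Given a stem function $F=F_1+\iota F_2$ on $D$, write uniquely $F_s=\sum_{k=0}^{u_A}(F_{s,1}^{J,J_k}+F_{s,2}^{J,J_k}J)J_k$ ($s=1,2$) with $F_{s,\ell}^{J,J_k}:D\to\mathbb{R}$, and set $F^{\ell}_{J,J_k}:=F_{1,\ell}^{J,J_k}+iF_{2,\ell}^{J,J_k}:D\to\mathbb{C}$. $F$ is a stem-Nash function on $D$ if there exist $J\in\mathbb{S}_A$ and a splitting basis associated to $J$ such that $F^{\ell}_{J,J_k}$ is a complex Nash function on $D$ for all $\ell\in\{1,2\}$, $k\in\{0,\dots,u_A\}$. $f=\mathcal{I}(F)$ is a slice-Nash function on $\Omega_D$ if $F$ is stem-Nash on $D$. **Nash number.** $\mathcal{N}(A)$ is the minimum integer $\ell$ for which there is a subset $\mathcal{K}\subset\mathcal{P}(n)$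 of cardinality $\ell$ such that, for each open circular set $\Omega\subset Q_A$ and each slice regular $f:\Omega\to A$, if $f_K$ is a real Nash function on $\Omega$ for each $K\in\mathcal{K}$, then $f$ is a slice-Nash function. *)

(* Defs.v *)
From HB Require Import structures.
From mathcomp Require Import all_boot all_order all_algebra all_field.
From mathcomp Require Import ring.
From mathcomp Require mpoly.

Set Implicit Arguments.
Unset Strict Implicit.
Unset Printing Implicit Defensive.

Import Order.TTheory GRing.Theory Num.Theory.

Local Open Scope ring_scope.

(* mpoly is imported in this section only: its notations are incompatible     *)
(* with those of the analysis library.                                        *)
Section PowerSeries.
Import mpoly.
Variables (k : numFieldType) (m : nat).
Implicit Types (c : 'X_{1..m} -> k) (y x : 'rV[k]_m).

Definition monomial (nu : 'X_{1..m}) y : k := \prod_(i < m) y 0 i ^+ nu i.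

(* Partial sums over the multi-indices of total degree < N.                   *)
Definition power_series c y (N : nat) : k :=
  \sum_(nu : 'X_{1..m < N}) c nu * monomial nu y.

Definition norm_series c y (N : nat) : k :=
  \sum_(nu : 'X_{1..m < N}) `|c nu * monomial nu y|.

(* The last variable of P is t.                                               *)
Definition algebraic_on (V : 'rV[k]_m -> Prop) (h : 'rV[k]_m -> k) : Prop :=
  exists2 P : {mpoly k[m + 1]}, P != 0 &
    forall x, V x -> P.@[row_mx x (const_mx (h x) : 'M_1) 0] = 0.

End PowerSeries.

Section SymmetricDifference.
Variable T : finType.

Definition symd (A B : {set T}) : {set T} := (A :\: B) :|: (B :\: A).

Lemma in_symd A B x : (x \in symd A B) = (x \in A) (+) (x \in B).
Proof. by rewrite !inE; case: (x \in A); case: (x \in B). Qed.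

Lemma symdA A B C : symd A (symd B C) = symd (symd A B) C.
Proof. by apply/setP=> x; rewrite !in_symd addbA. Qed.

Lemma symdC A B : symd A B = symd B A.
Proof. by apply/setP=> x; rewrite !in_symd addbC. Qed.

Lemma symd0 A : symd A set0 = A.
Proof. by apply/setP=> x; rewrite !in_symd inE addbF. Qed.

Lemma sym0d A : symd set0 A = A.
Proof. by rewrite symdC symd0. Qed.

Lemma symdd A : symd A A = set0.
Proof. by apply/setP=> x; rewrite !in_symd inE addbb. Qed.

Lemma symdK A B : symd A (symd A B) = B.
Proof. by rewrite symdA symdd sym0d. Qed.

Lemma symd_eq A B C : (symd A B == C) = (B == symd A C).
Proof. by apply/eqP/eqP => [<-|->]; rewrite symdK. Qed.

Lemma symd_sign (F : comPzRingType) A B :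
  (-1) ^+ #|symd A B| = (-1) ^+ #|A| * (-1) ^+ #|B| :> F.
Proof.
have dAB : #|symd A B| = (#|A :\: B| + #|B :\: A|)%N.
  rewrite cardsU -[RHS]subn0; congr (_ - _)%N; apply/eqP; rewrite cards_eq0.
  by apply/eqP/setP=> x; rewrite !inE; case: (x \in A); case: (x \in B).
rewrite dAB -(cardsID B A) -(cardsID A B) setIC !exprD.
by rewrite mulrACA -expr2 -exprM mulnC exprM sqrrN !expr1n mul1r.
Qed.

End SymmetricDifference.

Section CliffordAlgebra.
Variables (F : fieldType) (n : nat).
Implicit Types K L M : {set 'I_n}.

(* Sorting the word e_K e_L costs one sign for every pair (k, l) in K * L     *)
(* with l < k, and each k in K :&: L contributes e_k ^ 2 = -1; the remaining  *)
(* indices form the symmetric difference of K and L.                          *)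
Definition cliff_inv K L : {set 'I_n * 'I_n} :=
  [set p | [&& p.1 \in K, p.2 \in L & (p.2 <= p.1)%N]].

Definition cliff_sign K L : F := (-1) ^+ #|cliff_inv K L|.

(* x : clifford is the linear combination \sum_K x K *: e_K.  The type is an  *)
(* alias because {ffun _ -> _} already carries the pointwise product.         *)
Definition clifford : Type := {ffun {set 'I_n} -> F^o}.

HB.instance Definition _ := Vector.copy clifford {ffun {set 'I_n} -> F^o}.

Implicit Types x y z : clifford.

Definition cliff_basis K : clifford := [ffun L => (L == K)%:R].

Definition cliff_mul x y : clifford :=
  [ffun M => \sum_K \sum_(L | symd K L == M) cliff_sign K L * (x K * y L)].

Lemma cliff_signDr K L M :
  cliff_sign K (symd L M) = cliff_sign K L * cliff_sign K M.
Proof.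
rewrite /cliff_sign -symd_sign; congr (_ ^+ #|pred_of_set _|); apply/setP=> p.
rewrite in_symd !inE; case: (p.1 \in K) => //=.
by case: (p.2 <= p.1)%N; rewrite ?andbF ?andbT //; 
  case: (p.2 \in L); case: (p.2 \in M).
Qed.

Lemma cliff_signDl K L M :
  cliff_sign (symd K L) M = cliff_sign K M * cliff_sign L M.
Proof.
rewrite /cliff_sign -symd_sign; congr (_ ^+ #|pred_of_set _|); apply/setP=> p.
rewrite in_symd !inE; case: (p.2 \in M); rewrite ?andbF ?andbT //=.
by case: (p.2 <= p.1)%N; rewrite ?andbF ?andbT //; 
  case: (p.1 \in K); case: (p.1 \in L).
Qed.

Lemma cliff_mulE x y M :
  cliff_mul x y M =
  \sum_K cliff_sign K (symd K M) * (x K * y (symd K M)).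
Proof.
rewrite ffunE; apply: eq_bigr => K _.
by rewrite (eq_bigl (pred1 (symd K M))) ?big_pred1_eq // => L; rewrite symd_eq.
Qed.

Lemma cliff_sign0l K : cliff_sign set0 K = 1.
Proof.
by rewrite /cliff_sign (_ : cliff_inv _ _ = set0) ?cards0 //; apply/setP=> p;
  rewrite !inE.
Qed.

Lemma cliff_sign0r K : cliff_sign K set0 = 1.
Proof.
by rewrite /cliff_sign (_ : cliff_inv _ _ = set0) ?cards0 //; apply/setP=> p;
  rewrite !inE andbF.
Qed.

Lemma cliff_sign_sqr K L : cliff_sign K L * cliff_sign K L = 1.
Proof. by rewrite -expr2 -exprM mulnC exprM sqrrN !expr1n. Qed.

Lemma cliff_mulA : associative cliff_mul.
Proof.
move=> x y z; apply/ffunP=> M; rewrite !cliff_mulE.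
under eq_bigr do rewrite cliff_mulE mulr_sumr mulr_sumr.
under [RHS]eq_bigr do rewrite cliff_mulE mulr_suml mulr_sumr.
rewrite [RHS]exchange_big /=; apply: eq_bigr => K _.
rewrite [RHS](reindex_inj (h := symd K)) /=; last first.
  by move=> L M' /(congr1 (symd K)); rewrite !symdK.
apply: eq_bigr => L _; rewrite !symdK.
rewrite (symdC K L) -!symdA cliff_signDl [cliff_sign K (symd L _)]cliff_signDr.
have := cliff_sign_sqr K L; set s := cliff_sign K L => ss.
set u := cliff_sign L _; set v := cliff_sign K _; set a := z _.
rewrite [RHS](_ : _ = s * s * (v * (x K * (u * (y L * a))))); last by ring.
by rewrite ss mul1r.
Qed.

Lemma cliff_mul1l : left_id (cliff_basis set0) cliff_mul.
Proof.
move=> x; apply/ffunP=> M; rewrite cliff_mulE (bigD1 set0) //= big1 => [|K K0].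
  by rewrite ffunE eqxx cliff_sign0l sym0d !mul1r addr0.
by rewrite ffunE (negPf K0) mul0r mulr0.
Qed.

Lemma cliff_mul1r : right_id (cliff_basis set0) cliff_mul.
Proof.
move=> x; apply/ffunP=> M; rewrite cliff_mulE (bigD1 M) //= big1 => [|K KM].
  by rewrite ffunE symdd eqxx cliff_sign0r mul1r mulr1 addr0.
by rewrite ffunE symd_eq symd0 eq_sym (negPf KM) !mulr0.
Qed.

Lemma cliff_mulDl : left_distributive cliff_mul +%R.
Proof.
move=> x y z; apply/ffunP=> M; rewrite [RHS]ffunE !cliff_mulE -big_split /=.
by apply: eq_bigr => K _; rewrite ffunE -mulrDr -mulrDl.
Qed.

Lemma cliff_mulDr : right_distributive cliff_mul +%R.
Proof.
move=> x y z; apply/ffunP=> M; rewrite [RHS]ffunE !cliff_mulE -big_split /=.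
by apply: eq_bigr => K _; rewrite ffunE -!mulrDr.
Qed.

Lemma cliff_oner_neq0 : cliff_basis set0 != 0.
Proof.
apply/eqP=> /ffunP/(_ set0); rewrite !ffunE eqxx => /eqP.
by rewrite oner_eq0.
Qed.

HB.instance Definition _ := GRing.Zmodule_isNzRing.Build clifford
  cliff_mulA cliff_mul1l cliff_mul1r cliff_mulDl cliff_mulDr cliff_oner_neq0.

Lemma cliff_scaleAl (a : F) x y : a *: (x * y) = (a *: x) * y.
Proof.
apply/ffunP=> M; rewrite [LHS]ffunE !cliff_mulE scaler_sumr; apply: eq_bigr => K _.
by rewrite ffunE /GRing.scale /=; ring.
Qed.

HB.instance Definition _ :=
  GRing.Lmodule_isLalgebra.Build F clifford cliff_scaleAl.

Lemma cliff_scaleAr (a : F) x y : a *: (x * y) = x * (a *: y).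
Proof.
apply/ffunP=> M; rewrite [LHS]ffunE !cliff_mulE scaler_sumr; apply: eq_bigr => K _.
by rewrite ffunE /GRing.scale /=; ring.
Qed.

HB.instance Definition _ :=
  GRing.Lalgebra_isAlgebra.Build F clifford cliff_scaleAr.

HB.instance Definition _ := Algebra_isFalgebra.Build F clifford.

Definition cliff_conj x : clifford :=
  [ffun K : {set 'I_n} =>
     if (#|K| %% 4 \in [:: 1; 2])%N then - x K else x K].

Lemma cliff_basis_mul K L :
  cliff_basis K * cliff_basis L = cliff_sign K L *: cliff_basis (symd K L).
Proof.
apply/ffunP=> M; rewrite [LHS]cliff_mulE (bigD1 K) //= big1 => [|K' K'K].
  rewrite !ffunE eqxx mul1r addr0 symd_eq.
  have [->|_] := eqVneq M; last by rewrite mulr0 scaler0.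
  by rewrite symdK.
by rewrite !ffunE (negPf K'K) mul0r mulr0.
Qed.

Lemma cliff_basis0 : cliff_basis set0 = 1.
Proof. by []. Qed.

Lemma cliff_gen_sqr (k : 'I_n) : cliff_basis [set k] ^+ 2 = -1.
Proof.
rewrite expr2 cliff_basis_mul symdd cliff_basis0 /cliff_sign.
rewrite (_ : cliff_inv _ _ = [set (k, k)]) ?cards1 ?scaleN1r //.
apply/setP=> -[i j]; rewrite !inE xpair_eqE /=.
by case: eqVneq => [->|//]; case: eqVneq => [->|//]; rewrite leqnn.
Qed.

Lemma cliff_gen_anticomm (k h : 'I_n) : k != h ->
  cliff_basis [set k] * cliff_basis [set h] =
  - (cliff_basis [set h] * cliff_basis [set k]).
Proof.
have lt_sign (i j : 'I_n) : (i < j)%N ->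
    (cliff_sign [set i] [set j] = 1) * (cliff_sign [set j] [set i] = -1).
  move=> ij; split; rewrite /cliff_sign.
    rewrite (_ : cliff_inv _ _ = set0) ?cards0 //.
    apply/setP=> -[a b]; rewrite !inE /=.
    have [->|//] := eqVneq a i; have [->|//] := eqVneq b j.
    by rewrite leqNgt ij.
  rewrite (_ : cliff_inv _ _ = [set (j, i)]) ?cards1 ?expr1 //.
  apply/setP=> -[a b]; rewrite !inE xpair_eqE /=.
  have [->|//] := eqVneq a j; have [->|//] := eqVneq b i.
  by rewrite ltnW.
rewrite !cliff_basis_mul (symdC [set h]) -scaleNr neq_ltn => /orP[] /lt_sign E.
  by rewrite !E opprK.
by rewrite !E.
Qed.

Lemma cliff_basis_prod K :
  cliff_basis K = \prod_(k <- enum K) cliff_basis [set k].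
Proof.
have: sorted ltn (map val (enum K)).
  rewrite {1}/enum_mem -enumT /=; apply: (subseq_sorted ltn_trans).
    by apply: map_subseq; apply: filter_subseq.
  by rewrite val_enum_ord iota_ltn_sorted.
have eK : [set k in enum K] = K by apply/setP=> k; rewrite inE mem_enum.
rewrite -[in cliff_basis K]eK {eK}.
elim: (enum K) => [_|k s IHs /= ks].
  by rewrite big_nil -cliff_basis0; congr cliff_basis; apply/setP=> k;
    rewrite !inE.
rewrite big_cons -{}IHs ?(path_sorted ks) // cliff_basis_mul.
have lt_ks i : i \in s -> (k < i)%N.
  move=> si; have := order_path_min ltn_trans ks.
  by move/allP; apply; apply: map_f.
have -> : cliff_sign [set k] [set i in s] = 1.
  rewrite /cliff_sign (_ : cliff_inv _ _ = set0) ?cards0 //.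
  apply/setP=> -[a b]; rewrite !inE /=; have [->|//] := eqVneq a k.
  by have [/lt_ks kb|] := boolP (b \in s); rewrite //= leqNgt kb.
rewrite scale1r; congr cliff_basis; apply/setP=> i.
rewrite in_symd !inE; have [->|//] := eqVneq i k.
by have [/lt_ks|] := boolP (k \in s); rewrite ?ltnn.
Qed.

Lemma cliff_sum x : x = \sum_K x K *: cliff_basis K.
Proof.
apply/ffunP=> L; rewrite sum_ffunE (bigD1 L) //= big1 => [|K KL].
  by rewrite !ffunE eqxx addr0 /GRing.scale /= mulr1.
by rewrite !ffunE eq_sym (negPf KL) scaler0.
Qed.

End CliffordAlgebra.

Section Components.
Variables (F : fieldType) (A : vectType F) (I : finType) (e : I -> A).

Definition component (K : I) (x : A) : F :=
  coord (codom_tuple e) (enum_rank K) x.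

Lemma component_sum (c : I -> F) K :
  basis_of fullv (codom_tuple e) ->
  component K (\sum_L c L *: e L) = c K.
Proof.
move=> /basis_free fe; rewrite /component.
rewrite (reindex (@enum_val I I)) /=; last first.
  by apply: onW_bij; exists enum_rank; [exact: enum_valK | exact: enum_rankK].
rewrite (eq_bigr (fun i => c (enum_val i) *: (codom_tuple e)`_i)) => [|i _].
  by rewrite coord_sum_free // enum_rankK.
congr (_ *: _); rewrite (nth_map (enum_val i)) -?cardE //.
by rewrite -[in RHS](enum_val_nth (enum_val i) i).
Qed.

Lemma component_basis (x : A) :
  basis_of fullv (codom_tuple e) -> x = \sum_K component K x *: e K.
Proof.
move=> be; rewrite {1}(coord_basis be (memvf x)).
rewrite (reindex (@enum_rank I)) /=; last first.
  by apply: onW_bij; exists enum_val; [exact: enum_rankK | exact: enum_valK].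
apply: eq_bigr => K _; congr (_ *: _).
by rewrite (nth_map K) -?cardE // nth_enum_rank.
Qed.

End Components.

Lemma cliff_basisP (F : fieldType) (n : nat) :
  basis_of fullv (codom_tuple (@cliff_basis F n)).
Proof.
rewrite basisEdim size_tuple; apply/andP; split.
  apply/subvP=> x _; rewrite [x]cliff_sum; apply: memv_suml => K _.
  by apply/memvZ/memv_span/codom_f.
by rewrite dimvf /dim /= muln1.
Qed.

Lemma cliff_component (F : fieldType) (n : nat) (K : {set 'I_n})
    (x : clifford F n) :
  component (@cliff_basis F n) K x = x K.
Proof. by rewrite {1}[x]cliff_sum component_sum //; apply: cliff_basisP. Qed.

Section Quaternions.
Variable F : fieldType.

(* Quat a b c d stands for a + b i + c j + d k.                               *)
Record quat : Type := Quat { quat0 : F; quat1 : F; quat2 : F; quat3 : F }.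

Definition quat_enc (x : quat) : 'rV[F]_4 :=
  \row_(i < 4) [:: quat0 x; quat1 x; quat2 x; quat3 x]`_i.

Definition quat_dec (v : 'rV[F]_4) : quat :=
  Quat (v 0 (inord 0)) (v 0 (inord 1)) (v 0 (inord 2)) (v 0 (inord 3)).

Lemma quat_encK : cancel quat_enc quat_dec.
Proof. by move=> [a b c d]; rewrite /quat_dec !mxE !inordK. Qed.

Lemma quat_decK : cancel quat_dec quat_enc.
Proof.
move=> v; apply/rowP=> i; rewrite mxE.
by case: i => [[|[|[|[|//]]]] lti]; congr (v _ _); apply/val_inj;
  rewrite /= inordK.
Qed.

HB.instance Definition _ := Choice.copy quat (can_type quat_encK).

Implicit Types x y z : quat.

Definition quat_add x y : quat :=
  let: Quat a b c d := x in let: Quat a' b' c' d' := y in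
  Quat (a + a') (b + b') (c + c') (d + d').

Definition quat_opp x : quat :=
  let: Quat a b c d := x in Quat (- a) (- b) (- c) (- d).

Definition quat_scale (s : F) x : quat :=
  let: Quat a b c d := x in Quat (s * a) (s * b) (s * c) (s * d).

Definition quat_mul x y : quat :=
  let: Quat a b c d := x in let: Quat a' b' c' d' := y in
  Quat (a * a' - b * b' - c * c' - d * d')
       (a * b' + b * a' + c * d' - d * c')
       (a * c' - b * d' + c * a' + d * b')
       (a * d' + b * c' - c * b' + d * a').

Definition quat_conj x : quat :=
  let: Quat a b c d := x in Quat a (- b) (- c) (- d).

Local Ltac quat_ring :=
  repeat (let a := fresh in let b := fresh in let c := fresh in
          let d := fresh in case => a b c d);
  rewrite /=; congr Quat; ring.

Lemma quat_addA : associative quat_add. Proof. quat_ring. Qed.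
Lemma quat_addC : commutative quat_add. Proof. quat_ring. Qed.
Lemma quat_add0 : left_id (Quat 0 0 0 0) quat_add. Proof. quat_ring. Qed.
Lemma quat_addN : left_inverse (Quat 0 0 0 0) quat_opp quat_add.
Proof. quat_ring. Qed.

HB.instance Definition _ :=
  GRing.isZmodule.Build quat quat_addA quat_addC quat_add0 quat_addN.

Lemma quat_mulA : associative quat_mul. Proof. quat_ring. Qed.
Lemma quat_mul1l : left_id (Quat 1 0 0 0) quat_mul. Proof. quat_ring. Qed.
Lemma quat_mul1r : right_id (Quat 1 0 0 0) quat_mul. Proof. quat_ring. Qed.
Lemma quat_mulDl : left_distributive quat_mul +%R. Proof. quat_ring. Qed.
Lemma quat_mulDr : right_distributive quat_mul +%R. Proof. quat_ring. Qed.
Lemma quat_oner_neq0 : Quat 1 0 0 0 != 0.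
Proof. by apply/eqP => -[] /eqP; rewrite oner_eq0. Qed.

HB.instance Definition _ := GRing.Zmodule_isNzRing.Build quat
  quat_mulA quat_mul1l quat_mul1r quat_mulDl quat_mulDr quat_oner_neq0.

Lemma quat_scaleA s t x : quat_scale s (quat_scale t x) = quat_scale (s * t) x.
Proof. move: x; quat_ring. Qed.
Lemma quat_scale1 : left_id 1 quat_scale. Proof. quat_ring. Qed.
Lemma quat_scaleDr : right_distributive quat_scale +%R.
Proof. move=> s; quat_ring. Qed.
Lemma quat_scaleDl x : {morph quat_scale^~ x : s t / s + t}.
Proof. move=> s t; move: x; quat_ring. Qed.

HB.instance Definition _ := GRing.Zmodule_isLmodule.Build F quat
  quat_scaleA quat_scale1 quat_scaleDr quat_scaleDl.

Lemma quat_scaleAl (s : F) x y : s *: (x * y) = (s *: x) * y.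
Proof. move: x y; quat_ring. Qed.

HB.instance Definition _ := GRing.Lmodule_isLalgebra.Build F quat quat_scaleAl.

Lemma quat_scaleAr (s : F) x y : s *: (x * y) = x * (s *: y).
Proof. move: x y; quat_ring. Qed.

HB.instance Definition _ := GRing.Lalgebra_isAlgebra.Build F quat quat_scaleAr.

Lemma quat_vect_axiom : Vector.axiom 4 quat.
Proof.
exists quat_enc; last by exists quat_dec; [exact: quat_encK|exact: quat_decK].
move=> s [a b c d] [a' b' c' d']; apply/rowP=> i; rewrite !mxE.
by case: i => [[|[|[|[|//]]]] lti].
Qed.

HB.instance Definition _ := Lmodule_hasFinDim.Build F quat quat_vect_axiom.

HB.instance Definition _ := Algebra_isFalgebra.Build F quat.

Definition quat_i : quat := Quat 0 1 0 0.
Definition quat_j : quat := Quat 0 0 1 0.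

Definition quat_basis (K : {set 'I_2}) : quat :=
  (if ord0 \in K then quat_j else 1) * (if ord_max \in K then quat_i else 1).

Lemma quat_basisP : basis_of fullv (codom_tuple quat_basis).
Proof.
have bE K : quat_basis K \in <<codom_tuple quat_basis>>%VS.
  by apply/memv_span/codom_f.
have b0 := bE set0; have bj := bE [set ord0]; have bi := bE [set ord_max].
have bji := bE setT; move: b0 bj bi bji; rewrite /quat_basis !inE /=.
rewrite !mul1r !mulr1 => b0 bj bi bji.
rewrite basisEdim size_tuple; apply/andP; split; last first.
  by rewrite dimvf -cardsT -powersetT card_powerset cardsT card_ord.
apply/subvP=> -[a b c d] _.
have -> : Quat a b c d =
    a *: 1 + b *: quat_i + c *: quat_j - d *: (quat_j * quat_i).
  by congr Quat; ring.
by rewrite !(rpredD, rpredN, rpredZ).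
Qed.

End Quaternions.

From mathcomp Require Import complex.
From mathcomp Require Import boolp classical_sets reals topology normedtype.
From mathcomp Require Import derive sequences.

Import numFieldNormedType.Exports.

Local Open Scope classical_set_scope.
Local Open Scope complex_scope.

Section Nash.
Variables (k : numFieldType) (m : nat).

(* h is the sum of an absolutely convergent power series near a.              *)
Definition analytic_at (h : 'rV[k]_m -> k) (a : 'rV[k]_m) : Prop :=
  exists c : mpoly.multinom m -> k, \forall x \near a,
    cvgn (norm_series c (x - a)) /\ power_series c (x - a) @ \oo --> h x.

Definition nash_on (U : set 'rV[k]_m) (h : 'rV[k]_m -> k) : Prop :=
  forall a, U a -> exists V : set 'rV[k]_m,
    [/\ open V, V a, V `<=` U, (forall b, V b -> analytic_at h b)
      & algebraic_on V h].

End Nash.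

(* R[i] seen as a numFieldType, whence its topology is inferred.              *)
Definition cplx (R : realType) : numFieldType := R[i].

Definition complex_nash (R : realType) (D : set (cplx R))
    (h : cplx R -> cplx R) : Prop :=
  nash_on [set x : 'rV[cplx R]_1 | D (x 0 0)] (fun x => h (x 0 0)).

Section SliceNash.
Variables (R : realType) (A : falgType R) (conjA : A -> A).
Variables (I : finType) (e : I -> A).
Implicit Types (D : set (cplx R)) (F : cplx R -> A) (f : A -> A) (J : A).

Definition imag_units : set A := [set J | conjA J = - J /\ J * J = -1].

Definition circular D : set A :=
  [set x | exists a b J, [/\ D (a +i* b), imag_units J & x = a%:A + b *: J]].

(* The identification of A with R^(dim A) through the basis e.                *)
Definition coordinates (x : A) : 'rV[R]_#|I| :=
  \row_i coord (codom_tuple e) i x.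

Definition real_nash (Omega : set A) (g : A -> R) : Prop :=
  forall p, Omega p -> exists V : set 'rV[R]_#|I|,
    [/\ open V, V (coordinates p)
      & exists2 G : 'rV[R]_#|I| -> R, nash_on V G &
          forall q, Omega q -> V (coordinates q) -> G (coordinates q) = g q].

(* A function F1 + iota F2 : D -> A (x) C is given by the pair of F1 and F2.  *)
Definition stem D F1 F2 : Prop :=
  forall z, D z -> F1 (conjc z) = F1 z /\ F2 (conjc z) = - F2 z.

Definition induces D F1 F2 f : Prop :=
  forall a b J, D (a +i* b) -> imag_units J ->
    f (a%:A + b *: J) = F1 (a +i* b) + J * F2 (a +i* b).

Definition along_alpha F (z : cplx R) (t : R) : 'rV[R]_#|I| :=
  coordinates (F (t +i* complex.Im z)).

Definition along_beta F (z : cplx R) (t : R) : 'rV[R]_#|I| :=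
  coordinates (F (complex.Re z +i* t)).

Definition d_alpha F (z : cplx R) : 'rV[R]_#|I| :=
  derive1 (along_alpha F z) (complex.Re z).

Definition d_beta F (z : cplx R) : 'rV[R]_#|I| :=
  derive1 (along_beta F z) (complex.Im z).

Definition C1_on D F : Prop :=
  forall z, D z ->
    [/\ derivable (along_alpha F z) (complex.Re z) 1,
        derivable (along_beta F z) (complex.Im z) 1,
        {for z, continuous (d_alpha F)} & {for z, continuous (d_beta F)}].

(* The two components of dF/dalpha + iota dF/dbeta = 0.                       *)
Definition cauchy_riemann D F1 F2 : Prop :=
  forall z, D z ->
    d_alpha F1 z - d_beta F2 z = 0 /\ d_alpha F2 z + d_beta F1 z = 0.

Definition slice_regular D f : Prop :=
  exists F1 F2, [/\ stem D F1 F2, induces D F1 F2 f, C1_on D F1, C1_on D F2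
                  & cauchy_riemann D F1 F2].

Definition of_cplx J (z : cplx R) : A :=
  (complex.Re z)%:A + complex.Im z *: J.

(* The elements 1 = JJ 0, ..., JJ u form a basis of A as a left vector space  *)
(* over C_J; this forces 2 (u + 1) = dim A.                                   *)
Definition splitting_basis J (u : nat) (JJ : 'I_u.+1 -> A) : Prop :=
  JJ ord0 = 1 /\
  forall x, exists! c : {ffun 'I_u.+1 -> cplx R},
    x = \sum_k of_cplx J (c k) * JJ k.

(* G s l k is F_{s+1,l+1}^{J,J_k}.                                            *)
Definition stem_nash D F1 F2 : Prop :=
  exists J u (JJ : 'I_u.+1 -> A) (G : 'I_2 -> 'I_2 -> 'I_u.+1 -> cplx R -> R),
    [/\ imag_units J, splitting_basis J JJ,
        forall z, D z ->
          F1 z = \sum_k of_cplx J (G 0 0 k z +i* G 0 1 k z) * JJ k /\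
          F2 z = \sum_k of_cplx J (G 1 0 k z +i* G 1 1 k z) * JJ k
      & forall l k, complex_nash D (fun z => G 0 l k z +i* G 1 l k z)].

Definition slice_nash D f : Prop :=
  exists F1 F2, [/\ stem D F1 F2, induces D F1 F2 f & stem_nash D F1 F2].

Definition nash_determining (KK : {set I}) : Prop :=
  forall D f, D !=set0 -> open D -> (forall z, D z -> D (conjc z)) ->
    slice_regular D f ->
    (forall K, K \in KK ->
       real_nash (circular D) (fun x => component e K (f x))) ->
    slice_nash D f.

Definition is_nash_number (l : nat) : Prop :=
  (exists2 KK : {set I}, #|KK| = l & nash_determining KK) /\
  (forall KK : {set I}, nash_determining KK -> (l <= #|KK|)%N).

End SliceNash.

Definition nash_number_clifford (R : realType) (n l : nat) : Prop :=
  is_nash_number (@cliff_conj R n) (@cliff_basis R n) l.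

Definition nash_number_quat (R : realType) (l : nat) : Prop :=
  is_nash_number (@quat_conj R) (@quat_basis R) l.

(* Main.v *)
Require Import Defs.
From HB Require Import structures.
From mathcomp Require Import all_boot all_order all_algebra all_field.
From mathcomp Require Import ring lra zify.
From mathcomp Require mpoly.

(** Write F = F_1 + iota F_2 for the stem function of f and
    H_M = (F_1)_M + i (F_2)_M for its complex components. By the
    Cauchy-Riemann equations each H_M is holomorphic
    ([cauchy_riemann_hol]), and f is slice-Nash as soon as each H_M is complex
    Nash ([stem_nash_components]). Everything therefore depends on how much a
    single real component f_K knows about the functions H_M.

    Let e_L be an imaginary unit and M the symmetric difference of K and L.
    Left multiplication by e_L carries only e_M to a multiple of e_K, so on the
    plane of e_L one has f_K = Re (H_K - i c H_M) with c = 1 or c = -1. Now e_L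
    is an imaginary unit exactly when |L| = 1, 2 modulo 4, and every imaginary
    unit is a combination of such e_L. So f_K involves H_K and the H_M for
    which the symmetric difference of K and M has cardinality 1 or 2 modulo 4,
    and no others. The Nash number is thus the domination number of the graph
    on the subsets of {1, ..., n} that joins K to these M.

    Sufficiency ([determining_of_reaching]). Suppose that f_K is Nash. A
    nonzero polynomial relation satisfied by f_K near a point of the plane of J
    may become trivial on that plane; dividing by the lowest power of a
    transversal parameter leaves a nonzero relation T(x, y, Re h(x + i y)) = 0
    for h = H_K - i c H_M ([plane_restriction], [nash_plane_relation]). The
    real part is removed by polarization: z and its conjugate become
    independent variables, by the identity theorem, and freezing the second one
    gives Q(z, h(z)) = 0 ([real_part_algebraic]). The unit -J gives the same
    for H_K + i c H_M, and since sums of algebraic functions are algebraic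
    ([algebraic_nearD]), both H_K and H_M are algebraic. Being holomorphic they
    are sums of convergent power series, by Cauchy's formula
    ([disc_hol_power_series]), hence complex Nash.

    Necessity ([not_determining]). If M is neither in a family nor joined to
    one of its members, then the slice regular function induced by exp(z) e_M
    has component zero at every member of the family, yet it is not slice-Nash
    because exp is transcendental ([exp_transcendental]).

    It remains to dominate the graph. The empty set suffices for n = 2; the
    empty and the full set suffice for n = 3, 4 and for n = 1 modulo 4
    ([dominating_empty_full]); the four subsets of a pair always suffice
    ([dominating_pair]). Conversely a set of three elements escapes a single
    vertex, and when n >= 6 is not 1 modulo 4 some set escapes any two given
    vertices ([undominated_sizes], [domination_gt2]). In the quaternions all
    of i, j, k are imaginary units, so the real part alone already involves
    every H_M ([quat_reaches]). *)

Set Implicit Arguments.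
Unset Strict Implicit.
Unset Printing Implicit Defensive.

Import Order.TTheory GRing.Theory Num.Theory.

Local Open Scope ring_scope.

(** * Polynomial relations and multivariate power series *)
Lemma poly_nonroot (F : numDomainType) (p : {poly F}) (s : seq F) :
  p != 0 -> uniq s -> (size p <= size s)%N -> exists2 x, x \in s & p.[x] != 0.
Proof.
move=> p0 us ps; have : ~~ all (root p) s.
  by apply: contraL ps => rs; rewrite -ltnNge; exact: max_poly_roots.
by move=> /allPn[x xs px]; exists x.
Qed.

Section Multivariate.
Import mpoly.

Section Uni.
Variables (F : numFieldType) (n : nat).
Implicit Type p : {mpoly F[n.+1]}.

Lemma mcoeff_muni p (m : 'X_{1..n.+1}) :
  ((muni p)`_(m ord_max))@_[multinom m (widen_ord (leqnSn n) i) | i < n] = p@_m.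
Proof.
rewrite muniE coef_sum raddf_sum /=.
have E (m' : 'X_{1..n.+1}) : ((p@_m' *:
  'X_[[multinom m' (widen_ord (leqnSn n) i) | i < n]]
    *: 'X^(m' ord_max))`_(m ord_max))@_[multinom m (widen_ord (leqnSn n) i) | i < n]
    = p@_m' * (m' == m)%:R.
  rewrite coefZ coefXn.
  have [mm|mm] := eqVneq (m ord_max) (m' ord_max); last first.
    rewrite mulr0 mcoeff0; have [mE|] := eqVneq m' m; last by rewrite mulr0.
    by rewrite mE eqxx in mm.
  rewrite mulr1 mcoeffZ mcoeffX; congr (_ * _%:R); congr nat_of_bool.
  apply/eqP/eqP => [/mnmP e|-> //]; apply/mnmP => i.
  have [->//|im] := eqVneq i ord_max.
  have iln : (i < n)%N by rewrite ltn_neqAle -ltnS ltn_ord andbT.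
  have := e (Ordinal iln); rewrite !mnmE (_ : widen_ord _ _ = i) //.
  exact/val_inj.
under eq_bigr do rewrite E.
have [mp|mp] := boolP (m \in msupp p).
  rewrite (bigD1_seq m) ?msupp_uniq //= eqxx mulr1 big1 ?addr0 // => m' /negPf->.
  by rewrite mulr0.
rewrite big_seq big1 => [|m' m'p]; first by rewrite (memN_msupp_eq0 mp).
by have [mE|] := eqVneq m' m; [rewrite -mE m'p in mp|rewrite mulr0].
Qed.

(** With [mcoeff_muni], this allows an induction on the number of variables: the
    last variable becomes the indeterminate of a univariate polynomial. *)
Lemma meval_muni p (v : 'I_n.+1 -> F) :
  (map_poly (meval (fun i => v (widen_ord (leqnSn n) i))) (muni p)).[v ord_max] =
    p.@[v].
Proof.
rewrite muniE mevalE raddf_sum /= horner_sum; apply: eq_bigr => m _.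
rewrite -mul_polyC rmorphM /= map_polyC /= map_polyXn hornerM hornerC hornerXn.
rewrite mevalZ mevalX big_ord_recr /= mulrA; congr (_ * _ * _).
by apply: eq_bigr => i _; rewrite mnmE.
Qed.

End Uni.

Lemma meval_nonzero (F : numFieldType) n (p : {mpoly F[n]}) : p != 0 ->
  exists v : 'I_n -> F, p.@[v] != 0.
Proof.
elim: n p => [|n IH] p; rewrite -mleadc_eq0 => p0.
  exists (fun _ => 0); apply: contra p0.
  have -> : p = (p@_(mlead p))%:MP.
    apply/mpolyP => m; rewrite mcoeffC (_ : m = 0%MM) ?eqxx ?mulr1.
      by congr (p@__); apply/mnmP => -[].
    by apply/mnmP => -[].
  by rewrite mevalC mcoeffC => /eqP ->; rewrite mul0r.
pose m := mlead p; pose k := m ord_max.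
have q0 : (muni p)`_k != 0.
  apply: contra p0 => /eqP q0.
  by rewrite -(mcoeff_muni p m) -/k q0 mcoeff0.
have [v vq] := IH _ q0.
have : map_poly (meval v) (muni p) != 0.
  apply: contra vq => /eqP/(congr1 (fun q : {poly F} => q`_k)).
  by rewrite coef_map coef0 => ->.
move=> /(@poly_nonroot _ _ [seq i%:R | i <-
  iota 0 (size (map_poly (meval v) (muni p)))])[].
- by rewrite map_inj_uniq ?iota_uniq // => i j /eqP; rewrite eqr_nat => /eqP.
- by rewrite size_map size_iota.
move=> x _ px.
exists (fun i : 'I_n.+1 => if insub (val i) is Some j then v j else x).
rewrite -meval_muni insubN ?ltnn //; move: px; congr (_.[x] != 0).
apply: eq_map_poly => q /=; apply: meval_eq => i.
by rewrite /= (valK i).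
Qed.

(** Nonvanishing, named for use where the polynomial notations are closed. *)
Definition nontrivial (F : nzRingType) n (p : {mpoly F[n]}) : bool := p != 0.

Definition eval3 (F K : nzRingType) (f : F -> K) (T : {mpoly F[3]}) (x y t : K) : K :=
  mmap f (fun i : 'I_3 => [:: x; y; t]`_i) T.

Lemma mmap_rmorph n (F : comNzRingType) (K L : nzRingType) (f : F -> K)
    (g : {rmorphism K -> L}) (h : 'I_n -> K) (p : {mpoly F[n]}) :
  g (mmap f h p) = mmap (g \o f) (g \o h) p.
Proof.
rewrite /mmap rmorph_sum; apply: eq_bigr => m _; rewrite rmorphM; congr (_ * _).
by rewrite /mmap1 rmorph_prod; apply: eq_bigr => i _; rewrite rmorphXn.
Qed.

Lemma mmap_ext n (F : nzRingType) (K : nzRingType) (f g : F -> K) (h k : 'I_n -> K)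
    (p : {mpoly F[n]}) : f =1 g -> h =1 k -> mmap f h p = mmap g k p.
Proof.
move=> fg hk; rewrite /mmap; apply: eq_bigr => m _; rewrite fg; congr (_ * _).
by rewrite /mmap1; apply: eq_bigr => i _; rewrite hk.
Qed.

Lemma eval3_rmorph (F : comNzRingType) (K L : nzRingType) (f : F -> K)
    (g : {rmorphism K -> L}) (T : {mpoly F[3]}) x y t :
  g (eval3 f T x y t) = eval3 (g \o f) T (g x) (g y) (g t).
Proof.
rewrite /eval3 mmap_rmorph; apply: mmap_ext => // i /=.
by case: i => -[|[|[|//]]].
Qed.

(** Applied below with Pr a notion of continuity, and with Pr holomorphy on a
    disc. *)
Section Eval3Closure.
Variables (X : Type) (K : nzRingType) (Pr : (X -> K) -> Prop).
Hypothesis Pext : forall u v, u =1 v -> Pr u -> Pr v.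
Hypothesis Pcst : forall c, Pr (fun _ => c).
Hypothesis PD : forall u v, Pr u -> Pr v -> Pr (fun a => u a + v a).
Hypothesis PM : forall u v, Pr u -> Pr v -> Pr (fun a => u a * v a).

Lemma closed_exp u n : Pr u -> Pr (fun a => u a ^+ n).
Proof.
move=> Pu; elim: n => [|n IH]; first by apply: Pext (Pcst 1) => a; rewrite expr0.
by apply: Pext (PM Pu IH) => a; rewrite exprS.
Qed.

Lemma closed_sum (J : Type) (r : seq J) (u : J -> X -> K) :
  (forall j, Pr (u j)) -> Pr (fun a => \sum_(j <- r) u j a).
Proof.
move=> Pu; elim: r => [|j r IH]; first by apply: Pext (Pcst 0) => a; rewrite big_nil.
by apply: Pext (PD (Pu j) IH) => a; rewrite big_cons.
Qed.

Lemma closed_prod (J : Type) (r : seq J) (u : J -> X -> K) :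
  (forall j, Pr (u j)) -> Pr (fun a => \prod_(j <- r) u j a).
Proof.
move=> Pu; elim: r => [|j r IH]; first by apply: Pext (Pcst 1) => a; rewrite big_nil.
by apply: Pext (PM (Pu j) IH) => a; rewrite big_cons.
Qed.

Lemma closed_eval3 (F : nzRingType) (f : F -> K) (T : {mpoly F[3]}) x y t :
  Pr x -> Pr y -> Pr t -> Pr (fun a => eval3 f T (x a) (y a) (t a)).
Proof.
move=> Px Py Pt; apply: closed_sum => m; apply: PM => //.
by apply: closed_prod => -[[|[|[|//]]] i3]; apply: closed_exp.
Qed.

End Eval3Closure.

(** P may vanish identically over the plane spanned by A and B. Moving off the
    plane by s v, in a direction v along which P is not identically zero,
    yields a nonzero polynomial in s; T is its lowest coefficient, and it
    vanishes on the graph of every function that satisfies P near the plane and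
    is continuous at s = 0 along v. *)
Lemma plane_restriction (F : numFieldType) m (P : {mpoly F[m + 1]}) (A B : 'rV[F]_m) :
  nontrivial P -> exists (v : 'rV[F]_m) (k n : nat)
    (T : {mpoly F[3]}) (U : nat -> {mpoly F[3]}),
    nontrivial T /\ forall x y t s,
      P.@[row_mx (x *: A + y *: B + s *: v) (const_mx t : 'M_1) 0] =
      s ^+ k * (eval3 idfun T x y t +
        s * \sum_(i < n) eval3 idfun (U i) x y t * s ^+ i).
Proof.
move=> P0; have [w Pw] := meval_nonzero P0.
pose v : 'rV[F]_m := \row_j w (lshift 1 j).
pose H (i : 'I_(m + 1)) : {poly {mpoly F[3]}} := match split i with
  | inl j => (A 0 j *: 'X_(inord 0) + B 0 j *: 'X_(inord 1))%:P + (v 0 j)%:MP *: 'X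
  | inr _ => ('X_(inord 2))%:P end.
(* P along the affine space x A + y B + s v, as a polynomial in s. *)
pose S : {poly {mpoly F[3]}} := mmap (polyC \o @mpolyC 3 F) H P.
pose e x y t : 'I_3 -> F := fun i => [:: x; y; t]`_i.
have SE x y t s : P.@[row_mx (x *: A + y *: B + s *: v) (const_mx t : 'M_1) 0] =
    (map_poly (meval (e x y t)) S).[s].
  pose g : {rmorphism {poly {mpoly F[3]}} -> F} :=
    horner_eval s \o map_poly (meval (e x y t)).
  rewrite -[RHS]/(g S) /S mmap_rmorph /meval; apply: mmap_ext => [c|i] /=.
    by rewrite /g /= /horner_eval map_polyC hornerC /= mevalC.
  rewrite /g /= /horner_eval /H mxE; case: splitP => j _; last first.
    by rewrite map_polyC hornerC /= mevalXU /e inordK // mxE.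
  rewrite rmorphD /= map_polyC /= -mul_polyC rmorphM /= map_polyC map_polyX /=.
  rewrite hornerD hornerM !hornerC hornerX mevalD !mevalZ !mevalXU mevalC.
  by rewrite /e !inordK //= !mxE; ring.
have S0 : S != 0.
  apply: contra Pw => /eqP S0.
  have := SE 0 0 (w (rshift m ord0)) 1; rewrite S0 rmorph0 horner0 => <-.
  apply/eqP; apply: meval_eq => i; rewrite !scale0r !add0r scale1r.
  by rewrite -(splitK i); case: (split i) => j /=;
    rewrite ?row_mxEl ?row_mxEr mxE // ord1.
have [k [kS ltk]] : exists k, S`_k != 0 /\ forall j, (j < k)%N -> S`_j = 0.
  have ex : exists k, S`_k != 0.
    by exists (size S).-1; rewrite -lead_coefE lead_coef_eq0.
  exists (ex_minn ex); case: ex_minnP => k Sk mink; split=> // j jk.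
  by apply/eqP; apply: contraTT jk => /mink; rewrite leqNgt.
exists v, k, (size S), S`_k, (fun i => S`_(k + i.+1)); split=> // x y t s.
have size_map : (size (map_poly (meval (e x y t)) S) <= k + (size S).+1)%N.
  by apply: leq_trans (size_poly _ _) _; rewrite addnS leqW // leq_addl.
rewrite SE (horner_coef_wide _ size_map) big_split_ord /= big1 ?add0r => [|i _];
  last first.
  by rewrite coef_map (ltk i (ltn_ord i)) /= meval0 mul0r.
rewrite big_ord_recl /= addn0 coef_map mulrDr; congr (_ + _).
  by rewrite mulrC /eval3 /meval; congr (_ * _).
rewrite !mulr_sumr; apply: eq_bigr => i _.
rewrite coef_map /= /bump add1n -[eval3 _ _ _ _ _]/(meval _ _) exprD exprS.
by rewrite /e; ring.
Qed.

Lemma bivariate_nonzero (F : numFieldType) (Q : {poly {poly F}}) : Q != 0 ->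
  exists z t, Q.[t%:P].[z] != 0.
Proof.
pose nats n : seq F := [seq i%:R | i <- iota 0 n].
have un n : uniq (nats n).
  by rewrite map_inj_uniq ?iota_uniq // => i j /eqP; rewrite eqr_nat => /eqP.
have sn n : size (nats n) = n by rewrite size_map size_iota.
rewrite -lead_coef_eq0 => /(@poly_nonroot _ _ (nats (size (lead_coef Q))))[].
- exact: un.
- by rewrite sn.
move=> z _ Qz; have : map_poly (horner_eval z) Q != 0.
  apply: contra Qz => /eqP/(congr1 (fun q : {poly F} => q`_(size Q).-1)).
  by rewrite coef_map coef0 => Qz0; apply/eqP.
move=> /(@poly_nonroot _ _ (nats (size (map_poly (horner_eval z) Q))))[].
- exact: un.
- by rewrite sn.
move=> t _ Qt; exists z, t; apply: contra Qt => /eqP Qt.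
have := horner_map (horner_eval z) Q t%:P.
by rewrite /= /horner_eval hornerC Qt => ->.
Qed.

Lemma bivariate_mpoly (F : numFieldType) (Q : {poly {poly F}}) : Q != 0 ->
  exists2 P : {mpoly F[1 + 1]}, nontrivial P & forall (x : 'rV[F]_1) t,
    P.@[row_mx x (const_mx t : 'M_1) 0] = Q.[t%:P].[x 0 0].
Proof.
move=> Q0.
pose P : {mpoly F[1 + 1]} := \sum_(i < size Q) \sum_(j < size Q`_i)
  (Q`_i)`_j *: ('X_(lshift 1 ord0) ^+ j * 'X_(rshift 1 ord0) ^+ i).
have PE (x : 'rV[F]_1) t : P.@[row_mx x (const_mx t : 'M_1) 0] = Q.[t%:P].[x 0 0].
  rewrite (horner_coef Q) horner_sum raddf_sum; apply: eq_bigr => i _ /=.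
  rewrite raddf_sum hornerM horner_coef -rmorphXn hornerC mulr_suml;
    apply: eq_bigr => j _ /=.
  by rewrite mevalZ mevalM !rmorphXn /= !mevalXU row_mxEl row_mxEr mxE mulrA.
exists P => //; have [z [t]] := bivariate_nonzero Q0; apply: contra => /eqP P0.
have := PE (const_mx z) t; rewrite P0 meval0 mxE => <-.
exact: eqxx.
Qed.

(** For kappa = 1 / (2 i), the three arguments of T are Re z, Im z and
    Re h(z) when w and c are the conjugates of z and h(z). Freezing w leaves a
    nonzero relation between z and s for all but finitely many w, uniformly
    in c: the choice s = 2 t0 - c makes the third argument equal to t0. *)
Lemma polarized_polynomial (F : numFieldType) (K : numFieldType)
    (f : {rmorphism F -> K})
    (T : {mpoly F[3]}) (kappa : K) : kappa != 0 -> nontrivial T ->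
  exists2 g : {poly K}, g != 0 & forall w, g.[w] != 0 -> forall c,
    exists2 Q : {poly {poly K}}, Q != 0 & forall z s,
      Q.[s%:P].[z] = eval3 f T ((z + w) / 2) ((z - w) * kappa) ((s + c) / 2).
Proof.
move=> k0 T0; have [v Tv] := meval_nonzero T0.
have two : 2 != 0 :> K by rewrite pnatr_eq0.
pose x0 := f (v (inord 0)); pose y0 := f (v (inord 1)); pose t0 := f (v (inord 2)).
have fT : eval3 f T x0 y0 t0 != 0.
  have -> : eval3 f T x0 y0 t0 = f (T.@[v]).
    rewrite /meval mmap_rmorph; apply: mmap_ext => //= i.
    rewrite -[in RHS](inord_val i).
    by case: i => -[|[|[|//]]].
  by rewrite fmorph_eq0.
(* The values of z and w that correspond to the point v where T is nonzero. *)
pose z0 := x0 + y0 / (2 * kappa); pose w0 := x0 - y0 / (2 * kappa).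
pose g : {poly K} := eval3 (polyC \o f) T ((z0%:P + 'X) * (2^-1)%:P)
   ((z0%:P - 'X) * kappa%:P) t0%:P.
have gE w : g.[w] = eval3 f T ((z0 + w) / 2) ((z0 - w) * kappa) t0.
  rewrite -[LHS]/(horner_eval w g) /g eval3_rmorph /= /horner_eval.
  rewrite !hornerE; apply: mmap_ext => //= c.
  by rewrite /comp !hornerC.
have g0 : g != 0.
  apply: contra fT => /eqP gz; have := gE w0; rewrite gz horner0 => ->.
  apply/eqP; congr eval3; rewrite /z0 /w0; field.
    by [].
  by rewrite k0.
exists g => // w gw c.
pose Q : {poly {poly K}} := eval3 (polyC \o (polyC \o f)) T
   ((('X + w%:P) * (2^-1)%:P)%:P) ((('X - w%:P) * kappa%:P)%:P)
   (('X + c%:P%:P) * (2^-1)%:P%:P).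
have QE z s : Q.[s%:P].[z] = eval3 f T ((z + w) / 2) ((z - w) * kappa) ((s + c) / 2).
  rewrite -[LHS]/((horner_eval z \o horner_eval s%:P) Q) /Q eval3_rmorph /=
    /horner_eval.
  rewrite !hornerE; apply: mmap_ext => //= a.
  by rewrite /comp !hornerC.
exists Q => //; apply: contra gw => /eqP Q0.
have := QE z0 (2 * t0 - c); rewrite Q0 !horner0 gE => ->.
by apply/eqP; congr eval3; field.
Qed.

Lemma monomial_homogeneous (F : numFieldType) m (nu : 'X_{1..m}) (s : F) (v : 'rV_m) :
  monomial nu (s *: v) = s ^+ (\sum_(i < m) nu i) * monomial nu v.
Proof.
rewrite /monomial (eq_bigr (fun i => s ^+ nu i * v 0 i ^+ nu i)) => [|i _].
  by rewrite big_split /= prodrXr.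
by rewrite mxE exprMn.
Qed.

(** The difference has only terms of positive degree; along a line each of them
    contains a factor s, and |s| <= s0 bounds the remaining powers. *)
Lemma power_series_line (F : realFieldType) m (c : 'X_{1..m} -> F) (v : 'rV_m)
    (s s0 : F) N : 0 < s0 -> `|s| <= s0 ->
  `|power_series c (s *: v) N - power_series c (0 *: v) N|
    <= `|s| / s0 * norm_series c (s0 *: v) N.
Proof.
move=> s00 ss0; rewrite /power_series /norm_series -sumrB mulr_sumr.
apply: le_trans (ler_norm_sum _ _ _) _; apply: ler_sum => nu _.
rewrite !monomial_homogeneous; move: (\sum_(i < m) nu i)%N => d.
case: d => [|d].
  by rewrite !expr0 subrr normr0 mulr_ge0 ?divr_ge0 // ltW.
rewrite expr0n mul0r mulr0 subr0 !normrM !normrX (gtr0_norm s00).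
have -> : `|s| / s0 * (`|c nu| * (s0 ^+ d.+1 * `|monomial nu v|)) =
    `|c nu| * ((`|s| * s0 ^+ d) * `|monomial nu v|).
  by rewrite exprS; field; rewrite gt_eqF.
rewrite ler_wpM2l // ler_wpM2r // exprS ler_wpM2l //.
by rewrite lerXn2r ?nnegrE // ltW.
Qed.

Lemma univariate_series (F : numFieldType) (c : nat -> F) :
  exists c' : 'X_{1..1} -> F, forall (y : 'rV[F]_1) N,
    power_series c' y N = \sum_(n < N) c n * y 0 0 ^+ n /\
    norm_series c' y N = \sum_(n < N) `|c n * y 0 0 ^+ n|.
Proof.
pose i0 : 'I_1 := ord0.
have degE (nu : 'X_{1..1}) : mdeg nu = nu i0 by rewrite mdegE big_ord1.
have sumE (V : nmodType) (g : nat -> V) N :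
    \sum_(nu : 'X_{1..1 < N}) g (nu i0) = \sum_(n < N) g n.
  have lt (nu : 'X_{1..1 < N}) : (nu i0 < N)%N by rewrite -degE bmdeg.
  have ub (n : 'I_N) : (mdeg (U_(i0) *+ n)%MM < N)%N.
    by rewrite degE mulmnE mnm1E eqxx mul1n.
  rewrite [RHS](reindex (fun nu : 'X_{1..1 < N} => Ordinal (lt nu))) //=.
  exists (fun n => BMultinom (ub n)) => [nu|n] _; apply/val_inj => /=.
    by apply/mnmP => i; rewrite (ord1 i) mulmnE mnm1E mul1n.
  by rewrite mulmnE mnm1E eqxx mul1n.
exists (fun nu => c (nu i0)) => y N; rewrite /power_series /norm_series /monomial.
split.
  rewrite -(sumE _ (fun n => c n * y 0 0 ^+ n)).
  by apply: eq_bigr => nu _; rewrite big_ord1.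
rewrite -(sumE _ (fun n => `|c n * y 0 0 ^+ n|)).
by apply: eq_bigr => nu _; rewrite big_ord1.
Qed.

(** The relation is the polynomial t. *)
Lemma zero_algebraic_on (F : numFieldType) m (V : 'rV[F]_m -> Prop) :
  algebraic_on V (fun _ => 0).
Proof.
exists 'X_(rshift m ord0).
  apply/eqP => /(congr1 (meval (fun _ => 1 : F))).
  by rewrite mevalXU meval0 => /eqP; rewrite oner_eq0.
by move=> x _; rewrite mevalXU row_mxEr mxE.
Qed.

Lemma mpoly_bivariate (F : numFieldType) (P : {mpoly F[1 + 1]}) : nontrivial P ->
  exists2 Q : {poly {poly F}}, Q != 0 & forall (x : 'rV[F]_1) t,
    P.@[row_mx x (const_mx t : 'M_1) 0] = Q.[t%:P].[x 0 0].
Proof.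
move=> P0; pose H (i : 'I_(1 + 1)) : {poly {poly F}} :=
  if split i is inl _ then 'X%:P else 'X.
pose Q : {poly {poly F}} := mmap (polyC \o polyC) H P.
have QE (v : 'I_(1 + 1) -> F) : P.@[v] = Q.[(v (rshift 1 ord0))%:P].[v (lshift 1 ord0)].
  pose g : {rmorphism {poly {poly F}} -> F} :=
    horner_eval (v (lshift 1 ord0)) \o horner_eval (v (rshift 1 ord0))%:P.
  rewrite -[RHS]/(g Q) /Q mmap_rmorph /meval; apply: mmap_ext => [c|i] /=.
    by rewrite /g /= /horner_eval !hornerC.
  rewrite /g /= /horner_eval /H -{1}(splitK i); case: (split i) => j /=.
    by rewrite hornerC hornerX ord1.
  by rewrite hornerX hornerC ord1.
exists Q; last by move=> x t; rewrite QE row_mxEl row_mxEr mxE.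
have [v] := meval_nonzero P0; apply: contra => /eqP Q0.
by rewrite QE Q0 !horner0.
Qed.

End Multivariate.

From mathcomp Require Import complex.
From mathcomp Require Import all_classical all_reals all_analysis.

Import Order.TTheory GRing.Theory Num.Theory.
Import numFieldNormedType.Exports.
Import Normc.

Local Open Scope classical_set_scope.
Local Open Scope ring_scope.
Local Open Scope complex_scope.

(** * Continuity of scalar-valued functions *)
Section NumFieldContinuity.
Variables (K : numFieldType) (T : topologicalType) (z : T).
Implicit Types f g : T -> K.

Lemma cont_cst (c : K) : {for z, continuous (fun _ : T => c)}.
Proof. exact: cvg_cst. Qed.

Lemma contD f g : {for z, continuous f} -> {for z, continuous g} ->
  {for z, continuous (fun x => f x + g x)}.
Proof. by move=> cf cg; apply: (@cvgD _ _ _ (nbhs z)). Qed.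

Lemma contB f g : {for z, continuous f} -> {for z, continuous g} ->
  {for z, continuous (fun x => f x - g x)}.
Proof. by move=> cf cg; apply: (@cvgB _ _ _ (nbhs z)). Qed.

Lemma contM f g : {for z, continuous f} -> {for z, continuous g} ->
  {for z, continuous (fun x => f x * g x)}.
Proof. by move=> cf cg; apply: (@cvgM _ _ (nbhs z)). Qed.

End NumFieldContinuity.

Section NumFieldGlobalContinuity.
Variables (K : numFieldType) (T : topologicalType).
Implicit Types f g : T -> K.

Lemma gcont_cst (c : K) : continuous (fun _ : T => c).
Proof. by move=> z; exact: cvg_cst. Qed.

Lemma gcontD f g : continuous f -> continuous g ->
  continuous (fun x => f x + g x).
Proof. by move=> cf cg z; apply: contD; [exact: cf|exact: cg]. Qed.

Lemma gcontB f g : continuous f -> continuous g ->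
  continuous (fun x => f x - g x).
Proof. by move=> cf cg z; apply: contB; [exact: cf|exact: cg]. Qed.

Lemma gcontM f g : continuous f -> continuous g ->
  continuous (fun x => f x * g x).
Proof. by move=> cf cg z; apply: contM; [exact: cf|exact: cg]. Qed.

End NumFieldGlobalContinuity.

Section ComplexBasics.
Variable R : realType.
Local Notation C := (cplx R).
Implicit Types (z w : C).

Lemma normc_norm z : `|z| = (normc z)%:C :> C. Proof. by []. Qed.

Lemma normc_real (x : R) : normc (x%:C : C) = `|x|.
Proof. by rewrite /= expr0n /= addr0 sqrtr_sqr. Qed.

Lemma normc_ge0 z : 0 <= normc z.
Proof. by case: z => a b; rewrite sqrtr_ge0. Qed.

Lemma normc_conj z : normc (conjc z : C) = normc z.
Proof. by case: z => a b /=; rewrite sqrrN. Qed.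

Lemma normRe z : `|complex.Re z| <= normc z.
Proof.
by case: z => a b /=; rewrite -sqrtr_sqr ler_wsqrtr// lerDl sqr_ge0.
Qed.

Lemma normIm z : `|complex.Im z| <= normc z.
Proof.
by case: z => a b /=; rewrite -sqrtr_sqr ler_wsqrtr// lerDr sqr_ge0.
Qed.

Lemma normc_le z : normc z <= `|complex.Re z| + `|complex.Im z|.
Proof.
case: z => a b; rewrite /= -(normc_real a) -(normc_real b).
rewrite [X in _ <= _ + X](_ : _ = normc (0 +i* b : C)); last first.
  by rewrite /= expr0n /= addr0 add0r.
by apply: le_trans (le_normcD _ _); rewrite /= addr0 add0r.
Qed.

Lemma nbhs_cplx z (U : set C) :
  nbhs z U <-> exists2 e : R, 0 < e & forall w, normc (w - z) < e -> U w.
Proof.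
split=> [/nbhs_ballP[e e0 eU]|[e e0 eU]].
  have e_real : e = (complex.Re e)%:C.
    by rewrite RRe_real // gtr0_real.
  exists (complex.Re e) => [|w ew]; first by move: e0; rewrite /= ltcE => /andP[].
  by apply: eU; rewrite /ball /= e_real distrC normc_norm ltcR.
apply/nbhs_ballP; exists e%:C; first by rewrite /= ltcR.
by move=> w; rewrite /ball /= distrC normc_norm ltcR => /eU.
Qed.

Lemma near_normc z (e : R) : 0 < e -> \forall w \near z, normc (w - z) < e.
Proof. by move=> e0; apply/nbhs_cplx; exists e. Qed.

Lemma cvg_cplx (T : Type) (F : set_system T) (FF : Filter F) (f : T -> C) (l : C) :
  f @ F --> l <-> forall e : R, 0 < e -> \forall x \near F, normc (f x - l) < e.
Proof.
split=> [fl e e0|fl]; first exact: fl (near_normc l e0).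
by move=> U /nbhs_cplx[e e0 eU]; near=> x; apply: eU; near: x; exact: fl.
Unshelve. all: by end_near. Qed.

Lemma cvg_Re (T : Type) (F : set_system T) (FF : Filter F) (f : T -> C) (l : C) :
  f @ F --> l -> complex.Re (f x) @[x --> F] --> complex.Re l.
Proof.
move=> /cvg_cplx fl; apply/cvgrPdist_lt => e /fl; apply: filterS => x.
apply: le_lt_trans; rewrite distrC (le_trans _ (normRe _)) //.
by rewrite raddfB.
Qed.

Lemma cvg_Im (T : Type) (F : set_system T) (FF : Filter F) (f : T -> C) (l : C) :
  f @ F --> l -> complex.Im (f x) @[x --> F] --> complex.Im l.
Proof.
move=> /cvg_cplx fl; apply/cvgrPdist_lt => e /fl; apply: filterS => x.
apply: le_lt_trans; rewrite distrC (le_trans _ (normIm _)) //.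
by rewrite raddfB.
Qed.

Lemma cvg_Complex (T : Type) (F : set_system T) (FF : Filter F)
    (f g : T -> R) (a b : R) :
  f @ F --> a -> g @ F --> b -> (f x +i* g x : C) @[x --> F] --> (a +i* b : C).
Proof.
move=> /cvgrPdist_lt fa /cvgrPdist_lt gb; apply/cvg_cplx => e e0; near=> x.
apply: le_lt_trans (normc_le _) _ => /=; rewrite [e]splitr.
by apply: ltrD; rewrite distrC; near: x; [apply: fa|apply: gb];
  rewrite divr_gt0.
Unshelve. all: by end_near. Qed.

Lemma cvg_real_complex (T : Type) (F : set_system T) (FF : Filter F)
    (f : T -> R) (a : R) :
  f @ F --> a -> ((f x)%:C : C) @[x --> F] --> (a%:C : C).
Proof. by move=> fa; apply: cvg_Complex => //; exact: cvg_cst. Qed.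

Lemma cvg_conjc (T : Type) (F : set_system T) (FF : Filter F) (f : T -> C) (l : C) :
  f @ F --> l -> (conjc (f x) : C) @[x --> F] --> (conjc l : C).
Proof.
move=> /cvg_cplx fl; apply/cvg_cplx => e /fl; apply: filterS => x.
by rewrite -rmorphB normc_conj.
Qed.

Section Continuity.
Variables (T : topologicalType) (z : T).
Implicit Types f g : T -> C.

Lemma cont_real (f : T -> R) : {for z, continuous f} ->
  {for z, continuous (fun x => (f x)%:C : C)}.
Proof. exact: cvg_real_complex. Qed.

Lemma cont_conjc f : {for z, continuous f} ->
  {for z, continuous (fun x => conjc (f x) : C)}.
Proof. exact: cvg_conjc. Qed.

Lemma cont_Re f : {for z, continuous f} ->
  {for z, continuous (fun x => complex.Re (f x))}.
Proof. exact: cvg_Re. Qed.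

Lemma cont_Im f : {for z, continuous f} ->
  {for z, continuous (fun x => complex.Im (f x))}.
Proof. exact: cvg_Im. Qed.

Lemma cont_Complex (f g : T -> R) : {for z, continuous f} ->
  {for z, continuous g} -> {for z, continuous (fun x => f x +i* g x : C)}.
Proof. exact: cvg_Complex. Qed.

End Continuity.

Lemma cont_id (T : topologicalType) (z : T) : {for z, continuous (fun x : T => x)}.
Proof. exact: cvg_id. Qed.

Lemma cont_comp (T U V : topologicalType) (f : T -> U) (g : U -> V) (z : T) :
  {for z, continuous f} -> {for f z, continuous g} ->
  {for z, continuous (fun x => g (f x))}.
Proof. exact: continuous_comp. Qed.

End ComplexBasics.

(** * Derivatives in Caratheodory form *)
Section Derivative.
Variable K : numFieldType.
Implicit Types (z w d a b : K) (f g : K -> K).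

(** Caratheodory's form of the derivative: the difference quotient extends to a
    function that is continuous at z. The product and chain rules reduce to the
    continuity of products and composites, without division. *)
Definition cderive (f : K -> K) z d := exists q : K -> K,
  [/\ forall w, f w - f z = q w * (w - z), {for z, continuous q} & q z = d].

Lemma cderive_continuous f z d : cderive f z d -> {for z, continuous f}.
Proof.
case=> q [fq cq _].
have -> : f = (fun w => f z + q w * (w - z)).
  by apply/funext => w; rewrite -fq addrC subrK.
apply: contD; first exact: cont_cst.
apply: contM; first exact: cq.
by apply: contB; [exact: cont_id|exact: cont_cst].
Qed.

Lemma cderive_cst c z : cderive (fun _ => c) z 0.
Proof.
exists (fun=> 0); split=> //; first by move=> w; rewrite subrr mul0r.
exact: cont_cst.
Qed.

Lemma cderive_id z : cderive id z 1.
Proof.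
exists (fun=> 1); split=> //; first by move=> w; rewrite mul1r.
exact: cont_cst.
Qed.

Lemma cderiveD f g z a b : cderive f z a -> cderive g z b -> cderive (f \+ g) z (a + b).
Proof.
move=> [q [fq cq <-]] [r [gr cr <-]]; exists (q \+ r); split=> //.
  by move=> w /=; rewrite mulrDl -fq -gr; ring.
by apply: contD; [exact: cq|exact: cr].
Qed.

Lemma cderiveM f g z a b : cderive f z a -> cderive g z b ->
  cderive (f \* g) z (a * g z + f z * b).
Proof.
move=> df dg; have cg := cderive_continuous dg.
move: df dg => [q [fq cq <-]] [r [gr cr <-]].
exists (fun w => q w * g w + f z * r w); split=> //.
  move=> w /=; rewrite mulrDl mulrAC -fq -[f z * r w * _]mulrA -gr; ring.
by apply: contD; apply: contM => //; exact: cont_cst.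
Qed.

Lemma cderive_affine f z a b d : cderive f (a * z + b) d ->
  cderive (fun w => f (a * w + b)) z (d * a).
Proof.
move=> [q [fq cq <-]]; exists (fun w => q (a * w + b) * a); split=> //.
  by move=> w; rewrite fq -[RHS]mulrA; congr (_ * _); ring.
apply: contM; last exact: cont_cst.
apply: (@cont_comp K K K (fun w => a * w + b) q) => //.
by apply: contD; last exact: cont_cst; apply: contM; [exact: cont_cst|exact: cont_id].
Qed.

End Derivative.

Section CDer.
Variable R : realType.
Local Notation C := (cplx R).
Implicit Types (z w d : C) (x y t s : R).

Definition rderive (p : R -> C) t d := exists q : R -> C,
  [/\ forall s, p s - p t = q s * (s - t)%:C, {for t, continuous q} & q t = d].

(** Conjugating argument and value preserves holomorphy: this is the reflected
    function that stands for the conjugate of f in polarization. *)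
Lemma cderive_conj f z d : cderive f (conjc z) d ->
  cderive (fun w => conjc (f (conjc w))) z (conjc d).
Proof.
move=> [q [fq cq <-]]; exists (fun w => conjc (q (conjc w))); split.
- by move=> w; rewrite -rmorphB fq rmorphM rmorphB /= !conjcK.
- apply: cont_conjc; apply: (@cont_comp C C C (fun w => conjc w) q); last exact: cq.
  by apply: cont_conjc; exact: cont_id.
- by [].
Qed.

Lemma rderive_continuous p t d : rderive p t d -> {for t, continuous p}.
Proof.
case=> q [fq cq _].
have -> : p = (fun s => p t + q s * (s - t)%:C).
  by apply/funext => w; rewrite -fq addrC subrK.
apply: contD; first exact: cont_cst.
apply: contM; first exact: cq.
apply: cont_real.
by apply: contB; [exact: cont_id|exact: cont_cst].
Qed.

Lemma rderiveD p r t a b : rderive p t a -> rderive r t b -> rderive (p \+ r) t (a + b).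
Proof.
move=> [q [fq cq <-]] [q' [gr cr <-]]; exists (q \+ q'); split.
- by move=> w /=; rewrite mulrDl -fq -gr; ring.
- by apply: contD; [exact: cq|exact: cr].
- by [].
Qed.

Lemma rderiveM p r t a b : rderive p t a -> rderive r t b ->
  rderive (p \* r) t (a * r t + p t * b).
Proof.
move=> df dg; have cg := rderive_continuous dg.
move: df dg => [q [fq cq <-]] [q' [gr cr <-]].
exists (fun s => q s * r s + p t * q' s); split.
- move=> w /=; rewrite mulrDl mulrAC -fq -[p t * q' w * _]mulrA -gr; ring.
- apply: contD; apply: contM; [exact: cq|exact: cg|exact: cont_cst|exact: cr].
- by [].
Qed.

Lemma rderive_cst c t : rderive (fun _ => c) t 0.
Proof.
exists (fun=> 0); split; [|exact: cont_cst|by []].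
by move=> w; rewrite subrr mul0r.
Qed.

Lemma rderive_real t : rderive (fun s => s%:C) t 1.
Proof.
exists (fun=> 1); split; [|exact: cont_cst|by []].
by move=> w; rewrite mul1r rmorphB.
Qed.

Lemma cderive_comp h p t d e : cderive h (p t) d -> rderive p t e ->
  rderive (h \o p) t (d * e).
Proof.
move=> [q [hq cq <-]] dp; have cp := rderive_continuous dp.
move: dp => [r [pr cr <-]]; exists (fun s => q (p s) * r s); split.
- by move=> s /=; rewrite hq pr mulrA.
- by apply: contM; [exact: cont_comp cp cq|exact: cr].
- by [].
Qed.

Lemma rderiveP p t d : rderive p t d <->
  is_derive t 1 (fun x => complex.Re (p x)) (complex.Re d) /\
  is_derive t 1 (fun x => complex.Im (p x)) (complex.Im d).
Proof.
split=> [[q [pq cq <-]]|].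
  split; apply/is_derive1_caratheodory.
    exists (fun s => complex.Re (q s)); split; [|exact: cont_Re|by []].
    by move=> s /=; rewrite -raddfB pq /=; case: (q s) => a b; simpc.
  exists (fun s => complex.Im (q s)); split; [|exact: cont_Im|by []].
  by move=> s /=; rewrite -raddfB pq /=; case: (q s) => a b; simpc.
case=> /is_derive1_caratheodory[q [pq cq qt]] /is_derive1_caratheodory[r [pr cr rt]].
exists (fun s => q s +i* r s); split.
- move=> s; apply/eqP; rewrite eq_complex /=; simpc.
  by rewrite -pq -pr /= !raddfB !eqxx.
- exact: cont_Complex.
- by rewrite qt rt; case: (d).
Qed.

End CDer.

(** * Integrals over a period *)
Section CircleIntegral.
Variable R : realType.
Local Notation C := (cplx R).
Local Notation mu := (@lebesgue_measure R).
Local Notation tau := (pi *+ 2 : R).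

(** The interval [0, 2 pi] parametrizes the circle in Cauchy's formula. *)
Definition rint (f : R -> R) : R := (\int[mu]_(x in `[0%R, tau]) f x)%R.

Lemma tau_gt0 : 0 < tau. Proof. by rewrite mulrn_wgt0 // pi_gt0. Qed.

Lemma rint_integrable (f : R -> R) : continuous f ->
  mu.-integrable `[0%R, tau] (EFin \o f).
Proof.
move=> cf; apply: continuous_compact_integrable; first exact: segment_compact.
exact: continuous_subspaceT.
Qed.

Lemma rintD (f g : R -> R) : continuous f -> continuous g ->
  rint (fun x => f x + g x) = rint f + rint g.
Proof. by move=> cf cg; rewrite /rint RintegralD //; exact: rint_integrable. Qed.

Lemma rintZ (c : R) (f : R -> R) : continuous f ->
  rint (fun x => c * f x) = c * rint f.
Proof. by move=> cf; rewrite /rint RintegralZl //; exact: rint_integrable. Qed.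

Lemma rint_cst (c : R) : rint (fun _ => c) = c * tau.
Proof.
rewrite /rint Rintegral_cst //= lebesgue_measure_itv /= lte_fin tau_gt0.
by rewrite oppr0 adde0.
Qed.

Lemma rint_bound (f : R -> R) (M : R) : continuous f -> (forall x, `|f x| <= M) ->
  `|rint f| <= M * tau.
Proof.
move=> cf fM; rewrite -rint_cst.
apply: le_trans (le_normr_Rintegral _ _) _ => //; first exact: rint_integrable.
apply: le_Rintegral => //.
  by apply: (@rint_integrable (fun x => `|f x|)) => x;
    apply: continuous_comp (@norm_continuous _ _ _); exact: cf.
by apply: rint_integrable => x; exact: cvg_cst.
Qed.

Lemma rint_FTC (F f : R -> R) : continuous f ->
  (forall x : R, is_derive x 1 F (f x)) -> rint f = F tau - F 0.
Proof.
move=> cf dF; have cF : continuous F.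
  by move=> x; apply: differentiable_continuous; apply/derivable1_diffP; case: (dF x).
rewrite /rint /Rintegral (@continuous_FTC2 _ f F) //; first exact: tau_gt0.
- exact: continuous_subspaceT.
- split.
  + by move=> x _; case: (dF x).
  + by apply: cvg_at_right_filter; exact: cF.
  + by apply: cvg_at_left_filter; exact: cF.
- by move=> x _; rewrite derive1E; apply: derive_val.
Qed.

Lemma rint_der (f f' : R -> R -> R) (u v M : R) :
  (forall t, t \in `]u, v[ -> continuous (f t)) ->
  (forall t x, t \in `]u, v[ -> is_derive t 1 (f^~ x) (f' t x)) ->
  (forall t x, t \in `]u, v[ -> `|f' t x| <= M) ->
  forall t, t \in `]u, v[ -> is_derive t 1 (fun s => rint (f s)) (rint (f' t)).
Proof.
move=> cf df f'M t tuv.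
have p1 s x : s \in `]u, v[ -> partial1of2 f s x = f' s x.
  by move=> /(df s x) ?; rewrite partial1of2E; apply: derive_val.
have M0 : 0 <= M by apply: le_trans (f'M t 0 tuv).
have int s : `]u, v[%classic s -> mu.-integrable `[0%R, tau] (EFin \o f s).
  by move=> suv; apply: rint_integrable; exact: cf.
have der s x : `]u, v[%classic s -> `[0, tau]%classic x -> derivable (f^~ x) s 1.
  by move=> suv _; case: (df s x suv).
have intM : mu.-integrable `[0%R, tau] (EFin \o (fun=> M)).
  by apply: rint_integrable => x; exact: cvg_cst.
have bnd s x : `]u, v[%classic s -> `[0, tau]%classic x ->
  `|partial1of2 f s x| <= (fun=> M) x.
  by move=> suv _; rewrite p1 // f'M.
have mI : measurable `[0%R, tau] by [].
have D := @derivable_under_integral R _ _ mu f _ mI _ u v tuv int der (fun=> M)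
  (fun=> M0) intM bnd.
apply: DeriveDef; first exact: D.
have E := @differentiation_under_integral R _ _ mu f _ mI _ u v tuv int der (fun=> M)
  (fun=> M0) intM bnd.
rewrite -derive1E [LHS]E /rint.
by apply: eq_Rintegral => x _; rewrite p1.
Qed.

Definition cint (f : R -> C) : C :=
  rint (fun x => complex.Re (f x)) +i* rint (fun x => complex.Im (f x)).

Implicit Types f g : R -> C.

Lemma eq_cint f g : f =1 g -> cint f = cint g. Proof. by move/funext=> ->. Qed.

Lemma cintD f g : continuous f -> continuous g ->
  cint (fun x => f x + g x) = cint f + cint g.
Proof.
move=> cf cg; apply/eqP; rewrite eq_complex /=; apply/andP; split; apply/eqP.
- rewrite -rintD; first by congr rint; apply/funext => x; case: (f x) (g x) => ? ? [].
  +
  by move=> x; apply: cont_Re; exact: cf.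
  + by move=> x; apply: cont_Re; exact: cg.
- rewrite -rintD; first by congr rint; apply/funext => x; case: (f x) (g x) => ? ? [].
  + by move=> x; apply: cont_Im; exact: cf.
  + by move=> x; apply: cont_Im; exact: cg.
Qed.

Lemma cintZ c f : continuous f -> cint (fun x => c * f x) = c * cint f.
Proof.
move=> cf; have cR : continuous (fun x => complex.Re (f x))
  by move=> x; apply: cont_Re; exact: cf.
have cI : continuous (fun x => complex.Im (f x)) by move=> x; apply: cont_Im; exact: cf.
case: c => a b; apply/eqP; rewrite eq_complex /=; apply/andP; split; apply/eqP.
  rewrite -mulNr -!rintZ // -rintD; first last.
  - by move=> x; apply: cvgM; [exact: cvg_cst|exact: cI].
  - by move=> x; apply: cvgM; [exact: cvg_cst|exact: cR].
  by congr rint; apply/funext => x /=; case: (f x) => p q /=; rewrite mulNr.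
rewrite -!rintZ // -rintD; first last.
- by move=> x; apply: cvgM; [exact: cvg_cst|exact: cR].
- by move=> x; apply: cvgM; [exact: cvg_cst|exact: cI].
by congr rint; apply/funext => x /=; case: (f x).
Qed.

Lemma cint_bound f (M : R) : continuous f -> (forall x, normc (f x) <= M) ->
  normc (cint f) <= M * (tau *+ 2).
Proof.
move=> cf fM; apply: le_trans (normc_le _) _ => /=; rewrite mulrnAr mulr2n.
apply: lerD; apply: rint_bound.
-
  by move=> x; apply: cont_Re; exact: cf.
- by move=> x; apply: le_trans (normRe _) (fM x).
- by move=> x; apply: cont_Im; exact: cf.
- by move=> x; apply: le_trans (normIm _) (fM x).
Qed.

Lemma cint_FTC F f : continuous f -> (forall x, rderive F x (f x)) ->
  cint f = F tau - F 0.
Proof.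
move=> cf dF; apply/eqP; rewrite eq_complex !raddfB /=; apply/andP; split; apply/eqP.
  apply: (rint_FTC (F := fun x => complex.Re (F x))) ; first
  by move=> x; apply: cont_Re; exact: cf.
  move=> x.
  by case/rderiveP: (dF x).
apply: (rint_FTC (F := fun x => complex.Im (F x))) ; first by move=> x;
  apply: cont_Im; exact: cf.
move=> x.
by case/rderiveP: (dF x).
Qed.

Lemma cint_der (f f' : R -> R -> C) (u v M : R) :
  (forall t, t \in `]u, v[ -> continuous (f t)) ->
  (forall t x, t \in `]u, v[ -> rderive (f^~ x) t (f' t x)) ->
  (forall t x, t \in `]u, v[ -> normc (f' t x) <= M) ->
  forall t, t \in `]u, v[ -> rderive (fun s => cint (f s)) t (cint (f' t)).
Proof.
move=> cf df f'M t tuv; apply/rderiveP; split => /=.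
  apply: (rint_der (f := fun s x => complex.Re (f s x))
    (f' := fun s x => complex.Re (f' s x)) (u := u) (v := v) (M := M)) => //.
  - by move=> s suv x; apply: cont_Re; exact: cf.
  - by move=> s x suv; case/rderiveP: (df s x suv).
  - by move=> s x suv; apply: le_trans (normRe _) (f'M s x suv).
apply: (rint_der (f := fun s x => complex.Im (f s x))
    (f' := fun s x => complex.Im (f' s x)) (u := u) (v := v) (M := M)) => //.
- by move=> s suv x; apply: cont_Im; exact: cf.
- by move=> s x suv; case/rderiveP: (df s x suv).
- by move=> s x suv; apply: le_trans (normIm _) (f'M s x suv).
Qed.

End CircleIntegral.

Section Closure.
Variables (K : numFieldType) (T : topologicalType) (z : T).

Lemma cont_inv (f : T -> K) :
  f z != 0 -> {for z, continuous f} -> {for z, continuous (fun x => (f x)^-1)}.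
Proof. by move=> f0 cf; apply: (@cvgV _ _ (nbhs z)). Qed.

Lemma contX (f : T -> K) n :
  {for z, continuous f} -> {for z, continuous (fun x => f x ^+ n)}.
Proof.
move=> cf; elim: n => [|n IH].
  rewrite (_ : (fun _ => _) = fun=> 1); first exact: cont_cst.
  by apply/funext => x; rewrite expr0.
rewrite (_ : (fun _ => _) = fun x => f x * f x ^+ n); first exact: contM.
by apply/funext => x; rewrite exprS.
Qed.

End Closure.

Lemma gcontX (K : numFieldType) (T : topologicalType) (f : T -> K) n :
  continuous f -> continuous (fun x => f x ^+ n).
Proof. by move=> cf z; apply: contX; exact: cf. Qed.

Lemma gcont_inv (K : numFieldType) (T : topologicalType) (f : T -> K) :
  (forall x, f x != 0) -> continuous f -> continuous (fun x => (f x)^-1).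
Proof. by move=> f0 cf z; apply: cont_inv; [exact: f0|exact: cf]. Qed.

(** * Cauchy's formula and power series expansion *)
Section CauchyFormula.
Variable R : realType.
Local Notation C := (cplx R).
Local Notation tau := (pi *+ 2 : R).
Local Notation I := ('i%C : C).

Lemma eq0_geometric (x B q : R) : 0 <= x -> 0 <= q < 1 ->
  (forall N, x <= B * q ^+ N) -> x = 0.
Proof.
move=> x0 /andP[q0 q1] xB; apply/eqP; rewrite eq_le x0 andbT.
have : (fun N => B * q ^+ N) @ \oo --> (B * 0 : R).
  by apply: cvgM; [exact: cvg_cst|apply: cvg_expr; rewrite ger0_norm].
by rewrite mulr0 => /cvgr_to_ge; apply; exact: nearW.
Qed.

Lemma rderive_eq (p : R -> C) t d e : rderive p t d -> d = e -> rderive p t e.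
Proof. by move=> H <-. Qed.

Definition circ (x : R) : C := cos x +i* sin x.
Definition circJ (x : R) : C := cos x +i* - sin x.

Lemma sqrI : I * I = -1. Proof. by rewrite -expr2 sqr_i. Qed.
Lemma I_neq0 : I != 0.
Proof. by apply/eqP => /(congr1 (fun z => z * z)) /eqP;
  rewrite sqrI mulr0 oppr_eq0 oner_eq0. Qed.

Lemma circ_tau : circ tau = circ 0.
Proof. by rewrite /circ cos2pi sin2pi cos0 sin0. Qed.

Lemma circJ_tau : circJ tau = circJ 0.
Proof. by rewrite /circJ cos2pi sin2pi cos0 sin0. Qed.

Lemma circ_circJ x : circ x * circJ x = 1.
Proof.
apply/eqP; rewrite eq_complex /=; apply/andP; split; apply/eqP.
  by rewrite mulrN opprK -!expr2 cos2Dsin2.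
by rewrite mulrN mulrC addNr.
Qed.

Lemma normc_circ x : normc (circ x) = 1.
Proof. by rewrite /= cos2Dsin2 sqrtr1. Qed.

Lemma normc_circJ x : normc (circJ x) = 1.
Proof. by rewrite /= sqrrN cos2Dsin2 sqrtr1. Qed.

Lemma rderive_circ x : rderive circ x (I * circ x).
Proof.
apply/rderiveP; split => /=.
  by rewrite mul0r mul1r sub0r; exact: is_derive_cos.
by rewrite mul0r mul1r add0r; exact: is_derive_sin.
Qed.

Lemma rderive_circJ x : rderive circJ x (- I * circJ x).
Proof.
apply/rderiveP; split => /=.
  rewrite oppr0 mul0r mulN1r opprK sub0r; exact: is_derive_cos.
rewrite oppr0 mul0r mulN1r add0r; apply: is_deriveN; exact: is_derive_sin.
Qed.

Lemma rderive_circJX n x : rderive (fun y => circJ y ^+ n) x (- I *+ n * circJ x ^+ n).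
Proof.
elim: n => [|n IH].
  rewrite mulr0n mul0r (_ : (fun _ => _) = fun=> 1); first exact: rderive_cst.
  by apply/funext => y; rewrite expr0.
rewrite (_ : (fun _ => _) = circJ \* (fun y => circJ y ^+ n)); last first.
  by apply/funext => y; rewrite exprS.
apply: rderive_eq (rderiveM (rderive_circJ x) IH) _.
by rewrite exprS mulrS; ring.
Qed.

Lemma cont_circ : continuous circ.
Proof. by move=> x; apply: rderive_continuous (rderive_circ x). Qed.

Lemma cont_circJ : continuous circJ.
Proof. by move=> x; apply: rderive_continuous (rderive_circJ x). Qed.

Lemma cint_cst (c : C) : cint (fun _ => c) = c * tau%:C.
Proof.
case: c => a b; rewrite /cint !rint_cst; apply/eqP; rewrite eq_complex /=.
by rewrite !mulr0 subr0 add0r !eqxx.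
Qed.

Lemma cint_circJX n : cint (fun x => circJ x ^+ n.+1) = 0.
Proof.
have n0 : - I *+ n.+1 != 0 by rewrite mulrn_eq0 oppr_eq0 (negPf I_neq0).
have cX m : continuous (fun x => circJ x ^+ m).
  by apply: gcontX; exact: cont_circJ.
apply: (mulfI n0); rewrite mulr0 -cintZ; last exact: cX.
rewrite (cint_FTC (F := fun x => circJ x ^+ n.+1)).
- by rewrite circJ_tau subrr.
- by apply: gcontM; [exact: gcont_cst|exact: cX].
- by move=> x; exact: rderive_circJX.
Qed.

Section Kernel.
Variables (r : R) (z : C).
Hypotheses (r0 : 0 < r) (zr : normc z < r).

Let q (x : R) : C := z / r%:C * circJ x.
Let k : R := normc z / r.

(** On the circle w = r exp(i x), dw / (w - z) is i times this kernel times dx. *)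
Definition kernel (x : R) : C := (1 - q x)^-1.

Lemma kernel_ratio : 0 <= k < 1.
Proof. by rewrite divr_ge0 ?normc_ge0 ?ltW //= ltr_pdivrMr // mul1r. Qed.

Let normc_q x : normc (q x) = k.
Proof.
by rewrite /q !normcM normc_circJ mulr1 normcV normc_real gtr0_norm.
Qed.

Let oneq_neq0 x : 1 - q x != 0.
Proof.
rewrite subr_eq0; apply/eqP => /(congr1 (@normc R)); rewrite normc_q normc1 => k1.
by have /andP[_] := kernel_ratio; rewrite -k1 ltxx.
Qed.

Lemma kernelE x : (r%:C * circ x - z) * kernel x = r%:C * circ x.
Proof.
rewrite -[RHS](mulfK (oneq_neq0 x)); congr (_ * _).
have rC : r%:C != 0 :> C by rewrite eq_complex /= eqxx andbT gt_eqF.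
rewrite mulrBr mulr1 /q; congr (_ - _).
rewrite [RHS](_ : _ = (r%:C / r%:C) * z * (circ x * circJ x)); last by ring.
by rewrite circ_circJ divff // mul1r mulr1.
Qed.

Lemma cont_q : continuous q.
Proof. by apply: gcontM; [exact: gcont_cst|exact: cont_circJ]. Qed.

Lemma cont_kernel : continuous kernel.
Proof.
apply: gcont_inv; first exact: oneq_neq0.
by apply: gcontB; [exact: gcont_cst|exact: cont_q].
Qed.

Lemma normc_kernel x : normc (kernel x) <= (1 - k)^-1.
Proof.
have /andP[_ k1] := kernel_ratio.
rewrite /kernel normcV lef_pV2 ?posrE ?subr_gt0 //.
  have := le_normcD (1 - q x) (q x); rewrite subrK normc1 normc_q; lra.
rewrite lt_neqAle normc_ge0 andbT eq_sym; apply: contra (oneq_neq0 x).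
by move=> /eqP/eq0_normc ->.
Qed.

Definition cauchy_coeff (g : R -> C) n : C :=
  cint (fun x => g x * circJ x ^+ n) / r%:C ^+ n.

(** The geometric series of the kernel with exact remainder: stopping after N
    terms leaves q^N times the kernel, which is of modulus at most
    k^N / (1 - k). *)
Lemma cint_kernel_expansion (g : R -> C) (M : R) N :
  continuous g -> (forall x, normc (g x) <= M) ->
  normc (cint (fun x => g x * kernel x) - \sum_(n < N) cauchy_coeff g n * z ^+ n)
    <= M * (1 - k)^-1 * (tau *+ 2) * k ^+ N.
Proof.
move=> cg gM.
have cX n : continuous (fun x => g x * circJ x ^+ n).
  by apply: gcontM; [exact: cg|apply: gcontX; exact: cont_circJ].
have crem n : continuous (fun x => g x * (q x ^+ n * kernel x)).
  apply: gcontM; first exact: cg.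
  by apply: gcontM; [apply: gcontX; exact: cont_q|exact: cont_kernel].
have -> : cint (fun x => g x * kernel x) - \sum_(n < N) cauchy_coeff g n * z ^+ n =
    cint (fun x => g x * (q x ^+ N * kernel x)).
  elim: N => [|N IH].
    by rewrite big_ord0 subr0; apply: eq_cint => x; rewrite expr0 mul1r.
  rewrite big_ord_recr /= opprD addrA IH; apply/eqP; rewrite subr_eq; apply/eqP.
  rewrite (_ : cauchy_coeff g N * z ^+ N =
    cint (fun x => (z / r%:C) ^+ N * (g x * circJ x ^+ N))); last first.
    by rewrite cintZ; [rewrite expr_div_n /cauchy_coeff; ring|exact: cX].
  rewrite -cintD; [|exact: crem|by apply: gcontM; [exact: gcont_cst|exact: cX]].
    apply: eq_cint => x.
    rewrite -[X in _ = _ + X](_ : g x * q x ^+ N = _); last first.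
      by rewrite /q exprMn; ring.
    rewrite -{1}[kernel x](_ : q x * kernel x + 1 = _); last first.
      by rewrite -[X in _ + X](mulVf (oneq_neq0 x)) -/(kernel x); ring.
    by rewrite exprSr; ring.
apply: le_trans (cint_bound (M := M * (1 - k)^-1 * k ^+ N) _ _) _.
- exact: crem.
- move=> x; rewrite !normcM -mulrA; apply: ler_pM; rewrite ?normc_ge0 //.
    by rewrite mulr_ge0 // normc_ge0.
  rewrite mulrC; apply: ler_pM; rewrite ?normc_ge0 //; first exact: normc_kernel.
  by elim: N => [|N IH]; rewrite ?expr0 ?normc1 // !exprS normcM normc_q
    ler_wpM2l // (andP kernel_ratio).1.
- by rewrite le_eqVlt; apply/orP; left; apply/eqP; ring.
Qed.

(** In the expansion for g = 1 every term but the first integrates a nontrivial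
    power of exp(-i x) over a period. *)
Lemma cint_kernel : cint kernel = tau%:C.
Proof.
apply/eqP; rewrite -subr_eq0; apply/eqP/eq0_normc.
apply: (@eq0_geometric _ (1 * (1 - k)^-1 * (tau *+ 2) * k) k).
- exact: normc_ge0.
- exact: kernel_ratio.
move=> N; rewrite -[_ * k * _]mulrA -exprS.
have c1 : continuous (fun _ : R => 1 : C) by exact: gcont_cst.
have b1 (x : R) : normc (1 : C) <= 1 by rewrite normc1.
have := cint_kernel_expansion N.+1 c1 b1.
rewrite big_ord_recl big1 => [|n _].
  rewrite expr0 mulr1 addr0 /cauchy_coeff expr0 divr1.
  rewrite (_ : (fun x => 1 * kernel x) = kernel); last by apply/funext => x;
    rewrite mul1r.
  rewrite (_ : (fun x => 1 * _) = fun=> 1); last by apply/funext => x;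
    rewrite expr0 mul1r.
  by rewrite cint_cst mul1r.
rewrite /cauchy_coeff (_ : (fun x => 1 * _) = fun x => circJ x ^+ n.+1); last first.
  by apply/funext => x; rewrite mul1r.
by rewrite cint_circJX !mul0r.
Qed.

End Kernel.

(** The derivative is required to be continuous and both functions to be
    bounded on the disc, which is what differentiation under the integral sign
    consumes. *)
Definition disc_hol (rho : R) (h : C -> C) := exists (h' : C -> C) (M : R),
  forall z, normc z < rho -> [/\ cderive h z (h' z), {for z, continuous h'},
    normc (h z) <= M & normc (h' z) <= M].

Lemma const_rderive0 (f : R -> C) (e : R) : 0 < e ->
  (forall t, t \in `]- e, (1 + e)[ -> rderive f t 0) -> f 1 = f 0.
Proof.
move=> e0 df.
have cst (g : R -> R) : (forall t, t \in `]- e, (1 + e)[ -> is_derive t 1 g 0) ->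
    g 1 = g 0.
  move=> dg; apply/eqP; rewrite -subr_eq0; apply/eqP.
  have dg' (x : R) : x \in `]0, 1[ -> is_derive x 1 g 0.
    by rewrite in_itv /= => /andP[x0 x1]; apply: dg; rewrite in_itv /=; lra.
  have [|c _ ->] := MVT (@ltr01 R) dg'; last by rewrite mul0r.
  apply: derivable_within_continuous => x; rewrite in_itv /= => /andP[x0 x1].
  have : is_derive x 1 g 0 by apply: dg; rewrite in_itv /=; lra.
  by case.
have R0 := cst (fun t => complex.Re (f t)).
have I0 := cst (fun t => complex.Im (f t)).
apply/eqP; rewrite eq_complex; apply/andP; split; apply/eqP.
  by apply: R0 => t te; case/rderiveP: (df t te).
by apply: I0 => t te; case/rderiveP: (df t te).
Qed.

Section Cauchy.
Variables (rho r M : R) (h h' : C -> C) (z : C).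
Hypotheses (r0 : 0 < r) (rrho : r < rho) (zr : normc z < r).
Hypothesis hH : forall z, normc z < rho -> [/\ cderive h z (h' z),
  {for z, continuous h'}, normc (h z) <= M & normc (h' z) <= M].

(* The circle is contracted to z; the parameter may slightly leave [0, 1], by
   less than e, without leaving the disc of radius rho. *)
Let p (t x : R) : C := z + t%:C * (r%:C * circ x - z).
Let e : R := (rho - r) / (4 * r).

Let e0 : 0 < e.
Proof. by rewrite divr_gt0 ?mulr_gt0 ?subr_gt0. Qed.

Let p_in t x : t \in `]- e, (1 + e)[ -> normc (p t x) < rho.
Proof.
rewrite in_itv /= => /andP[t0 t1].
have -> : p t x = (1 - t)%:C * z + t%:C * (r%:C * circ x).
  by rewrite /p rmorphB rmorph1; ring.
apply: le_lt_trans (le_normcD _ _) _.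
rewrite !normcM !normc_real normc_circ mulr1 (gtr0_norm r0).
have er : e * r = (rho - r) / 4 by rewrite /e; field; rewrite gt_eqF.
have zr' : `|1 - t| * normc z <= `|1 - t| * r by rewrite ler_wpM2l // ltW.
have : (`|1 - t| + `|t|) * r <= (1 + 2 * e) * r.
  apply: ler_wpM2r; first exact: ltW.
  move: (e) e0 t0 t1 => e' e'0 t0 t1.
  case: (ger0P t) => ?; case: (ger0P (1 - t)) => ?; lra.
rewrite (_ : (1 + 2 * e) * r = r + 2 * (e * r)); last by ring.
rewrite er mulrDl; move: rrho; lra.
Qed.

Let rderive_p_t t x : rderive (p^~ x) t (r%:C * circ x - z).
Proof.
apply: rderive_eq (rderiveD (rderive_cst z t)
  (rderiveM (rderive_real t) (rderive_cst (r%:C * circ x - z) t))) _.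
by rewrite mulr0 addr0 mul1r add0r.
Qed.

Let rderive_p_x t x : rderive (p t) x (t%:C * r%:C * (I * circ x)).
Proof.
have -> : p t = (fun _ : R => z - t%:C * z) \+ ((fun _ : R => t%:C * r%:C) \* @circ).
  by apply/funext => y; rewrite /p /=; ring.
apply: rderive_eq (rderiveD (rderive_cst _ x) (rderiveM (rderive_cst _ x)
  (rderive_circ x))) _.
by rewrite mul0r !add0r.
Qed.

Let cont_hp t : t \in `]- e, (1 + e)[ -> continuous (fun x => h (p t x)).
Proof.
move=> te x; have [dh _ _ _] := hH (p_in x te).
by apply: rderive_continuous (cderive_comp dh (rderive_p_x t x)).
Qed.

Let cont_h'p t : t \in `]- e, (1 + e)[ -> continuous (fun x => h' (p t x)).
Proof.
move=> te x; have [_ ch _ _] := hH (p_in x te).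
by apply: (@cont_comp _ _ _ (p t) h' x);
  [apply: rderive_continuous (rderive_p_x t x)|exact: ch].
Qed.

Let dint0 t : t \in `]- e, (1 + e)[ ->
  cint (fun x => h' (p t x) * (r%:C * circ x)) = 0.
Proof.
move=> te.
have cI : continuous (fun x => h' (p t x) * (r%:C * circ x)).
  apply: gcontM; first exact: cont_h'p.
  by apply: gcontM; [exact: gcont_cst|exact: cont_circ].
have [t0|t0] := eqVneq t 0.
  have pz x : p t x = z by rewrite /p t0 mul0r addr0.
  rewrite (cint_FTC (F := fun x => (h' z * r%:C / I) * circ x)).
  - by rewrite circ_tau subrr.
  - exact: cI.
  - move=> x; apply: rderive_eq (rderiveM (rderive_cst _ x) (rderive_circ x)) _.
    by rewrite pz; field; exact: I_neq0.
have tC : t%:C != 0 :> C by rewrite eq_complex /= eqxx andbT.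
rewrite (cint_FTC (F := fun x => (t%:C * I)^-1 * h (p t x))).
- by rewrite /p circ_tau subrr.
- exact: cI.
- move=> x; have [dh _ _ _] := hH (p_in x te).
  apply: rderive_eq (rderiveM (rderive_cst _ x) (cderive_comp dh (rderive_p_x t x))) _.
  by field; rewrite I_neq0.
Qed.

(** Contract the circle to z through p t. The t-derivative of the integral of
    h (p t x) against the kernel is the integral of h' (p t x) r exp(i x), since
    the kernel cancels the factor r exp(i x) - z; up to the constant i t this
    is an x-derivative, so it integrates to zero over the period. Hence the
    integral is the same for t = 1 and for t = 0, where the integrand is h z
    times the kernel. *)
Lemma cauchy_formula :
  h z * tau%:C = cint (fun x => h (r%:C * circ x) * kernel r z x).
Proof.
pose f t : C := cint (fun x => h (p t x) * kernel r z x).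
have ck := cont_kernel r0 zr.
have : f 1 = f 0.
  apply: (const_rderive0 e0) => t te; rewrite -(dint0 te).
  apply: (cint_der (f := fun s x => h (p s x) * kernel r z x)
     (f' := fun s x => h' (p s x) * (r%:C * circ x)) (u := - e) (v := 1 + e)
     (M := M * r)).
  - by move=> s se; apply: gcontM; [exact: cont_hp|exact: ck].
  - move=> s x se; have [dh _ _ _] := hH (p_in x se).
    have D := rderiveM (cderive_comp (p := p^~ x) dh (rderive_p_t s x)) (rderive_cst
      (kernel r z x) s).
    by apply: (rderive_eq D); rewrite mulr0 addr0 -mulrA kernelE.
  - move=> s x se; have [_ _ _ bh] := hH (p_in x se).
    rewrite !normcM normc_circ mulr1 normc_real (gtr0_norm r0).
    by rewrite ler_wpM2r // ltW.
  - exact: te.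
rewrite {}/f => fE.
rewrite -(cint_kernel r0 zr) -cintZ; last exact: ck.
rewrite (_ : (fun x => h z * _) = fun x => h (p 0 x) * kernel r z x); last first.
  by apply/funext => x; rewrite /p mul0r addr0.
by rewrite -fE; apply: eq_cint => x; rewrite /p mul1r addrC subrK.
Qed.

End Cauchy.

Theorem hol_power_series rho r h : 0 < r < rho -> disc_hol rho h ->
  exists (c : nat -> C) (B : R),
    [/\ 0 <= B, forall n, normc (c n) * r ^+ n <= B &
      forall z N, normc z < r ->
        normc (h z - \sum_(n < N) c n * z ^+ n) <=
          B * (1 - normc z / r)^-1 * (normc z / r) ^+ N].
Proof.
move=> /andP[r0 rrho] [h' [M hH]].
have tauC : tau%:C != 0 :> C by rewrite eq_complex /= eqxx andbT gt_eqF ?tau_gt0.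
pose g (x : R) : C := h (r%:C * circ x).
have inr x : normc (r%:C * circ x) < rho.
  by rewrite normcM normc_circ mulr1 normc_real gtr0_norm.
have cg : continuous g.
  move=> x; have [dh _ _ _] := hH _ (inr x).
  have dp := rderiveM (rderive_cst (r%:C : C) x) (rderive_circ x).
  by apply: rderive_continuous (cderive_comp (p := fun y => r%:C * circ y) dh dp).
have gM x : normc (g x) <= M by have [] := hH _ (inr x).
have M0 : 0 <= M by apply: le_trans (gM 0); exact: normc_ge0.
have ntau : normc (tau%:C^-1 : C) = tau^-1.
  by rewrite normcV normc_real gtr0_norm // tau_gt0.
exists (fun n => tau%:C^-1 * cauchy_coeff r g n), (2 * M); split.
- by rewrite mulr_ge0.
- move=> n; rewrite /cauchy_coeff !normcM ntau normcV.
  have -> : normc (r%:C ^+ n : C) = r ^+ n.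
    by rewrite -rmorphXn normc_real gtr0_norm // exprn_gt0.
  rewrite mulrA mulfVK ?gt_eqF ?exprn_gt0 // mulrC ler_pdivrMr ?tau_gt0 //.
  apply: le_trans (cint_bound (M := M) _ _) _.
  + by apply: gcontM; [exact: cg|apply: gcontX; exact: cont_circJ].
  + move=> x; rewrite normcM (_ : normc (circJ x ^+ n) = 1) ?mulr1 //.
    by elim: n => [|n IH]; rewrite ?expr0 ?normc1 // exprS normcM normc_circJ mul1r.
  + by rewrite le_eqVlt; apply/orP; left; apply/eqP; ring.
- move=> z N zr.
  have -> : h z - \sum_(n < N) tau%:C^-1 * cauchy_coeff r g n * z ^+ n =
      tau%:C^-1 * (cint (fun x => g x * kernel r z x) -
        \sum_(n < N) cauchy_coeff r g n * z ^+ n).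
    rewrite mulrBr mulr_sumr -(cauchy_formula r0 rrho zr hH) [_ * (h z * _)]mulrC.
    rewrite mulfK //; congr (_ - _).
    by apply: eq_bigr => n _; rewrite -mulrA.
  rewrite normcM ntau mulrC ler_pdivrMr ?tau_gt0 //.
  apply: le_trans (cint_kernel_expansion r0 zr N cg gM) _.
  by rewrite le_eqVlt; apply/orP; left; apply/eqP; ring.
Qed.

End CauchyFormula.

(** * Algebraic functions of one variable *)
Section IntegralLead.
Variables (A : idomainType) (K : comNzRingType) (f : {rmorphism A -> K}).

(** With l the leading coefficient and d + 1 the degree, multiplying the relation
    by l^d turns it into a monic relation for l u. *)
Lemma integral_lead_mul (Q : {poly A}) (u : K) : Q != 0 ->
  (map_poly f Q).[u] = 0 -> integralOver f (f (lead_coef Q) * u).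
Proof.
move=> Q0; pose l := lead_coef Q; have [d sQ] : exists d, size Q = d.+1.
  by exists (size Q).-1; rewrite prednK // lt0n size_poly_eq0.
have lE : Q`_d = l by rewrite /l lead_coefE sQ.
have sfQ : (size (map_poly f Q) <= d.+1)%N by rewrite -sQ size_poly.
rewrite (horner_coef_wide _ sfQ) big_ord_recr /= => rel.
case: d => [|d] in sQ lE sfQ rel *.
  move: rel; rewrite big_ord0 add0r expr0 mulr1 coef_map lE -/l => ->.
  rewrite mul0r. exact: (mxpoly.integral0 f).
pose q : {poly A} := \poly_(i < d.+1) (Q`_i * l ^+ (d - i)).
pose p : {poly A} := 'X^(d.+1) + q.
exists p.
  by rewrite monicE /p lead_coefDl ?lead_coefXn // size_polyXn ltnS size_poly.
have : f l ^+ d * (\sum_(i < d.+1) (map_poly f Q)`_i * u ^+ i + (map_poly f Q)`_d.+1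
  * u ^+ d.+1) = 0.
  by rewrite rel mulr0.
rewrite /root /p rmorphD /= map_polyXn hornerD hornerXn => <-; apply/eqP.
rewrite addrC mulrDr coef_map lE; congr (_ + _); last by rewrite exprMn exprS; ring.
have sp : (size (map_poly f q) <= d.+1)%N.
  by apply: leq_trans (size_poly _ _) _; exact: size_poly.
rewrite (horner_coef_wide _ sp) mulr_sumr; apply: eq_bigr => i _.
rewrite !coef_map /=.
have -> : q`_i = Q`_i * l ^+ (d - i) by rewrite coef_poly ltn_ord.
rewrite rmorphM rmorphXn exprMn -/l.
have -> : f l ^+ d = f l ^+ (d - i) * f l ^+ i by rewrite -exprD subnK // -ltnS.
by ring.
Qed.

End IntegralLead.

Section AlgebraicFunctions.
Variable R : realType.
Local Notation C := (cplx R).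

(** The graph of h near a lies on the zero set of a nonzero Q(z, t), read as a
    polynomial in t with coefficients in C[z]. *)
Definition algebraic_near (h : C -> C) (a : C) := exists2 Q : {poly {poly C}},
  Q != 0 & \forall z \near a, Q.[(h z)%:P].[z] = 0.

(** Algebraic functions are treated as integral elements over the image of C[z]
    in the ring of all functions on C. *)
Definition polyfun (l : {poly C}) : C -> C := fun z => l.[z].

Lemma polyfun_zmod_morphism : zmod_morphism polyfun.
Proof. by move=> p q; apply/funext => z; rewrite /polyfun hornerD hornerN. Qed.

Lemma polyfun_monoid_morphism : monoid_morphism polyfun.
Proof.
by split=> [|p q]; apply/funext => z; rewrite /polyfun ?hornerC ?hornerM.
Qed.

HB.instance Definition _ := GRing.isZmodMorphism.Build {poly C} (C -> C) polyfun
  polyfun_zmod_morphism.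
HB.instance Definition _ := GRing.isMonoidMorphism.Build {poly C} (C -> C) polyfun
  polyfun_monoid_morphism.

Lemma horner_polyfun (p : {poly {poly C}}) (u : C -> C) z :
  (map_poly polyfun p).[u] z = p.[(u z)%:P].[z].
Proof.
rewrite (horner_coef_wide _ (size_poly _ _)) (horner_coef p) horner_sum fct_sumE.
apply: eq_bigr => i _.
by rewrite coef_map hornerM -rmorphXn hornerC /= exprfctE.
Qed.

Lemma horner2_ext (p : {poly {poly C}}) (u v : {poly C}) z :
  u.[z] = v.[z] -> p.[u].[z] = p.[v].[z].
Proof.
move=> uv; rewrite -[LHS]/(horner_eval z p.[u]) -[RHS]/(horner_eval z p.[v]).
by rewrite -!horner_map /= /horner_eval uv.
Qed.

(** Integral elements form a ring, so a combination of l1 h1 and l2 h2 with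
    polynomial coefficients satisfies a monic p. Substituting (l1 l2) X in p
    gives a relation for c1 h1 + c2 h2 that is nonzero because p is monic and
    l1 l2 is nonzero. *)
Lemma algebraic_nearD (h1 h2 : C -> C) a c1 c2 :
  algebraic_near h1 a -> algebraic_near h2 a ->
  algebraic_near (fun z => c1 * h1 z + c2 * h2 z) a.
Proof.
move=> [Q1 Q10 V1] [Q2 Q20 V2].
(* Integrality concerns functions on all of C, while the relations hold only near
   a: away from them h is replaced by 0, a root of Q * 'X. *)
pose mask (h : C -> C) (Q : {poly {poly C}}) z :=
  if Q.[(h z)%:P].[z] == 0 then h z else 0.
have int h (Q : {poly {poly C}}) : Q != 0 ->
    integralOver polyfun (polyfun (lead_coef Q) * mask h Q).
  move=> Q0; rewrite -(lead_coefMX Q); apply: integral_lead_mul.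
    by rewrite mulf_neq0 // polyX_eq0.
  apply/funext => z; rewrite horner_polyfun hornerM hornerX hornerM hornerC /mask.
  by case: eqP => [->|_]; rewrite ?mul0r ?mulr0.
have ic c : integralOver polyfun (polyfun c%:P) by exact: integral_id.
have ip c : integralOver polyfun (polyfun c) by exact: integral_id.
set l1 := lead_coef Q1; set l2 := lead_coef Q2.
have := integral_add
  (integral_mul (integral_mul (ic c1) (ip l2)) (int h1 Q1 Q10))
  (integral_mul (integral_mul (ic c2) (ip l1)) (int h2 Q2 Q20)).
case=> p pm pr; pose Q := p \Po ((l1 * l2) *: 'X).
have l0 : l1 * l2 != 0 by rewrite mulf_neq0 ?lead_coef_eq0.
exists Q.
  by rewrite comp_poly2_eq0 ?monic_neq0 // size_scale // size_polyX.
near=> z.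
have E1 : Q1.[(h1 z)%:P].[z] = 0 by near: z.
have E2 : Q2.[(h2 z)%:P].[z] = 0 by near: z.
have /(congr1 (fun u : C -> C => u z)) := eqP pr.
rewrite horner_polyfun /Q horner_comp hornerZ hornerX => E.
rewrite -[RHS]E; apply: horner2_ext.
rewrite !hornerM !hornerC !(mulrfctE, addrfctE) /polyfun /mask E1 E2 eqxx !hornerC.
by ring.
Unshelve. all: by end_near. Qed.

End AlgebraicFunctions.

Lemma cont_leibniz (K : numFieldType) (f g f' g' : K -> K) z :
  {for z, continuous f'} -> {for z, continuous g} -> {for z, continuous f} ->
  {for z, continuous g'} -> {for z, continuous (fun w => f' w * g w + f w * g' w)}.
Proof.
by move=> cf' cg cf cg'; apply: contD; apply: contM;
  [exact: cf'|exact: cg|exact: cf|exact: cg'].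
Qed.

Lemma cont_affine (K : numFieldType) (a b : K) : continuous (fun w : K => a * w + b).
Proof.
apply: gcontD; last exact: gcont_cst.
by apply: gcontM; [exact: gcont_cst|move=> w; exact: cont_id].
Qed.

(** * Holomorphic functions on a disc and the identity theorem *)
Section HolClosure.
Variable R : realType.
Local Notation C := (cplx R).
Local Notation I := ('i%C : C).

Lemma hol_cst (rho : R) (c : C) : disc_hol rho (fun _ => c).
Proof.
exists (fun _ => 0), (normc c) => z _; split;
  [exact: cderive_cst|exact: cont_cst|by []|].
by rewrite normc0 normc_ge0.
Qed.

Lemma hol_id (rho : R) : disc_hol rho id.
Proof.
exists (fun _ => 1), (`|rho| + 1) => z zr; split;
  [exact: cderive_id|exact: cont_cst| |].
  by have := ler_norm rho; move: zr => /=; lra.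
by rewrite normc1; have := normr_ge0 rho; lra.
Qed.

Lemma holD (rho : R) (f g : C -> C) : disc_hol rho f -> disc_hol rho g ->
  disc_hol rho (fun z => f z + g z).
Proof.
move=> [f' [M fH]] [g' [N gH]]; exists (fun z => f' z + g' z), (M + N) => z zr.
have [df cf bf bf'] := fH z zr; have [dg cg bg bg'] := gH z zr; split.
- exact: cderiveD.
- by apply: contD; [exact: cf|exact: cg].
- by apply: le_trans (le_normcD _ _) _; exact: lerD.
- by apply: le_trans (le_normcD _ _) _; exact: lerD.
Qed.

Lemma holM (rho : R) (f g : C -> C) : disc_hol rho f -> disc_hol rho g ->
  disc_hol rho (fun z => f z * g z).
Proof.
move=> [f' [M fH]] [g' [N gH]].
exists (fun z => f' z * g z + f z * g' z), (2 * (`|M| * `|N|)) => z zr.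
have [df cf bf bf'] := fH z zr; have [dg cg bg bg'] := gH z zr.
have bnd u v : normc u <= M -> normc v <= N -> normc (u * v) <= `|M| * `|N|.
  move=> uM vN; rewrite normcM; apply: ler_pM; rewrite ?normc_ge0 //.
    exact: le_trans uM (ler_norm _).
  exact: le_trans vN (ler_norm _).
split.
- exact: cderiveM.
- exact: cont_leibniz cf (cderive_continuous dg) (cderive_continuous df) cg.
- apply: le_trans (bnd _ _ bf bg) _.
  by rewrite ler_peMl ?mulr_ge0 // ler1n.
- apply: le_trans (le_normcD _ _) _; rewrite mulr_natl mulr2n.
  by apply: lerD; apply: bnd.
Qed.

Lemma hol_affine (rho r : R) (f : C -> C) (a b : C) : disc_hol rho f ->
  (forall z, normc z < r -> normc (a * z + b) < rho) ->
  disc_hol r (fun z => f (a * z + b)).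
Proof.
move=> [f' [M fH]] rr; exists (fun z => f' (a * z + b) * a), (`|M| * (1 + normc a)).
move=> z /rr zr; have [df cf bf bf'] := fH _ zr.
have M0 : 0 <= `|M| by []. have a0 := normc_ge0 a. have MM := ler_norm M.
split.
- exact: cderive_affine.
- apply: contM; last exact: cont_cst.
  by apply: (@cont_comp C C C (fun w => a * w + b) f'); [exact: cont_affine|exact: cf].
- by apply: le_trans bf _; nra.
- rewrite normcM; apply: (@le_trans _ _ (M * normc a)); last by nra.
  exact: ler_wpM2r.
Qed.

Lemma hol_conj (rho : R) (f : C -> C) : disc_hol rho f ->
  disc_hol rho (fun z => conjc (f (conjc z))).
Proof.
move=> [f' [M fH]]; exists (fun z => conjc (f' (conjc z))), M => z zr.
have [|df cf bf bf'] := fH (conjc z); first by rewrite normc_conj.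
split.
- exact: cderive_conj.
- apply: cont_conjc; apply: (@cont_comp C C C (fun w => conjc w) f'); last exact: cf.
  by apply: cont_conjc; exact: cont_id.
- by rewrite normc_conj.
- by rewrite normc_conj.
Qed.

Lemma eq0_small (a k d : R) : 0 <= a -> 0 < d ->
  (forall x, 0 < x < d -> a <= k * x) -> a = 0.
Proof.
move=> a0 d0 ak; apply/eqP; rewrite eq_le a0 andbT leNgt; apply/negP => a1.
have k0 : 0 < k.
  have /ak : 0 < d / 2 < d by lra.
  by move=> h; rewrite -(pmulr_lgt0 k (x := d / 2)) ?(lt_le_trans a1 h) // divr_gt0.
pose x := Num.min (d / 2) (a / (2 * k)).
have x0 : 0 < x by rewrite lt_min !divr_gt0 // mulr_gt0.
have /ak : 0 < x < d by rewrite x0 /= /x gt_min; apply/orP; left; lra.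
apply/negP; rewrite -ltNge; apply: (@le_lt_trans _ _ (k * (a / (2 * k)))).
  by rewrite ler_pM2l // /x ge_min lexx orbT.
by rewrite (_ : _ * _ = a / 2); [lra|field; rewrite gt_eqF].
Qed.

(** By induction every power series coefficient is zero: once the earlier ones
    are, the Taylor estimate at a small real x bounds the next one by a multiple
    of x. *)
Lemma identity_theorem (rho : R) (f : C -> C) : disc_hol rho f ->
  (forall x : R, `|x| < rho -> f x%:C = 0) ->
  forall z, normc z < rho -> f z = 0.
Proof.
move=> fH f0 z zrho; pose r := (normc z + rho) / 2.
have z0 := normc_ge0 z.
have zr : normc z < r by rewrite /r; lra.
have r0 : 0 < r by lra.
have rr : 0 < r < rho by rewrite r0 /r; lra.
have [c [B [B0 _ cH]]] := hol_power_series rr fH.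
have c0 n : c n = 0.
  elim/ltn_ind: n => n IH; apply: eq0_normc.
  apply: (@eq0_small _ (B * 2 / r ^+ n.+1) (r / 2)).
  - exact: normc_ge0.
  - by rewrite divr_gt0.
  move=> x /andP[x0 xr].
  have nx : normc (x%:C : C) = x by rewrite normc_real gtr0_norm.
  have xr' : normc (x%:C : C) < r by rewrite nx; lra.
  have sE : \sum_(i < n.+1) c i * x%:C ^+ i = c n * x%:C ^+ n.
    by rewrite big_ord_recr /= big1 ?add0r // => i _; rewrite IH // mul0r.
  have := cH x%:C n.+1 xr'; rewrite sE nx f0; last first.
    by rewrite gtr0_norm //; case/andP: rr; lra.
  rewrite sub0r normcN normcM -rmorphXn normc_real gtr0_norm ?exprn_gt0 // => h.
  rewrite -(ler_pM2r (x := x ^+ n)) ?exprn_gt0 //; apply: le_trans h _.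
  rewrite expr_div_n exprS.
  have -> : B * 2 / r ^+ n.+1 * x * x ^+ n = B * 2 * (x * x ^+ n / r ^+ n.+1).
    by ring.
  rewrite ler_wpM2r //.
    by rewrite divr_ge0 ?mulr_ge0 ?exprn_ge0 // ltW.
  rewrite ler_wpM2l // -[leRHS]invrK lef_pV2 ?posrE //; last first.
    by rewrite subr_gt0 ltr_pdivrMr // mul1r; lra.
  have : x / r <= 2^-1 by rewrite ler_pdivrMr //; lra.
  lra.
apply: eq0_normc; apply: (@eq0_geometric _ _ (B * (1 - normc z / r)^-1) (normc z / r)).
- exact: normc_ge0.
- by rewrite divr_ge0 ?(ltW r0) //= ltr_pdivrMr // mul1r.
move=> N; have := cH z N zr; rewrite big1 ?subr0 // => i _.
by rewrite c0 mul0r.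
Qed.

End HolClosure.

(** * Polarization *)
Section Polarization.
Variable R : realType.
Local Notation C := (cplx R).
Local Notation I := ('i%C : C).

Let toC : {rmorphism R -> C} := real_complex R.
Let kappa : C := (2 * I)^-1.

Lemma twoI_neq0 : 2 * I != 0 :> C.
Proof. by rewrite mulf_neq0 ?pnatr_eq0 ?I_neq0. Qed.

Lemma normc_2 : normc (2%:R : C) = 2.
Proof. by rewrite -(rmorph_nat toC 2) normc_real ger0_norm. Qed.

Lemma normc_I : normc I = 1.
Proof. by rewrite /= expr0n expr1n add0r sqrtr1. Qed.

Lemma hol_eval3 (rho : R) (T : mpoly.mpoly 3 R) (x y t : C -> C) :
  disc_hol rho x -> disc_hol rho y -> disc_hol rho t ->
  disc_hol rho (fun z => eval3 toC T (x z) (y z) (t z)).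
Proof.
apply: closed_eval3.
- by move=> u v /funext ->.
- by move=> c; exact: hol_cst.
- by move=> u v; exact: holD.
- by move=> u v; exact: holM.
Qed.

Section Relation.
Variables (rho : R) (h : C -> C) (a : C) (T : mpoly.mpoly 3 R).
Hypotheses (rho0 : 0 < rho) (hH : disc_hol rho h).
Hypothesis rel : forall z, normc z < rho ->
  eval3 idfun T (complex.Re (a + z)) (complex.Im (a + z)) (complex.Re (h z)) = 0.

(* With w the conjugate of z, G z w is the complexified left side of rel: w
   stands for the conjugate of z and hJ w for that of h z. *)
Let hJ (w : C) : C := conjc (h (conjc w)).
Let G (z w : C) : C := eval3 toC T ((a + z + (conjc a + w)) / 2)
  ((a + z - (conjc a + w)) * kappa) ((h z + hJ w) / 2).

Lemma polarize_real (x y : R) : normc (x%:C + I * y%:C : C) < rho ->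
  G (x%:C + I * y%:C) (x%:C - I * y%:C) = 0.
Proof.
move=> xyr; have := rel xyr; set z : C := x%:C + I * y%:C => relz.
have -> : x%:C - I * y%:C = conjc z :> C.
  by rewrite /z; apply/eqP; rewrite eq_complex /=; apply/andP; split; apply/eqP; ring.
rewrite /G /hJ conjcK.
have -> : (a + z + (conjc a + conjc z)) / 2 = toC (complex.Re (a + z)).
  by rewrite -rmorphD /= ReJ_add.
have -> : (a + z - (conjc a + conjc z)) * kappa = toC (complex.Im (a + z)).
  rewrite -rmorphD /= [RHS]ImJ_sub /kappa invfM.
  have -> : I^-1 = - I.
    by apply: (mulIf (@I_neq0 R)); rewrite mulVf ?I_neq0 // mulNr -expr2 sqr_i opprK.
  by ring.
have -> : (h z + conjc (h z)) / 2 = toC (complex.Re (h z)).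
  by rewrite /= ReJ_add.
have := congr1 toC relz; rewrite rmorph0 => <-.
by rewrite eval3_rmorph.
Qed.

Let halfdisc (X Y : C) : normc X < rho / 2 -> normc Y < rho / 2 ->
  normc (X + I * Y) < rho /\ normc (X - I * Y) < rho.
Proof.
move=> Xr Yr; split; apply: le_lt_trans (le_normcD _ _) _;
  rewrite ?normcN normcM normc_I mul1r; lra.
Qed.

Let holJ : disc_hol rho hJ. Proof. exact: hol_conj. Qed.

Let hol_G (X0 Y0 a1 b1 : C) :
  (forall z, normc z < rho / 2 ->
    normc (a1 * z + X0) < rho /\ normc (b1 * z + Y0) < rho) ->
  disc_hol (rho / 2) (fun z => G (a1 * z + X0) (b1 * z + Y0)).
Proof.
move=> hd.
have hz : disc_hol (rho / 2) (fun z => a1 * z + X0).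
  by apply: holD; [apply: holM; [exact: hol_cst|exact: hol_id]|exact: hol_cst].
have hw : disc_hol (rho / 2) (fun z => b1 * z + Y0).
  by apply: holD; [apply: holM; [exact: hol_cst|exact: hol_id]|exact: hol_cst].
have hN : disc_hol (rho / 2) (fun z => - (conjc a + (b1 * z + Y0))).
  rewrite (_ : (fun z => _) = fun z => -1 * (conjc a + (b1 * z + Y0))); last first.
    by apply/funext => z; rewrite mulN1r.
  by apply: holM; [exact: hol_cst|apply: holD; [exact: hol_cst|exact: hw]].
apply: hol_eval3; apply: holM; try exact: hol_cst; apply: holD.
- by apply: holD; [exact: hol_cst|exact: hz].
- by apply: holD; [exact: hol_cst|exact: hw].
- by apply: holD; [exact: hol_cst|exact: hz].
- exact: hN.
- by apply: hol_affine hH _ => z /hd[].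
- by apply: (hol_affine holJ) => z /hd[].
Qed.

(** In the coordinates X = (z + w) / 2 and Y = (z - w) / (2 i) the function G is
    holomorphic in each variable and vanishes at real X and Y. The identity
    theorem in X, for fixed real Y, and then in Y extends this to complex X
    and Y. The radius is halved so that X + i Y and X - i Y stay in the disc. *)
Lemma polarize z w : normc z < rho / 2 -> normc w < rho / 2 -> G z w = 0.
Proof.
move=> zr wr.
have nX : normc ((z + w) / 2) < rho / 2.
  rewrite normcM normcV normc_2 ltr_pM2r ?invr_gt0 //.
  by apply: le_lt_trans (le_normcD _ _) _; lra.
have nY : normc ((z - w) * kappa) < rho / 2.
  rewrite /kappa normcM normcV normcM normc_2 normc_I mulr1 ltr_pM2r ?invr_gt0 //.
  by apply: le_lt_trans (le_normcD _ _) _; rewrite normcN; lra.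
have zE : z = I * ((z - w) * kappa) + (z + w) / 2.
  by rewrite /kappa; field; exact: I_neq0.
have wE : w = - I * ((z - w) * kappa) + (z + w) / 2.
  by rewrite /kappa; field; exact: I_neq0.
rewrite [in LHS]zE [X in G _ X]wE;
  move: ((z + w) / 2) ((z - w) * kappa) nX nY => X Y nX nY.
apply: (@identity_theorem _ (rho / 2) (fun Y => G (I * Y + X) (- I * Y + X))) => //.
  apply: hol_G => Y' nY'; have [] := halfdisc nX nY'.
  by rewrite mulNr ![X + _]addrC.
move=> y yr; have ny : normc (y%:C : C) < rho / 2 by rewrite normc_real.
apply: (etrans _ (@identity_theorem _ (rho / 2)
  (fun X => G (1 * X + I * y%:C) (1 * X + - (I * y%:C))) _ _ X nX)).
- by rewrite !mul1r mulNr ![_ + X]addrC.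
- by apply: hol_G => X' nX'; rewrite mul1r; exact: halfdisc nX' ny.
- move=> x xr; rewrite !mul1r; apply: polarize_real.
  by have [] := halfdisc (X := x%:C) _ ny; rewrite ?normc_real.
Qed.

(** Fix the conjugate variable w in the polarized relation: what remains is a
    relation between z and h (z - a), nonzero if w avoids the roots of g. *)
Theorem real_part_algebraic : nontrivial T -> algebraic_near (fun z => h (z - a)) a.
Proof.
move=> T0; have k0 : kappa != 0 by rewrite invr_neq0 // twoI_neq0.
have [g g0 gQ] := @polarized_polynomial _ _ toC T kappa k0 T0.
(* More candidates for w than g has roots, all within rho / 2 of conjc a. *)
pose pts : seq C := [seq conjc a + (rho / 4 / i.+1%:R)%:C | i <- iota 0 (size g)].
have upts : uniq pts.
  rewrite map_inj_uniq ?iota_uniq // => i j /addrI/complexI.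
  have r4 : rho / 4 != 0 by rewrite mulf_neq0 ?gt_eqF ?invr_gt0.
  by move=> /(mulfI r4)/invr_inj/eqP; rewrite eqr_nat => /eqP[].
have [|w /mapP[i _ wE] gw] := poly_nonroot g0 upts.
  by rewrite size_map size_iota.
have [Q Q0 QE] := gQ w gw (hJ (w - conjc a)).
exists Q => //; apply/nbhs_cplx; exists (rho / 2) => [|z zr]; first by rewrite divr_gt0.
rewrite QE -[RHS](@polarize (z - a) (w - conjc a)) //; last first.
  rewrite wE addrC addKr normc_real ger0_norm ?divr_ge0 // ?ltW //.
  apply: (@le_lt_trans _ _ (rho / 4)); last by move: rho0; lra.
  by rewrite ler_pdivrMr // ler_peMr // ?ler1n // divr_ge0 // ltW.
by rewrite /G ![_ + (_ - _)]addrC !subrK.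
Qed.

End Relation.
End Polarization.

(** * Nash functions on a plane *)
Section PlaneRelation.
Variables (R : realType) (m : nat).
Local Notation C := (cplx R).
Implicit Types (b v : 'rV[R]_m) (s : R).

Lemma line_continuous b v s : {for s, continuous (fun t : R => b + t *: v)}.
Proof.
apply: (@cvgD _ _ _ (nbhs s)); first exact: cvg_cst.
exact: scalel_continuous.
Qed.

(** By [power_series_line] the increment along the line is at most a multiple of
    |s|, the factor being a bound for the absolute series at one point. *)
Lemma analytic_line_continuous (G : 'rV[R]_m -> R) b v : analytic_at G b ->
  {for 0, continuous (fun s : R => G (b + s *: v))}.
Proof.
move=> [c cH].
pose Pc x := cvgn (norm_series c (x - b)) /\ power_series c (x - b) @ \oo --> G x.
have bE s : b + s *: v - b = s *: v by rewrite addrC addKr.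
have : \forall s \near (0 : R), Pc (b + s *: v).
  by apply: (line_continuous (b := b) (v := v)); rewrite /= scale0r addr0.
move=> /nbhs_ballP[e /= e0 eP].
have P0 : Pc (b + 0 *: v) by apply: eP; exact: ballxx.
have e20 : 0 < e / 2 by rewrite divr_gt0.
have [/cvg_seq_bounded/pinfty_ex_gt0[B B0 nB] _] : Pc (b + (e / 2) *: v).
  by apply: eP; rewrite /ball /= sub0r normrN gtr0_norm //; lra.
have key s : `|s| <= e / 2 -> `|G (b + s *: v) - G (b + 0 *: v)| <= `|s| / (e / 2) * B.
  move=> se; have [_ Ps] : Pc (b + s *: v).
    by apply: eP; rewrite /ball /= sub0r normrN; lra.
  have := P0.2; move: Ps; rewrite !bE => Ps P00.
  apply: (cvgr_to_le (cvg_norm (cvgB Ps P00))); apply: nearW => N /=.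
  apply: le_trans (power_series_line c v N e20 se) _.
  apply: ler_wpM2l; first by rewrite divr_ge0 // ltW.
  have := nB N Logic.I; rewrite bE /= => h. exact: le_trans (ler_norm _) h.
apply/cvgrPdist_le => /= d d0.
pose r := Num.min (e / 2) (d * (e / 2) / B).
have r0 : 0 < r by rewrite lt_min e20 divr_gt0 // mulr_gt0.
apply/nbhs_ballP; exists r => // s;
  rewrite /ball /= sub0r normrN lt_min => /andP[s1 s2].
rewrite distrC; apply: le_trans (key s (ltW s1)) _.
move: s2; rewrite ltr_pdivlMr // => s2.
by rewrite mulrAC ler_pdivrMr // ltW.
Qed.

(** Along the transversal direction v the factor s^k can be cancelled for s != 0,
    and continuity at s = 0 leaves T on the plane itself. *)
Lemma nash_plane_relation (G : 'rV[R]_m -> R) (V : set 'rV[R]_m) (A B : 'rV[R]_m)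
    (a : C) : nash_on V G -> V (complex.Re a *: A + complex.Im a *: B) ->
  exists2 T : mpoly.mpoly 3 R, nontrivial T & \forall z \near a,
    eval3 idfun T (complex.Re z) (complex.Im z)
      (G (complex.Re z *: A + complex.Im z *: B)) = 0.
Proof.
pose lam (z : C) := complex.Re z *: A + complex.Im z *: B.
move=> nG Va; have [V' [oV V'a V'V anG [P P0 PG]]] := nG _ Va.
have [v [k [n [T [U [T0 TE]]]]]] := plane_restriction A B P0.
exists T => //.
have clam : {for a, continuous lam}.
  apply: (@cvgD _ _ _ (nbhs a)); apply: (@cvgZ _ _ _ (nbhs a)).
  - by apply: cvg_Re; exact: cvg_id.
  - exact: cvg_cst.
  - by apply: cvg_Im; exact: cvg_id.
  - exact: cvg_cst.
have : \forall z \near a, V' (lam z) by apply: clam; exact: open_nbhs_nbhs.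
apply: filterS => z V'z.
have cG := analytic_line_continuous (v := v) (anG _ V'z).
pose x := complex.Re z; pose y := complex.Im z.
pose u (s : R) := G (lam z + s *: v).
pose phi (s : R) := eval3 idfun T x y (u s) +
  s * \sum_(i < n) eval3 idfun (U i) x y (u s) * s ^+ i.
have cphi : {for 0, continuous phi}.
  pose Pr (w : R -> R) := {for 0, continuous w}.
  have Pext w w' : w =1 w' -> Pr w -> Pr w' by move=> /funext ->.
  have Pc c : Pr (fun=> c) by exact: cvg_cst.
  have PD w w' : Pr w -> Pr w' -> Pr (fun s => w s + w' s) by exact: contD.
  have PM w w' : Pr w -> Pr w' -> Pr (fun s => w s * w' s) by exact: contM.
  have Pid : Pr id by exact: cvg_id.
  have Pev (W : mpoly.mpoly 3 R) : Pr (fun s => eval3 idfun W x y (u s)).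
    by apply: (closed_eval3 (Pr := Pr) Pext Pc PD PM); [exact: Pc|exact: Pc|exact: cG].
  apply: (PD); first exact: Pev.
  apply: (PM); first exact: Pid.
  apply: (closed_sum (Pr := Pr) Pext Pc PD) => i; apply: (PM); first exact: Pev.
  exact: (closed_exp (Pr := Pr) Pext Pc PM).
have phi0 : \forall s \near (0 : R), s != 0 -> phi s = 0.
  have : \forall s \near (0 : R), V' (lam z + s *: v).
    apply: (line_continuous (b := lam z) (v := v)).
    by rewrite scale0r addr0; exact: open_nbhs_nbhs.
  apply: filterS => s Vs s0; have := PG _ Vs; rewrite TE => /eqP.
  by rewrite mulf_eq0 expf_eq0 (negPf s0) andbF => /eqP.
have : phi 0 = 0.
  apply/eqP; apply: contraT => n0.
  have /cvgrPdist_lt/(_ `|phi 0|) := cphi; rewrite normr_gt0 => /(_ n0) n0'.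
  have : \forall s \near (0 : R), (s != 0 -> phi s = 0) /\ `|phi 0 - phi s| < `|phi 0|.
    exact: filterI.
  move=> /nbhs_ballP[e /= e0 eH].
  have [] := eH (e / 2); first by rewrite /ball /= sub0r normrN gtr0_norm; lra.
  by move=> ->; rewrite ?subr0 ?ltxx // gt_eqF; lra.
by rewrite /phi mul0r addr0 /u scale0r addr0.
Qed.

End PlaneRelation.

(** * Complex Nash functions as holomorphic algebraic functions *)
Section ComplexNash.
Variable R : realType.
Local Notation C := (cplx R).

Lemma cont_cplx (T : topologicalType) (f : T -> C) (z : T) :
  {for z, continuous f} <->
  forall e : R, 0 < e -> \forall w \near z, normc (f w - f z) < e.
Proof. exact: (@cvg_cplx R T (nbhs z) (nbhs_filter z) f (f z)). Qed.

Lemma hol_analytic_at (rho : R) (H : C -> C) (b : 'rV[C]_1) : 0 < rho ->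
  disc_hol rho (fun z => H (b 0 0 + z)) ->
    analytic_at (fun x : 'rV[C]_1 => H (x 0 0)) b.
Proof.
move=> rho0 hH; pose r := rho / 2.
have rr : 0 < r < rho by rewrite /r; apply/andP; split; lra.
have [r0 _] := andP rr.
have [c [B [B0 cB cH]]] := hol_power_series rr hH.
have [c' c'E] := univariate_series c; exists c'.
have near_b : nbhs b (fun x : 'rV[C]_1 => normc (x 0 0 - b 0 0) < r / 2).
  have : (fun x : 'rV[C]_1 => x 0 0) @ b --> b 0 0 by exact: coord_continuous.
  by move=> /cvg_cplx; apply; rewrite divr_gt0.
apply: filterS near_b => x xb; set w := x 0 0 - b 0 0.
have k1 : normc w / r <= 2^-1.
  by rewrite ler_pdivrMr // mulrC; apply: ltW.
have k0 : 0 <= normc w / r by rewrite divr_ge0 ?normc_ge0 // ltW.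
have wE : (x - b) 0 0 = w by rewrite !mxE.
split.
  have -> : norm_series c' (x - b) = (fun N => (series (fun n =>
    normc (c n * w ^+ n)) N)%:C : C).
    apply/funext => N; rewrite (c'E _ _).2 wE /series /= big_mkord rmorph_sum.
    by apply: eq_bigr => n _.
  have : cvgn (series (fun n => normc (c n * w ^+ n))).
    apply: (@series_le_cvg _ _ (geometric B 2^-1)).
    - by move=> n; exact: normc_ge0.
    - by move=> n; rewrite /= mulr_ge0 // exprn_ge0.
    - move=> n /=; rewrite normcM.
      have -> : normc (w ^+ n) = (normc w / r) ^+ n * r ^+ n.
        rewrite -exprMn divfK ?gt_eqF //.
        by elim: n => [|n IH]; rewrite ?expr0 ?normc1 // !exprS normcM IH.
      rewrite mulrCA mulrC; apply: ler_pM.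
      + by rewrite mulr_ge0 ?normc_ge0 // exprn_ge0 // ltW.
      + by rewrite exprn_ge0.
      + exact: cB.
      + by rewrite lerXn2r ?nnegrE.
    - by apply: is_cvg_geometric_series; rewrite ger0_norm //; lra.
  by move=> /cvg_ex[l /cvg_real_complex h]; apply/cvg_ex; exists (l%:C : C); exact: h.
apply/cvg_cplx => e e0.
have : (fun N => B * (1 - normc w / r)^-1 * (normc w / r) ^+ N) @ \oo --> (B * (1 -
  normc w / r)^-1 * 0 : R).
  apply: cvgM; first exact: cvg_cst.
  by apply: cvg_expr; rewrite ger0_norm //; apply: le_lt_trans k1 _; lra.
rewrite mulr0 => /cvgrPdist_lt/(_ e e0); apply: filterS => N.
rewrite sub0r normrN => h; rewrite -[X in normc X]opprB normcN.
apply: le_lt_trans (lt_le_trans h (lexx _)); apply: le_trans (ler_norm _).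
rewrite (c'E _ _).1 wE.
have -> : H (x 0 0) = H (b 0 0 + w) by rewrite /w addrC subrK.
by apply: cH; apply: lt_le_trans xb _; lra.
Qed.

Lemma complex_nash_intro (D : set C) (H : C -> C) : open D ->
  (forall a, D a -> exists2 rho : R, 0 < rho & disc_hol rho (fun z => H (a + z))) ->
  (forall a, D a -> algebraic_near H a) -> complex_nash D H.
Proof.
move=> oD hH aH a Da; have [Q Q0 QH] := aH _ Da.
have : nbhs (a 0 0) (fun z => D z /\ Q.[(H z)%:P].[z] = 0).
  by apply: filterI QH; exact: open_nbhs_nbhs.
move=> /nbhs_ballP[e /= e0 eH].
exists ((fun x : 'rV[C]_1 => x 0 0) @^-1` (ball (a 0 0) e)); split.
- apply: open_comp; last exact: ball_open.
  by move=> x _; exact: coord_continuous.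
- exact: ballxx.
- by move=> x /eH[].
- move=> b /eH[Db _]; have [rho rho0 h] := hH _ Db.
  exact: hol_analytic_at rho0 h.
- have [P P0 PE] := bivariate_mpoly Q0.
  by exists P => // x /eH[_ QHx]; rewrite PE.
Qed.

End ComplexNash.

(** * The Cauchy-Riemann equations *)
Section CauchyRiemann.
Variable R : realType.
Local Notation C := (cplx R).

Lemma mean_value (g g' : R -> R) (x s : R) :
  (forall y, `|y - x| <= `|s| -> is_derive y 1 g (g' y)) ->
  exists2 y, `|y - x| <= `|s| & g (x + s) - g x = g' y * s.
Proof.
have main (p q : R) : p <= q -> (forall y, p <= y <= q -> is_derive y 1 g (g' y)) ->
    exists2 y, p <= y <= q & g q - g p = g' y * (q - p).
  move=> pq dg.
  have [||c] := @MVT_segment _ g g' p q pq.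
  - by move=> y /subset_itv_oo_cc; rewrite in_itv /=; exact: dg.
  - by apply: derivable_within_continuous => y; rewrite in_itv /= => /dg[].
  - by rewrite in_itv /=; exists c.
move=> dg; case: (lerP 0 s) => s0.
  have [|y|c /andP[c0 c1] E] := main x (x + s); first by rewrite lerDl.
    by move=> /andP[y0 y1]; apply: dg; rewrite !ger0_norm //; lra.
  exists c; first by rewrite !ger0_norm //; lra.
  by rewrite E; congr (_ * _); ring.
have [|y|c /andP[c0 c1] E] := main (x + s) x; first by lra.
  by move=> /andP[y0 y1]; apply: dg; rewrite !ler0_norm //; lra.
exists c; first by rewrite !ler0_norm //; lra.
by rewrite -opprB E; ring.
Qed.

Variables (D : set C) (u v ua ub : C -> R).
Hypothesis oD : open D.
Hypothesis dua : forall z, D z ->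
  is_derive (complex.Re z) 1 (fun t => u (t +i* complex.Im z)) (ua z).
Hypothesis dub : forall z, D z ->
  is_derive (complex.Im z) 1 (fun t => u (complex.Re z +i* t)) (ub z).
Hypothesis cua : forall z, D z -> {for z, continuous ua}.
Hypothesis cub : forall z, D z -> {for z, continuous ub}.

(** From z to w one moves first vertically, then horizontally; the mean value
    theorem on each side replaces the increments by partial derivatives at
    nearby points, and these are continuous at z. *)
Lemma C1_differentiable z : D z -> forall e : R, 0 < e -> \forall w \near z,
  `|u w - u z - ua z * (complex.Re (w - z)) - ub z * complex.Im (w - z)|
    <= e * normc (w - z).
Proof.
move=> Dz e e0.
have e2 : 0 < e / 2 by lra.
have : nbhs z (fun w => [/\ D w, `|ua z - ua w| < e / 2 & `|ub z - ub w| < e / 2]).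
  have nD : \forall w \near z, D w by exact: open_nbhs_nbhs.
  have nA : \forall w \near z, `|ua z - ua w| < e / 2.
    by have /cvgrPdist_lt := cua Dz; apply.
  have nB : \forall w \near z, `|ub z - ub w| < e / 2.
    by have /cvgrPdist_lt := cub Dz; apply.
  by near=> w; split; near: w.
move=> /nbhs_cplx[d d0 dH]; apply/nbhs_cplx; exists (d / 2) => [|w wz]; first by lra.
set s := complex.Re (w - z); set t := complex.Im (w - z).
have ls : `|s| <= normc (w - z) := normRe _.
have lt : `|t| <= normc (w - z) := normIm _.
have sE : complex.Re w = complex.Re z + s by rewrite /s raddfB /=; ring.
have tE : complex.Im w = complex.Im z + t by rewrite /t raddfB /=; ring.
pose x := complex.Re z; pose y := complex.Im z.
have inD (x' y' : R) : `|x' - x| <= `|s| -> `|y' - y| <= `|t| ->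
    normc ((x' +i* y' : C) - z) < d.
  move=> x's y't; apply: le_lt_trans (normc_le _) _.
  rewrite !raddfB /= -/x -/y; lra.
have yt : `|y + t - y| <= `|t| by rewrite addrC addKr.
have xx : `|x - x| <= `|s| by rewrite subrr normr0.
have [x' x's Ex] : exists2 x', `|x' - x| <= `|s| &
    u ((x + s) +i* (y + t)) - u (x +i* (y + t)) = ua (x' +i* (y + t)) * s.
  apply: (@mean_value (fun x' => u (x' +i* (y + t))) (fun x' => ua (x' +i* (y + t)))).
  move=> x' x's; apply: (dua (z := x' +i* (y + t))).
  by have [] := dH _ (inD x' (y + t) x's yt).
have [y' y't Ey] : exists2 y', `|y' - y| <= `|t| &
    u (x +i* (y + t)) - u (x +i* y) = ub (x +i* y') * t.
  apply: (@mean_value (fun y' => u (x +i* y')) (fun y' => ub (x +i* y'))).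
  move=> y' y't; apply: (dub (z := x +i* y')).
  by have [] := dH _ (inD x y' xx y't).
have -> : u w = u ((x + s) +i* (y + t)) by rewrite -sE -tE; case: (w).
have -> : u z = u (x +i* y) by rewrite /x /y; case: (z).
have -> : u ((x + s) +i* (y + t)) - u (x +i* y) =
    ua (x' +i* (y + t)) * s + ub (x +i* y') * t by rewrite -Ex -Ey; ring.
have -> : ua (x' +i* (y + t)) * s + ub (x +i* y') * t - ua z * s - ub z * t =
   - ((ua z - ua (x' +i* (y + t))) * s) - (ub z - ub (x +i* y')) * t by ring.
apply: le_trans (ler_normB _ _) _; rewrite normrN !normrM [e]splitr mulrDl.
have [_ hA _] := dH _ (inD x' (y + t) x's yt).
have [_ _ hB] := dH _ (inD x y' xx y't).
apply: lerD; apply: ler_pM => //.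
- exact: ltW hA.
- exact: ltW hB.
Unshelve. all: by end_near. Qed.

End CauchyRiemann.

Section Holomorphic.
Variable R : realType.
Local Notation C := (cplx R).
Variables (D : set C) (u v ua ub va vb : C -> R).
Hypothesis oD : open D.
Hypothesis dua : forall z, D z ->
  is_derive (complex.Re z) 1 (fun t => u (t +i* complex.Im z)) (ua z).
Hypothesis dub : forall z, D z ->
  is_derive (complex.Im z) 1 (fun t => u (complex.Re z +i* t)) (ub z).
Hypothesis dva : forall z, D z ->
  is_derive (complex.Re z) 1 (fun t => v (t +i* complex.Im z)) (va z).
Hypothesis dvb : forall z, D z ->
  is_derive (complex.Im z) 1 (fun t => v (complex.Re z +i* t)) (vb z).
Hypothesis cua : forall z, D z -> {for z, continuous ua}.
Hypothesis cub : forall z, D z -> {for z, continuous ub}.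
Hypothesis cva : forall z, D z -> {for z, continuous va}.
Hypothesis cvb : forall z, D z -> {for z, continuous vb}.
Hypothesis CR1 : forall z, D z -> ua z = vb z.
Hypothesis CR2 : forall z, D z -> va z = - ub z.

Let h (z : C) : C := u z +i* v z.
Let d (z : C) : C := ua z +i* va z.

Lemma cauchy_riemann_cderive z : D z -> cderive h z (d z).
Proof.
move=> Dz; exists (fun w => if w == z then d z else (h w - h z) / (w - z)); split.
- move=> w; have [->|wz] := eqVneq w z; first by rewrite !subrr mulr0.
  by rewrite divfK // subr_eq0.
- apply/cont_cplx => e e0; rewrite eqxx.
  have e4 : 0 < e / 4 by lra.
  have nu := C1_differentiable oD dua dub cua cub Dz e4.
  have nv := C1_differentiable oD dva dvb cva cvb Dz e4.
  apply: filterS2 nu nv => w hu hv.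
  have [_|wz] := eqVneq w z; first by rewrite subrr normc0.
  have wz0 : w - z != 0 by rewrite subr_eq0.
  have n0 : 0 < normc (w - z).
    rewrite lt_neqAle normc_ge0 andbT eq_sym; apply: contra wz0.
    by move=> /eqP/eq0_normc ->.
  have -> : (h w - h z) / (w - z) - d z = (h w - h z - d z * (w - z)) / (w - z).
    by field.
  rewrite normcM normcV ltr_pdivrMr //; apply: le_lt_trans (normc_le _) _.
  have -> : complex.Re (h w - h z - d z * (w - z)) =
      u w - u z - ua z * complex.Re (w - z) - ub z * complex.Im (w - z).
    by case: (w - z) => s t /=; rewrite CR2 //; ring.
  have -> : complex.Im (h w - h z - d z * (w - z)) =
      v w - v z - va z * complex.Re (w - z) - vb z * complex.Im (w - z).
    by case: (w - z) => s t /=; rewrite CR1 //; ring.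
  nra.
- by rewrite eqxx.
Qed.

Lemma cauchy_riemann_hol a : D a -> exists2 rho : R, 0 < rho &
  disc_hol rho (fun z => h (a + z)).
Proof.
move=> Da; have ch := cderive_continuous (cauchy_riemann_cderive Da).
have cd z : D z -> {for z, continuous d}.
  by move=> Dz; apply: cont_Complex; [exact: cua|exact: cva].
have : nbhs a (fun w => [/\ D w, normc (h w - h a) < 1 & normc (d w - d a) < 1]).
  have nD : \forall w \near a, D w by exact: open_nbhs_nbhs.
  have nA : \forall w \near a, normc (h w - h a) < 1.
    by move/cont_cplx : ch; apply.
  have nB : \forall w \near a, normc (d w - d a) < 1.
    by have /cont_cplx := cd _ Da; apply.
  by near=> w; split; near: w.
move=> /nbhs_cplx[rho rho0 aH]; exists rho => //.
exists (fun z => d (a + z)), (normc (h a) + normc (d a) + 1) => z zr.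
have [|Dz hz dz] := aH (a + z); first by rewrite [a + z]addrC addrK.
have E f : (fun w : C => f (a + w) : C) = (fun w => f (1 * w + a)).
  by apply/funext => w; rewrite mul1r addrC.
have zE : a + z = 1 * z + a by rewrite mul1r addrC.
have ha := normc_ge0 (h a); have da := normc_ge0 (d a).
split.
- rewrite E zE -[d _]mulr1; apply: cderive_affine; rewrite -zE.
  exact: cauchy_riemann_cderive.
- apply: (@cont_comp C C C (fun w => a + w) d); last exact: cd.
  by apply: gcontD; [exact: gcont_cst|move=> w; exact: cont_id].
- have := le_normcD (h (a + z) - h a) (h a); rewrite subrK; lra.
- have := le_normcD (d (a + z) - d a) (d a); rewrite subrK; lra.
Unshelve. all: by end_near. Qed.

End Holomorphic.

(** * What a real component of a slice function determines *)
Section SliceFunctions.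
Variables (R : realType) (A : falgType R) (conjA : A -> A).
Variables (I : finType) (e : I -> A).
Local Notation C := (cplx R).
Local Notation comp := (component e).

Lemma componentD K x y : comp K (x + y) = comp K x + comp K y.
Proof. by rewrite /component linearD. Qed.

Lemma componentZ K (a : R) x : comp K (a *: x) = a * comp K x.
Proof. by rewrite /component linearZ. Qed.

Lemma component_coordinates K x : comp K x = coordinates e x 0 (enum_rank K).
Proof. by rewrite mxE. Qed.

Lemma coordinates_linear (a b : R) x y :
  coordinates e (a *: x + b *: y) = a *: coordinates e x + b *: coordinates e y.
Proof. by apply/rowP => i; rewrite !mxE linearD !linearZ. Qed.

Lemma C1_component (D : set C) (F : C -> A) K : C1_on e D F -> forall z, D z ->
  [/\ is_derive (complex.Re z) 1 (fun t => comp K (F (t +i* complex.Im z)))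
        (d_alpha e F z 0 (enum_rank K)),
      is_derive (complex.Im z) 1 (fun t => comp K (F (complex.Re z +i* t)))
        (d_beta e F z 0 (enum_rank K)),
      {for z, continuous (fun w => d_alpha e F w 0 (enum_rank K))} &
      {for z, continuous (fun w => d_beta e F w 0 (enum_rank K))}].
Proof.
move=> FC z /FC[da db ca cb]; split.
- apply: DeriveDef.
    have /derivable_mxP/(_ 0 (enum_rank K)) := da.
    by under eq_fun do rewrite -component_coordinates.
  have -> : (fun t => comp K (F (t +i* complex.Im z))) =
      (fun t => along_alpha e F z t 0 (enum_rank K)).
    by apply/funext => t; rewrite component_coordinates.
  by rewrite /d_alpha derive1E (derive_mx da) mxE.
- apply: DeriveDef.
    have /derivable_mxP/(_ 0 (enum_rank K)) := db.
    by under eq_fun do rewrite -component_coordinates.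
  have -> : (fun t => comp K (F (complex.Re z +i* t))) =
      (fun t => along_beta e F z t 0 (enum_rank K)).
    by apply/funext => t; rewrite component_coordinates.
  by rewrite /d_beta derive1E (derive_mx db) mxE.
- exact: (cvg_comp _ _ ca (@coord_continuous _ _ _ 0 (enum_rank K) _)).
- exact: (cvg_comp _ _ cb (@coord_continuous _ _ _ 0 (enum_rank K) _)).
Qed.

Definition stem_component (F1 F2 : C -> A) K (z : C) : C :=
  comp K (F1 z) +i* comp K (F2 z).

Lemma stem_component_hol (D : set C) F1 F2 K : open D ->
  C1_on e D F1 -> C1_on e D F2 -> cauchy_riemann e D F1 F2 ->
  forall a, D a -> exists2 rho : R, 0 < rho &
    disc_hol rho (fun z => stem_component F1 F2 K (a + z)).
Proof.
move=> oD C1 C2 CR a Da.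
have H1 z (Dz : D z) := C1_component K C1 Dz.
have H2 z (Dz : D z) := C1_component K C2 Dz.
apply: (@cauchy_riemann_hol R D (fun z => comp K (F1 z)) (fun z => comp K (F2 z))
  (fun z => d_alpha e F1 z 0 (enum_rank K)) (fun z => d_beta e F1 z 0 (enum_rank K))
  (fun z => d_alpha e F2 z 0 (enum_rank K))
  (fun z => d_beta e F2 z 0 (enum_rank K)) oD).
- by move=> z /H1[d1 _ _ _]; exact: d1.
- by move=> z /H1[_ d2 _ _]; exact: d2.
- by move=> z /H2[d1 _ _ _]; exact: d1.
- by move=> z /H2[_ d2 _ _]; exact: d2.
- by move=> z /H1[_ _ c1 _]; exact: c1.
- by move=> z /H1[_ _ _ c2]; exact: c2.
- by move=> z /H2[_ _ c1 _]; exact: c1.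
- by move=> z /H2[_ _ _ c2]; exact: c2.
- move=> z /CR[/rowP/(_ (enum_rank K)) + _]; rewrite !mxE => /eqP.
  by rewrite subr_eq0 => /eqP.
- move=> z /CR[_ /rowP/(_ (enum_rank K))]; rewrite !mxE => /eqP.
  by rewrite addr_eq0 => /eqP.
- exact: Da.
Qed.

Lemma hol_le (rho r : R) (h : C -> C) : r <= rho -> disc_hol rho h -> disc_hol r h.
Proof.
move=> rr [h' [M H]]; exists h', M => z zr.
by apply: H; apply: lt_le_trans zr rr.
Qed.

(** Both J and -J are imaginary units, so on the half planes through J and -J the
    component K of F_1 + J F_2 combines (F_1)_K and (F_2)_M with opposite
    signs. *)
Definition reaches K M := exists (J : A) (c : R),
  [/\ imag_units conjA J, imag_units conjA (- J), c != 0 &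
      forall x, comp K (J * x) = c * comp M x].

Section Determination.
Variables (D : set C) (F1 F2 : C -> A) (f : A -> A).
Hypotheses (oD : open D) (ind : induces conjA D F1 F2 f).
Hypotheses (C1 : C1_on e D F1) (C2 : C1_on e D F2) (CR : cauchy_riemann e D F1 F2).

(** On the plane of J the component of f at K is the real part of this
    combination: component K of F_1 + J F_2 is that of F_1 plus c times
    component M of F_2. *)
Lemma combination_algebraic K M (J : A) (c : R) : imag_units conjA J ->
  (forall x, comp K (J * x) = c * comp M x) ->
  real_nash e (circular conjA D) (fun x => comp K (f x)) ->
  forall a, D a -> algebraic_near (fun z => stem_component F1 F2 K z +
      (0 -i* c) * stem_component F1 F2 M z) a.
Proof.
move=> uJ JM nash a Da.
pose h (z : C) : C := stem_component F1 F2 K z + (0 -i* c) * stem_component F1 F2 M z.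
pose pt (z : C) : A := (complex.Re z)%:A + complex.Im z *: J.
have ptin z : D z -> circular conjA D (pt z).
  by case: z => x y Dz; exists x, y, J.
have [V [oV Va [G nG GE]]] := nash _ (ptin _ Da).
have ptE z : coordinates e (pt z) =
    complex.Re z *: coordinates e 1 + complex.Im z *: coordinates e J.
  by rewrite -coordinates_linear.
have VA : V (complex.Re a *: coordinates e 1 + complex.Im a *: coordinates e J).
  by rewrite -ptE.
have [T T0 TE] := nash_plane_relation nG VA.
have [r1 r10 hK] := stem_component_hol K oD C1 C2 CR Da.
have [r2 r20 hM] := stem_component_hol M oD C1 C2 CR Da.
have Vn : \forall z \near a, V (coordinates e (pt z)).
  have cl : {for a, continuous (fun z : C =>
      complex.Re z *: coordinates e 1 + complex.Im z *: coordinates e J)}.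
    apply: (@cvgD _ _ _ (nbhs a)); apply: (@cvgZ _ _ _ (nbhs a)).
    - by apply: cvg_Re; exact: cvg_id.
    - exact: cvg_cst.
    - by apply: cvg_Im; exact: cvg_id.
    - exact: cvg_cst.
  have := cl V; rewrite /= => H; have : nbhs a (fun z : C => V
      (complex.Re z *: coordinates e 1 + complex.Im z *: coordinates e J)).
    by apply: H; exact: open_nbhs_nbhs.
  by apply: filterS => z; rewrite ptE.
have Dn : \forall z \near a, D z by exact: open_nbhs_nbhs.
have : nbhs a (fun z => eval3 idfun T (complex.Re z) (complex.Im z) (complex.Re (h
  z)) = 0).
  apply: filterS3 TE Vn Dn => z Tz Vz Dz; rewrite -[RHS]Tz; congr eval3.
  rewrite -ptE GE //; last exact: ptin.
  have -> : f (pt z) = F1 z + J * F2 z.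
    by move: Dz; rewrite /pt; case: (z) => x y Dz /=; rewrite ind.
  by rewrite componentD JM /h /stem_component /=; ring.
move=> /nbhs_cplx[r3 r30 rel].
pose r := Num.min r1 (Num.min r2 r3).
have [rr1 rr2 rr3] : [/\ r <= r1, r <= r2 & r <= r3].
  by rewrite /r !ge_min !lexx /= !orbT.
have r0 : 0 < r by rewrite !lt_min r10 r20.
have holh : disc_hol r (fun z => h (a + z)).
  apply: holD; first exact: hol_le rr1 hK.
  by apply: holM; [exact: hol_cst|exact: hol_le rr2 hM].
have relh z : normc z < r -> eval3 idfun T (complex.Re (a + z)) (complex.Im (a + z))
    (complex.Re (h (a + z))) = 0.
  by move=> zr; apply: rel; rewrite [a + z]addrC addrK (lt_le_trans zr).
have := real_part_algebraic r0 holh relh T0.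
by rewrite (_ : (fun z => _) = h) //; apply/funext => z; rewrite addrC subrK.
Qed.

(** J and -J give the two combinations with coefficients -i c and i c; their half
    sum and a multiple of their difference are the two components. *)
Lemma reached_algebraic K M : reaches K M ->
  real_nash e (circular conjA D) (fun x => comp K (f x)) ->
  forall a, D a -> algebraic_near (stem_component F1 F2 K) a /\
    algebraic_near (stem_component F1 F2 M) a.
Proof.
move=> [J [c [uJ uNJ c0 JM]]] nash a Da.
have JNM x : comp K (- J * x) = - c * comp M x.
  by rewrite mulNr -scaleN1r componentZ JM; ring.
have a1 := combination_algebraic uJ JM nash Da.
have a2 := combination_algebraic uNJ JNM nash Da.
have cE : (0 -i* - c : C) = - (0 -i* c).
  by apply/eqP; rewrite eq_complex /= oppr0 !eqxx.
have c0' : (0 -i* c : C) != 0 by rewrite eq_complex /= oppr_eq0 (negPf c0) andbF.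
split.
  have := algebraic_nearD 2^-1 2^-1 a1 a2; congr algebraic_near; apply/funext => z.
  by rewrite cE; field.
have := algebraic_nearD (2 * (0 -i* c))^-1 (- (2 * (0 -i* c))^-1) a1 a2.
congr algebraic_near; apply/funext => z.
by rewrite cE; field; rewrite c0'.
Qed.

End Determination.

Section SplittingBasis.
(* A basis e that contains each JJ k along with J * JJ k, as the indices b (0, k)
   and b (1, k), makes the splitting coordinates components with respect to e. *)
Variables (J : A) (u : nat) (JJ : 'I_u.+1 -> A) (b : 'I_2 * 'I_u.+1 -> I).
Hypotheses (be : basis_of fullv (codom_tuple e)) (bij : bijective b).
Hypotheses (JJ0 : JJ ord0 = 1) (b0 : forall k, e (b (0, k)) = JJ k).
Hypothesis b1 : forall k, e (b (1, k)) = J * JJ k.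

Lemma splitting_sum (c : 'I_u.+1 -> C) : \sum_k of_cplx J (c k) * JJ k =
  \sum_k (complex.Re (c k) *: e (b (0, k)) + complex.Im (c k) *: e (b (1, k))).
Proof.
apply: eq_bigr => k _; rewrite /of_cplx mulrDl -!scalerAl mul1r.
by rewrite b0 b1.
Qed.

Lemma sum_pairs (V : nmodType) (g : 'I_2 * 'I_u.+1 -> V) :
  \sum_p g p = \sum_k (g (0, k) + g (1, k)).
Proof.
rewrite (eq_bigr (fun p => g (p.1, p.2))) => [|[] //].
rewrite -(pair_bigA _ (fun i k => g (i, k))) /= big_ord_recl big_ord1 -big_split /=.
by apply: eq_bigr => k _; congr (_ + g (_, _)); apply/val_inj.
Qed.

Lemma splitting_component (c : 'I_u.+1 -> C) k :
  comp (b (0, k)) (\sum_k of_cplx J (c k) * JJ k) = complex.Re (c k) /\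
  comp (b (1, k)) (\sum_k of_cplx J (c k) * JJ k) = complex.Im (c k).
Proof.
have [b' bK b'K] := bij.
pose g (p : 'I_2 * 'I_u.+1) :=
  if p.1 == 0 then complex.Re (c p.2) else complex.Im (c p.2).
have -> : \sum_k of_cplx J (c k) * JJ k = \sum_L g (b' L) *: e L.
  rewrite splitting_sum [RHS](reindex b) /=; last by apply: onW_bij.
  by rewrite sum_pairs; apply: eq_bigr => i _; rewrite !bK.
by rewrite !component_sum // !bK.
Qed.

Lemma splitting_expansion (x : A) :
  x = \sum_k of_cplx J (comp (b (0, k)) x +i* comp (b (1, k)) x) * JJ k.
Proof.
rewrite {1}(component_basis x be) splitting_sum (reindex b) /=; last exact: onW_bij.
by rewrite sum_pairs.
Qed.

Lemma splitting_basisP : splitting_basis J JJ.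
Proof.
split=> // x; exists [ffun k => comp (b (0, k)) x +i* comp (b (1, k)) x]; split.
  rewrite {1}[x]splitting_expansion; apply: eq_bigr => k _.
  by rewrite ffunE.
move=> c xE; apply/ffunP => k; rewrite ffunE; have [] := splitting_component c k.
by rewrite -xE => -> ->; case: (c k).
Qed.

Lemma stem_nash_components (D : set C) F1 F2 : imag_units conjA J ->
  (forall K, complex_nash D (stem_component F1 F2 K)) -> stem_nash conjA D F1 F2.
Proof.
move=> uJ nash; pose F (s : 'I_2) := if s == 0 then F1 else F2.
exists J, u, JJ, (fun s l k z => comp (b (l, k)) (F s z)); split.
- exact: uJ.
- exact: splitting_basisP.
- by move=> z Dz; split; exact: splitting_expansion.
- by move=> l k; exact: nash.
Qed.

(** Every component is in KK, or is reached from KK, hence is both holomorphic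
    and algebraic. *)
Theorem determining_of_reaching (KK : {set I}) : imag_units conjA J ->
  (forall M, exists2 K, K \in KK & exists M', reaches K M' /\ (M = K \/ M = M')) ->
  nash_determining conjA e KK.
Proof.
move=> uJ cover D f _ oD _ [F1 [F2 [st ind C1 C2 CR]]] nash.
exists F1, F2; split=> //; apply: stem_nash_components => // M.
have [K KKK [M' [KM' MK]]] := cover M.
apply: complex_nash_intro => //.
  by move=> a Da; exact: stem_component_hol Da.
move=> a Da.
have [hK hM'] := reached_algebraic oD ind C1 C2 CR KM' (nash _ KKK) Da.
by case: MK => ->.
Qed.

End SplittingBasis.
End SliceFunctions.

(** * Transcendence of the exponential *)
Section Transcendence.
Variable R : realType.
Local Notation C := (cplx R).
Variable rho : R.
Hypothesis rho0 : rho != 0.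

Let E (t : R) : C := (rho * expR t)%:C.

Lemma rderive_exp t : rderive E t (E t).
Proof.
apply/rderiveP; split => /=; last exact: is_derive_cst.
have := is_deriveZ rho (is_derive_expR t).
by [].
Qed.

Lemma rderive_poly (q : {poly C}) t : rderive (fun s => q.[s%:C]) t q^`().[t%:C].
Proof.
elim/poly_ind: q => [|q c IH].
  rewrite linear0 horner0 (_ : (fun _ => _) = fun=> 0); first exact: rderive_cst.
  by apply/funext => s; rewrite horner0.
rewrite (_ : (fun _ => _) = ((fun s => q.[s%:C]) \* (fun s => s%:C)) \+ (fun=> c)).
  apply: rderive_eq (rderiveD (rderiveM IH (rderive_real t)) (rderive_cst c t)) _.
  by rewrite derivD derivM derivX derivC !hornerE.
by apply/funext => s; rewrite /= !hornerE.
Qed.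

Lemma rderive_expX n t : rderive (fun s => E s ^+ n) t (E t ^+ n *+ n).
Proof.
elim: n => [|n IH].
  rewrite mulr0n (_ : (fun _ => _) = fun=> 1); first exact: rderive_cst.
  by apply/funext => y; rewrite expr0.
rewrite (_ : (fun _ => _) = E \* (fun y => E y ^+ n)); last first.
  by apply/funext => y; rewrite exprS.
apply: rderive_eq (rderiveM (rderive_exp t) IH) _.
by rewrite mulrnAr exprS mulrS.
Qed.

Lemma rderive_sum (n : nat) (g g' : 'I_n -> R -> C) t :
  (forall i, rderive (g i) t (g' i t)) ->
  rderive (fun s => \sum_i g i s) t (\sum_i g' i t).
Proof.
move=> dg; elim: (index_enum _) => [|i r IH].
  rewrite big_nil (_ : (fun _ => _) = fun=> 0); first exact: rderive_cst.
  by apply/funext => s; rewrite big_nil.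
rewrite big_cons (_ : (fun _ => _) = g i \+ (fun s => \sum_(j <- r) g j s)).
  exact: rderiveD.
by apply/funext => s; rewrite big_cons.
Qed.

(* The derivation d/dz + t d/dt: the derivative of Q(s, E s) is (Dexp Q)(s, E s),
   because E is its own derivative. *)
Let Dexp (Q : {poly {poly C}}) : {poly {poly C}} :=
  \poly_(i < size Q) ((Q`_i)^`() + Q`_i *+ i).

Let ev (Q : {poly {poly C}}) (t : R) : C := Q.[(E t)%:P].[t%:C].

Let evE (Q : {poly {poly C}}) n (t : R) : (size Q <= n)%N ->
  ev Q t = \sum_(i < n) (Q`_i).[t%:C] * E t ^+ i.
Proof.
move=> sQ; rewrite /ev (horner_coef_wide _ sQ) horner_sum; apply: eq_bigr => i _.
by rewrite hornerM -rmorphXn hornerC.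
Qed.

Lemma rderive_ev Q t : rderive (ev Q) t (ev (Dexp Q) t).
Proof.
rewrite (evE _ (size_poly _ _)).
rewrite (_ : ev Q = fun s => \sum_(i < size Q) (Q`_i).[s%:C] * E s ^+ i); last first.
  by apply/funext => s; exact: evE.
apply: (rderive_sum (g := fun i s => (Q`_i).[s%:C] * E s ^+ i)
  (g' := fun i s => ((Dexp Q)`_i).[s%:C] * E s ^+ i)) => i.
apply: rderive_eq (rderiveM (rderive_poly Q`_i t) (rderive_expX i t)) _.
rewrite coef_poly ltn_ord hornerD hornerMn mulrDl; congr (_ + _).
by rewrite mulrnAr mulrnAl.
Qed.

Let vanish (Q : {poly {poly C}}) :=
  exists2 d : R, 0 < d & forall t, `|t| < d -> ev Q t = 0.

Lemma rderive_vanish (p : R -> C) t d (e : R) : 0 < e ->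
  (forall s, `|s - t| < e -> p s = 0) -> rderive p t d -> d = 0.
Proof.
move=> e0 p0 [q [pq cq <-]]; apply/eqP; apply: contraT => qt0.
have n0 : 0 < normc (q t).
  rewrite lt_neqAle normc_ge0 andbT eq_sym; apply: contra qt0.
  by move=> /eqP/eq0_normc ->.
have /cont_cplx/(_ _ n0)/nbhs_ballP[r /= r0 rH] := cq.
pose s := t + Num.min e r / 2.
have m0 : 0 < Num.min e r by rewrite lt_min e0 r0.
have ts : `|s - t| = Num.min e r / 2.
  by rewrite /s addrC addKr gtr0_norm // divr_gt0.
have se : `|s - t| < e.
  by rewrite ts; apply: (@lt_le_trans _ _ (Num.min e r)); [lra|rewrite ge_min lexx].
have sr : ball t r s.
  rewrite /ball /= distrC ts.
  by apply: (@lt_le_trans _ _ (Num.min e r)); [lra|rewrite ge_min lexx orbT].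
have := pq s; rewrite !p0 ?subrr ?normr0 // => /esym/eqP; rewrite mulf_eq0.
case/orP => [/eqP qs0|]; last first.
  rewrite eq_complex /= eqxx andbT => /eqP st0.
  by move: ts; rewrite st0 normr0; lra.
by have := rH _ sr; rewrite qs0 sub0r normcN ltxx.
Qed.

Lemma vanish_Dexp Q : vanish Q -> vanish (Dexp Q).
Proof.
move=> [d d0 Qv]; exists d => // t td.
apply: (@rderive_vanish (ev Q) t _ (d - `|t|)); first by lra.
  move=> s st; apply: Qv; have := ler_normD (s - t) t; rewrite subrK; lra.
exact: rderive_ev.
Qed.

(** Induction on the degree n in t, then on the degree of the leading coefficient
    q_n. The polynomial Dexp Q - n Q vanishes too, and its leading coefficient is
    q_n', of smaller degree; so it is zero. Then q_i' = (n - i) q_i, which forces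
    q_i = 0 for i < n by degrees, and q_n is a constant. But q_n E^n vanishes at
    the origin, where E does not. *)
Lemma exp_transcendental Q : vanish Q -> Q = 0.
Proof.
have [n] := ubnP (size Q); elim: n Q => // -[_ Q|n IHn Q sQ].
  by rewrite ltnS leqn0 size_poly_eq0 => /eqP.
have [m] := ubnP (size Q`_n); elim: m Q sQ => // m IHm Q sQ sq vQ.
have [q0|q0] := eqVneq Q`_n 0.
  apply: IHn => //; rewrite ltnS; apply/leq_sizeP => i.
  rewrite leq_eqVlt => /orP[/eqP<- //|ni]; rewrite nth_default //.
  by apply: leq_trans ni; rewrite -ltnS.
pose Q1 := Dexp Q - Q *+ n.
have Q1i i : Q1`_i = (Q`_i)^`() + Q`_i *+ i - Q`_i *+ n.
  rewrite coefB coefMn coef_poly; case: ltnP => // si.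
  by rewrite nth_default // deriv0 !mul0rn addr0.
have Q10 : Q1 = 0.
  apply: IHm.
  - rewrite ltnS; apply/leq_sizeP => i ni;
    rewrite Q1i nth_default ?deriv0 ?mul0rn ?subr0 ?addr0 //.
    by apply: leq_trans ni; rewrite -ltnS.
  - by rewrite Q1i addrK; apply: leq_trans (lt_size_deriv q0) _.
  - have [d d0 vQ1] := vanish_Dexp vQ; have [d' d'0 vQ'] := vQ.
    exists (Num.min d d') => [|t]; first by rewrite lt_min d0 d'0.
    rewrite lt_min => /andP[td td'];
      rewrite /ev hornerD hornerN hornerMn hornerD hornerN hornerMn.
    by rewrite -/(ev _ _) vQ1 // -[Q.[_].[_]]/(ev Q t) vQ' // mul0rn subrr.
have Qi i : (i < n)%N -> Q`_i = 0.
  move=> ltin; apply/eqP; apply: contraT => qi0.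
  have := Q1i i; rewrite Q10 coef0 => /esym/eqP;
    rewrite -addrA -opprB subr_eq0 -mulrnBr ?(ltnW ltin) //.
  move=> /eqP/(congr1 (fun p : {poly C} => size p)) sE.
  have := lt_size_deriv qi0; rewrite sE -scaler_nat size_scale ?ltnn //.
  by rewrite pnatr_eq0 subn_eq0 -ltnNge.
have Qn' : (Q`_n)^`() = 0 by have := Q1i n; rewrite Q10 coef0 addrK.
have [d d0 vQ0] := vQ; have := vQ0 0; rewrite normr0 => /(_ d0).
rewrite (evE (n := n.+1)) // big_ord_recr /= big1 => [|i _]; last first.
  by rewrite Qi // horner0 mul0r.
rewrite add0r /E expR0 mulr1 => /eqP; rewrite mulf_eq0 expf_eq0.
have -> : (rho%:C == 0 :> C) = false by rewrite eq_complex /= eqxx andbT (negPf rho0).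
rewrite andbF orbF => /eqP Qn0; case/negP: q0.
have sz1 : (size (Q`_n)%R <= 1)%N.
  apply/leq_sizeP => -[|j] // _; have := congr1 (fun p : {poly C} => p`_j) Qn'.
  by rewrite coef_deriv coef0 => /eqP; rewrite mulrn_eq0 => /eqP.
by rewrite (size1_polyC sz1) hornerC in Qn0 *; rewrite Qn0.
Qed.

End Transcendence.

(** * The slice exponential *)
Section LowerBound.
Variables (R : realType) (A : falgType R) (conjA : A -> A).
Variables (I : finType) (e : I -> A) (i0 M : I).
Local Notation C := (cplx R).
Local Notation comp := (component e).
Hypothesis be : basis_of fullv (codom_tuple e).
Hypothesis ei0 : e i0 = 1.
Hypothesis imag0 : forall J, imag_units conjA J -> comp i0 J = 0.
Hypothesis imagN : forall J, imag_units conjA J -> imag_units conjA (- J).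

Lemma component_basis_elt K L : comp K (e L) = (K == L)%:R.
Proof.
have -> : e L = \sum_N (N == L)%:R *: e N.
  rewrite (bigD1 L) //= eqxx scale1r big1 ?addr0 // => N /negPf ->.
  by rewrite scale0r.
by rewrite component_sum.
Qed.

Definition exp_re (z : C) : R := expR (complex.Re z) * cos (complex.Im z).
Definition exp_im (z : C) : R := expR (complex.Re z) * sin (complex.Im z).

Let F1 (z : C) : A := exp_re z *: e M.
Let F2 (z : C) : A := exp_im z *: e M.

(** The slice function exp(z) e_M in closed form, with a the real part of x and
    y = b J its imaginary part, so that y^2 = -b^2. On the real axis b = 0, where
    the quotient sin b / b has value 0 and the factor y is 0 as well. *)
Definition slice_exp (x : A) : A :=
  let a := comp i0 x in let y := x - a%:A in
  let b := Num.sqrt (- comp i0 (y * y)) in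
  expR a *: (cos b *: e M + (sin b / b) *: (y * e M)).

Lemma slice_exp_stem : stem setT F1 F2.
Proof.
move=> [a b] _; rewrite /F1 /F2 /exp_re /exp_im /= cosN sinN.
by split=> //; rewrite mulrN scaleNr.
Qed.

Lemma slice_exp_induces : induces conjA setT F1 F2 slice_exp.
Proof.
move=> a b J _ uJ; have JJ : J * J = -1 by case: uJ.
have c1 : comp i0 1 = 1 by rewrite -ei0 component_basis_elt eqxx.
rewrite /slice_exp componentD !componentZ c1 imag0 // mulr0 addr0 mulr1.
have yy : (b *: J) * (b *: J) = (- (b ^+ 2)) *: 1.
  by rewrite -scalerAl -scalerAr JJ scalerA scalerN scaleNr expr2.
rewrite [a%:A + b *: J]addrC addrK yy componentZ c1 mulr1 opprK sqrtr_sqr.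
have sb : sin `|b| / `|b| * b = sin b.
  case: (ltrgt0P b) => [bp|bn|->]; rewrite ?sin0 ?mulr0 //.
    by rewrite divfK // gt_eqF.
  by rewrite sinN invrN mulrNN divfK // lt_eqF.
rewrite /F1 /F2 /exp_re /exp_im /= scalerDr scalerA cos_norm; congr (_ + _).
by rewrite -scalerAl -scalerAr !scalerA -mulrA sb.
Qed.

Lemma is_derive_scalev (g : R -> R) (t d : R) (v : 'rV[R]_#|I|) :
  is_derive t 1 g d ->
  derivable (fun s => g s *: v) t 1 /\ derive1 (fun s => g s *: v) t = d *: v.
Proof.
move=> dg; have de j : is_derive t 1 (fun s => (g s *: v) 0 j) (d * v 0 j).
  rewrite (_ : (fun s => _) = fun s => v 0 j * g s).
    by rewrite mulrC; exact: is_deriveZ.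
  by apply/funext => s; rewrite mxE mulrC.
have D : derivable (fun s => g s *: v) t 1.
  by apply/derivable_mxP => i j; rewrite (ord1 i); case: (de j).
split=> //; rewrite derive1E derive_mx //; apply/rowP => j; rewrite !mxE.
by have := de j => ?; apply: derive_val.
Qed.

Lemma exp_derivatives (z : C) :
  [/\ is_derive (complex.Re z) 1 (fun t => exp_re (t +i* complex.Im z)) (exp_re z),
      is_derive (complex.Im z) 1 (fun t => exp_re (complex.Re z +i* t)) (- exp_im z),
      is_derive (complex.Re z) 1 (fun t => exp_im (t +i* complex.Im z)) (exp_im z) &
      is_derive (complex.Im z) 1 (fun t => exp_im (complex.Re z +i* t)) (exp_re z)].
Proof.
rewrite /exp_re /exp_im /=; split.
- rewrite (_ : (fun t => _) = fun t => cos (complex.Im z) * expR t).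
    by rewrite mulrC; exact: is_deriveZ.
  by apply/funext => t; rewrite mulrC.
- by rewrite -mulrN; exact: is_deriveZ.
- rewrite (_ : (fun t => _) = fun t => sin (complex.Im z) * expR t).
    by rewrite mulrC; exact: is_deriveZ.
  by apply/funext => t; rewrite mulrC.
- exact: is_deriveZ.
Qed.

Lemma coordinatesZ (c : R) x : coordinates e (c *: x) = c *: coordinates e x.
Proof. by apply/rowP => i; rewrite !mxE linearZ. Qed.

Lemma exp_re_continuous : continuous exp_re.
Proof.
move=> z; apply: (@contM R C z (fun z => expR (complex.Re z))
  (fun z => cos (complex.Im z))).
  apply: (@cont_comp C R R (fun w : C => complex.Re w) expR).
    by apply: cont_Re; exact: cont_id.
  exact: continuous_expR.
apply: (@cont_comp C R R (fun w : C => complex.Im w) cos).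
  by apply: cont_Im; exact: cont_id.
exact: continuous_cos.
Qed.

Lemma exp_im_continuous : continuous exp_im.
Proof.
move=> z; apply: (@contM R C z (fun z => expR (complex.Re z))
  (fun z => sin (complex.Im z))).
  apply: (@cont_comp C R R (fun w : C => complex.Re w) expR).
    by apply: cont_Re; exact: cont_id.
  exact: continuous_expR.
apply: (@cont_comp C R R (fun w : C => complex.Im w) sin).
  by apply: cont_Im; exact: cont_id.
exact: continuous_sin.
Qed.

Let v := coordinates e (e M).

Lemma along_scaled (g : C -> R) (z : C) :
  along_alpha e (fun w => g w *: e M) z = (fun t => g (t +i* complex.Im z) *: v) /\
  along_beta e (fun w => g w *: e M) z = (fun t => g (complex.Re z +i* t) *: v).
Proof. by split; apply/funext => t; rewrite /along_alpha /along_beta coordinatesZ. Qed.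

Lemma slice_exp_along :
  [/\ d_alpha e F1 = fun z => exp_re z *: v, d_beta e F1 = fun z => - exp_im z *: v,
      d_alpha e F2 = fun z => exp_im z *: v & d_beta e F2 = fun z => exp_re z *: v].
Proof.
split; apply/funext => z; have [d1 d2 d3 d4] := exp_derivatives z.
- by rewrite /d_alpha (along_scaled exp_re z).1 (is_derive_scalev v d1).2.
- by rewrite /d_beta (along_scaled exp_re z).2 (is_derive_scalev v d2).2.
- by rewrite /d_alpha (along_scaled exp_im z).1 (is_derive_scalev v d3).2.
- by rewrite /d_beta (along_scaled exp_im z).2 (is_derive_scalev v d4).2.
Qed.

Lemma continuous_scalev (g : C ->
  R) (z : C) (w : 'rV[R]_#|I|) : {for z, continuous g} ->
  {for z, continuous (fun z => g z *: w)}.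
Proof. by move=> cg; apply: (@cvgZ _ _ _ (nbhs z)); [exact: cg|exact: cvg_cst]. Qed.

Lemma slice_exp_C1 : C1_on e setT F1 /\ C1_on e setT F2.
Proof.
have [a1 b1 a2 b2] := slice_exp_along.
split=> z _; have [d1 d2 d3 d4] := exp_derivatives z; split.
- by rewrite (along_scaled exp_re z).1; exact: (is_derive_scalev v d1).1.
- by rewrite (along_scaled exp_re z).2; exact: (is_derive_scalev v d2).1.
- by rewrite a1; apply: continuous_scalev; exact: exp_re_continuous.
- rewrite b1; apply: continuous_scalev.
  by apply: (@cvgN _ _ _ (nbhs z)); exact: exp_im_continuous.
- by rewrite (along_scaled exp_im z).1; exact: (is_derive_scalev v d3).1.
- by rewrite (along_scaled exp_im z).2; exact: (is_derive_scalev v d4).1.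
- by rewrite a2; apply: continuous_scalev; exact: exp_im_continuous.
- by rewrite b2; apply: continuous_scalev; exact: exp_re_continuous.
Qed.

Lemma slice_exp_regular : slice_regular conjA e setT slice_exp.
Proof.
have [a1 b1 a2 b2] := slice_exp_along; have [C1 C2] := slice_exp_C1.
exists F1, F2; split=> //; first exact: slice_exp_stem.
  exact: slice_exp_induces.
by move=> z _; rewrite a1 b1 a2 b2 subrr scaleNr addrN.
Qed.

Lemma slice_exp_component K : K != M -> (forall J, imag_units conjA J ->
  comp K (J * e M) = 0) ->
  real_nash e (circular conjA setT) (fun x => comp K (slice_exp x)).
Proof.
move=> KM KJ p _; exists setT; split=> //; first exact: openT.
exists (fun _ => 0) => [a _|q [a [b [J [_ uJ ->]]]] _].
  exists setT; split=> //; first exact: openT.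
    move=> b _; exists (fun _ => 0); apply: (@filterE _ (nbhs b)) => x.
    have z0 : power_series (fun _ => 0) (x - b) = fun _ => 0 :> R.
      by apply/funext => N; rewrite /power_series big1 // => nu _; rewrite mul0r.
    have n0 : norm_series (fun _ => 0) (x - b) = fun _ => 0 :> R.
      by apply/funext => N; rewrite /norm_series big1 // => nu _; rewrite mul0r normr0.
    by rewrite z0 n0; split; [exact: is_cvg_cst|exact: cvg_cst].
  exact: zero_algebraic_on.
rewrite slice_exp_induces // componentD /F1 /F2 -scalerAr !componentZ KJ //.
by rewrite component_basis_elt (negPf KM) !mulr0 addr0.
Qed.

(** The values on the planes of J and -J determine the stem function, so in any
    splitting basis the stem components are exp(z) times the real coordinates
    of e_M. One of these coordinates is nonzero, and the Nash property would
    make a nonzero multiple of exp algebraic near 0. *)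
Lemma slice_exp_not_nash : ~ slice_nash conjA setT slice_exp.
Proof.
move=> [G1 [G2 [_ ind [J [u [JJ [G [uJ [_ sb] GE GN]]]]]]]].
have JJ2 : J * J = -1 by case: uJ.
have FG z : G1 z = F1 z /\ G2 z = F2 z.
  case: z => a b.
  have e1 := ind a b J Logic.I uJ; have e2 := ind a b (- J) Logic.I (imagN uJ).
  rewrite slice_exp_induces // in e1; rewrite slice_exp_induces // in e2;
    last exact: imagN.
  move: e1 e2; set g1 := G1 _; set g2 := G2 _; set f1 := F1 _; set f2 := F2 _.
  rewrite !mulNr => e1 e2.
  have E1 : g1 = f1.
    apply: (scalerI (a := 2 : R)); first by rewrite pnatr_eq0.
    rewrite !scaler_nat !mulr2n.
    have -> : g1 + g1 = (g1 + J * g2) + (g1 - J * g2) by rewrite addrACA subrr addr0.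
    by rewrite -e1 -e2 addrACA subrr addr0.
  split=> //; move: e1; rewrite E1 => /addrI/(congr1 (fun x => J * x)).
  by rewrite !mulrA JJ2 !mulN1r => /oppr_inj.
have [c [cE cU]] := sb (e M).
have scal (r : R) (w : C) : of_cplx J (r%:C * w) = r *: of_cplx J w.
  case: w => x y; rewrite /of_cplx /= !mul0r subr0 addr0.
  by rewrite scalerDr !scalerA.
have coef (r : R) (d : 'I_u.+1 -> C) : r *: e M = \sum_k of_cplx J (d k) * JJ k ->
    forall k, d k = r%:C * c k.
  move=> dE k; have [c' [_ c'U]] := sb (r *: e M).
  have H1 : c' = [ffun k => d k].
    by apply: c'U; rewrite dE; apply: eq_bigr => i _; rewrite ffunE.
  have H2 : c' = [ffun k => r%:C * c k].
    apply: c'U; rewrite {1}cE scaler_sumr; apply: eq_bigr => i _.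
    by rewrite ffunE scal scalerAl.
  by have /ffunP/(_ k) : [ffun k => d k] = [ffun k => r%:C * c k];
    [rewrite -H1 -H2|rewrite !ffunE].
have [k ck] : exists k, c k != 0.
  apply: contrapT => nc; have c0 k : c k = 0.
    by apply/eqP; apply: contraT => ck; case: nc; exists k.
  have : e M = 0.
    rewrite cE big1 // => i _; rewrite c0 /of_cplx /= !scale0r addr0 mul0r //.
  move=> /(congr1 (comp M)); rewrite component_basis_elt eqxx.
  by rewrite /component linear0 => /eqP; rewrite oner_eq0.
have Gk z : (G 0 0 k z +i* G 0 1 k z = (exp_re z)%:C * c k) /\
            (G 1 0 k z +i* G 1 1 k z = (exp_im z)%:C * c k).
  have [g1 g2] := GE z Logic.I; have [f1 f2] := FG z.
  split.
    apply: (coef (exp_re z) (fun k => G 0 0 k z +i* G 0 1 k z)).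
    by rewrite -[LHS]/(F1 z) -f1 g1.
  apply: (coef (exp_im z) (fun k => G 1 0 k z +i* G 1 1 k z)).
  by rewrite -[LHS]/(F2 z) -f2 g2.
have [l [rho [rho0 Gl]]] : exists (l : 'I_2) (rho : R), rho != 0 /\
    forall z, G 0 l k z = exp_re z * rho /\ G 1 l k z = exp_im z * rho.
  case cE' : (c k) => [x y].
  have Gz z : [/\ G 0 0 k z = exp_re z * x, G 0 1 k z = exp_re z * y,
                  G 1 0 k z = exp_im z * x & G 1 1 k z = exp_im z * y].
    have [] := Gk z; rewrite cE' => [[]]; rewrite !mul0r subr0 addr0 => -> ->.
    by case; rewrite !mul0r subr0 addr0 => -> ->.
  have [x0|x0] := eqVneq x 0; last first.
    by exists 0, x; split=> // z; have [] := Gz z.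
  exists 1, y; split; last by move=> z; have [] := Gz z.
  by move: ck; rewrite cE' x0 eq_complex /= eqxx.
have [V [oV V0 _ _ [P P0 PV]]] := GN l k (const_mx 0) Logic.I.
have [Q Q0 QE] := mpoly_bivariate P0.
case/eqP: Q0; apply: (exp_transcendental rho0).
have : nbhs (const_mx 0 : 'rV[C]_1) V by exact: open_nbhs_nbhs.
move=> /nbhs_ballP[d /= d0 dV]; exists (complex.Re d).
  by move: d0; rewrite ltcE => /andP[].
move=> t td; have dre : d = (complex.Re d)%:C by rewrite RRe_real // gtr0_real.
have /PV : V (const_mx t%:C).
  apply: dV; split=> // i j; rewrite !mxE /ball /= sub0r normrN.
  by rewrite normc_norm normc_real dre ltcR.
rewrite QE mxE; have [-> ->] := Gl t%:C;
  rewrite /exp_re /exp_im /= cos0 sin0 !mulr0 mul0r mulr1.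
by rewrite [rho * _]mulrC.
Qed.

Theorem not_determining (KK : {set I}) :
  (forall K, K \in KK -> K != M /\ forall J, imag_units conjA J ->
    comp K (J * e M) = 0) ->
  ~ nash_determining conjA e KK.
Proof.
move=> KKM /(_ setT slice_exp) det; apply: slice_exp_not_nash; apply: det.
- by exists 0.
- exact: openT.
- by [].
- exact: slice_exp_regular.
- by move=> K /KKM[KM KJ]; exact: slice_exp_component.
Qed.

End LowerBound.

Local Close Scope classical_set_scope.

Local Notation set0 := finset.set0.

(** * Imaginary units of the Clifford algebra *)
Section CliffordUnits.
Variables (R : realType) (n : nat).
Implicit Types K L M : {set 'I_n}.
Local Notation A := (clifford R n).
Local Notation e := (@cliff_basis R n).
Local Notation conj := (@cliff_conj R n).

(** The cardinalities of the L for which e_L is an imaginary unit; they are also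
    those for which the conjugation negates e_L. *)
Definition imag_card (m : nat) := (m %% 4 \in [:: 1; 2])%N.

Lemma cliff_imag_support (J : A) K : imag_units conj J -> ~~ imag_card #|K| -> J K = 0.
Proof.
move=> [cJ _] K0; have /ffunP/(_ K) := cJ; rewrite !ffunE.
rewrite -/(imag_card _) (negPf K0) => /eqP.
by rewrite -addr_eq0 -mulr2n mulrn_eq0 => /eqP.
Qed.

Lemma cliff_imagN (J : A) : imag_units conj J -> imag_units conj (- J).
Proof.
move=> [cJ JJ]; split; last by rewrite mulrNN.
rewrite opprK; apply/ffunP => K; have /ffunP/(_ K) := cJ; rewrite !ffunE.
by case: ifP => _ h; [rewrite opprK|rewrite -h].
Qed.

(** The set and its mirror image cover the square of L and meet in the
    diagonal. *)
Lemma card_cliff_inv L : (#|cliff_inv L L|.*2 = #|L| * #|L|.+1)%N.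
Proof.
pose swap (p : 'I_n * 'I_n) := (p.2, p.1).
have swapK : involutive swap by case.
pose I2 := [set p : 'I_n * 'I_n | [&& p.1 \in L, p.2 \in L & (p.1 <= p.2)%N]].
have E : #|I2| = #|cliff_inv L L|.
  rewrite -(card_imset _ (inv_inj swapK)); apply: eq_card => p.
  rewrite -[p]swapK mem_imset; last exact: inv_inj.
  by case: p => k l; rewrite !inE /= andbCA.
rewrite -addnn -{1}E -cardsUI mulnS addnC; congr (_ + _)%N.
  rewrite -(card_imset (f := fun k => (k, k)) L); last by move=> i j [].
  apply: eq_card => -[k l]; rewrite !inE /=; apply/idP/imsetP => [|[i iL [-> ->]]].
    case/andP=> /and3P[kL lL kl] /and3P[_ _ lk]; exists k => //.
    by congr (_, _); apply/val_inj/eqP; rewrite /= eqn_leq lk kl.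
  by rewrite iL !leqnn.
rewrite -cardsX; apply: eq_card => -[k l]; rewrite !inE /=.
by case: (k \in L); case: (l \in L) => //=; rewrite leq_total.
Qed.

(** The square of e_L is -1 to the power |L| (|L| + 1) / 2, which is odd exactly
    for |L| = 1, 2 modulo 4. *)
Lemma cliff_basis_imag L : imag_card #|L| -> imag_units conj (e L).
Proof.
move=> L12; split.
  apply/ffunP => K; rewrite !ffunE; case: eqVneq => [->|_];
    last by rewrite oppr0 if_same.
  by rewrite -/(imag_card _) L12.
rewrite cliff_basis_mul symdd cliff_basis0 /cliff_sign.
have := card_cliff_inv L; move: #|cliff_inv L L| L12 => c; rewrite /imag_card.
rewrite !inE => L12 cE; have oc : odd c by lia.
by rewrite -signr_odd oc expr1 scaleN1r.
Qed.

Lemma cliff_sign_neq0 K L : cliff_sign R K L != 0.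
Proof. by rewrite /cliff_sign signr_eq0. Qed.

(** The imaginary unit e_L with L the symmetric difference of K and M sends
    only e_M to a multiple of e_K. *)
Lemma cliff_reaches K M : imag_card #|symd K M| -> reaches conj e K M.
Proof.
move=> KM; exists (e (symd K M)), (cliff_sign R (symd K M) M); split.
- exact: cliff_basis_imag.
- by apply: cliff_imagN; exact: cliff_basis_imag.
- exact: cliff_sign_neq0.
move=> x; rewrite !cliff_component [LHS]cliff_mulE (bigD1 (symd K M)) //= big1.
  rewrite addr0 ffunE eqxx mul1r.
  have -> : symd (symd K M) K = M by rewrite symdC symdK.
  by [].
by move=> L /negPf LKM; rewrite ffunE LKM mul0r mulr0.
Qed.

(** Only the coordinate of J at the symmetric difference of K and M could
    contribute, and an imaginary unit has none there. *)
Lemma cliff_not_reached K M (J : A) : imag_units conj J -> ~~ imag_card #|symd K M| ->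
  component e K (J * e M) = 0.
Proof.
move=> uJ KM; rewrite cliff_component [LHS]cliff_mulE big1 // => L _.
rewrite ffunE; case: eqP => [LK|_]; last by rewrite !mulr0.
rewrite (_ : J L = 0) ?mul0r ?mulr0 //; apply: cliff_imag_support uJ _.
by rewrite -LK [symd L K]symdC symdK in KM.
Qed.

Definition dominating (KK : {set {set 'I_n}}) :=
  forall M, exists2 K, K \in KK & M = K \/ imag_card #|symd K M|.

Lemma dominating_of_determining (KK : {set {set 'I_n}}) :
  nash_determining conj e KK -> dominating KK.
Proof.
move=> det M; apply: contrapT => nM; move: det.
apply: (@not_determining R A conj _ e set0 M).
- exact: cliff_basisP.
- exact: cliff_basis0.
- by move=> J uJ; rewrite cliff_component (cliff_imag_support uJ) // cards0.
- exact: cliff_imagN.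
- move=> K KKK; split.
    by apply/eqP => KM; apply: nM; exists K => //; left.
  move=> J uJ; apply: cliff_not_reached => //; apply/negP => u.
  by apply: nM; exists K => //; right.
Qed.

End CliffordUnits.

(** A splitting basis for J = e_1 consists of the e_K with 1 outside K, starting
    with the empty set: left multiplication by e_1 adds 1 to K without a sign. *)
Section CliffordSplitting.
Variables (R : realType) (n' : nat).
Local Notation n := n'.+1.
Local Notation e := (@cliff_basis R n).
Local Notation conj := (@cliff_conj R n).

Let rest := enum [set K : {set 'I_n} | (ord0 \notin K) && (K != set0)].
Let s := set0 :: rest.
Let b (p : 'I_2 * 'I_(size rest).+1) : {set 'I_n} :=
  if p.1 == 0 then nth set0 s p.2 else ord0 |: nth set0 s p.2.

Let mem_s K : (K \in s) = (ord0 \notin K).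
Proof.
rewrite inE mem_enum inE; have [->|] := eqVneq K set0; first by rewrite inE.
by rewrite andbT.
Qed.

Let rem_notin (K : {set 'I_n}) : ord0 \notin K -> K :\ ord0 = K.
Proof.
move=> K0; apply/setP => i; rewrite !inE; case: eqP => // ->.
by rewrite (negPf K0).
Qed.

Let uniq_s : uniq s.
Proof. by rewrite /= enum_uniq andbT mem_enum inE eqxx andbF. Qed.

Let nth_s (k : 'I_(size rest).+1) : ord0 \notin nth set0 s k.
Proof. by rewrite -mem_s mem_nth. Qed.

Lemma cliff_splitting_bij : bijective b.
Proof.
have lt (K : {set 'I_n}) : (index (K :\ ord0) s < (size rest).+1)%N.
  by rewrite -[(size rest).+1]/(size s) index_mem mem_s !inE eqxx.
exists (fun K : {set 'I_n} => (if ord0 \in K then 1 else 0, Ordinal (lt K))).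
  move=> [l k]; rewrite /b; have ns := nth_s k.
  have kE : index (nth set0 s k) s = k by exact: index_uniq.
  case: eqP => [/= ->|l1].
    rewrite (negPf ns); congr (_, _); apply/val_inj.
    exact: etrans (congr1 (index^~ s) (rem_notin ns)) kE.
  rewrite finset.setU11; congr (_, _).
    move: l1 => /=; case: l => -[|[|//]] i l1; last exact/val_inj.
    by case: l1; apply/val_inj.
  apply/val_inj; exact: etrans (congr1 (index^~ s) (finset.setU1K ns)) kE.
move=> K; have kE : nth set0 s (index (K :\ ord0) s) = K :\ ord0.
  by rewrite nth_index // mem_s !inE eqxx.
have [K0|K0] := boolP (ord0 \in K).
  exact: etrans (congr1 (fun X => ord0 |: X) kE) (finset.setD1K K0).
exact: etrans kE (rem_notin K0).
Qed.

Lemma determining_of_dominating (KK : {set {set 'I_n}}) :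
  dominating KK -> nash_determining conj e KK.
Proof.
move=> dom; have c1 : imag_card #|[set ord0 : 'I_n]| by rewrite cards1.
apply: (@determining_of_reaching R (clifford R n) conj _ e (e [set ord0]) _
  (fun k => e (nth set0 s k)) b).
- exact: cliff_basisP.
- exact: cliff_splitting_bij.
- exact: cliff_basis0.
- by [].
- move=> k; rewrite cliff_basis_mul.
  have sE : symd [set ord0] (nth set0 s k) = ord0 |: nth set0 s k.
    apply/setP => i; rewrite in_symd !inE; case: eqP => // ->.
    by rewrite (negPf (nth_s k)).
  have -> : cliff_sign R [set ord0] (nth set0 s k) = 1.
    rewrite /cliff_sign (_ : cliff_inv _ _ = set0) ?cards0 //; apply/setP => -[i j].
    rewrite !inE /=; case: eqP => // -> /=; rewrite leqn0; case: eqP => j0;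
      rewrite ?andbF //.
    by rewrite (_ : j = ord0) ?(negPf (nth_s k)) //; exact/val_inj.
  by rewrite scale1r sE.
- exact: cliff_basis_imag.
move=> M; have [K KKK KM] := dom M; exists K => //.
have [MK|KM'] := KM; last by exists M; split; [exact: cliff_reaches|right].
exists (symd K [set ord0]); split; last by left.
by apply: cliff_reaches; rewrite symdK.
Qed.

End CliffordSplitting.

(** * Dominating families of sets *)
Section Domination.
Local Open Scope nat_scope.
Variable n : nat.
Implicit Types K L M : {set 'I_n}.

Lemma dominating_empty : n = 2 -> dominating [set (set0 : {set 'I_n})].
Proof.
move=> n2 M; exists set0; first by rewrite inE.
have M2 : (#|M| <= 2)%N by rewrite -n2; have := max_card (mem M); rewrite card_ord.
rewrite sym0d /imag_card; case: (posnP #|M|) => [/eqP|];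
  first by rewrite cards_eq0 => /eqP; left.
by move=> M0; right; rewrite !inE; lia.
Qed.

Lemma symd_full M : symd [set: 'I_n] M = ~: M.
Proof. by apply/setP => i; rewrite in_symd !inE; case: (i \in M). Qed.

(** A set not dominated by the empty set has 0 or 3 elements modulo 4; for these
    n its complement has 1 or 2 elements modulo 4, unless it is empty. *)
Lemma dominating_empty_full : (n %% 4 = 1 \/ n = 3 \/ n = 4)%N ->
  dominating [set set0; [set: 'I_n]].
Proof.
move=> nn M; have := cardsC M; rewrite card_ord => cM.
have [u|u] := boolP (imag_card #|M|).
  by exists set0; [rewrite !inE eqxx|right; rewrite sym0d].
have [M0|M0] := eqVneq M set0; first by exists set0; [rewrite !inE eqxx|left].
have [MT|MT] := eqVneq M [set: 'I_n].
  by exists [set: 'I_n]; [rewrite !inE eqxx orbT|left].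
exists [set: 'I_n]; [by rewrite !inE eqxx orbT|right].
have c0 : (0 < #|M|)%N by rewrite card_gt0.
have c1 : (0 < #|~: M|)%N.
  by rewrite card_gt0; apply: contra MT => /eqP MC;
    rewrite -[M]finset.setCK MC finset.setC0.
by move: u; rewrite symd_full /imag_card !inE; lia.
Qed.

(** Given M, the traces on the pair can be chosen freely: K is obtained from the
    trace of M by changing |E c| = 0, 1 or 2 elements, so that the symmetric
    difference with M, of cardinality |E c| + c, falls on 1 or 2 modulo 4. *)
Lemma dominating_pair (i j : 'I_n) : i != j -> dominating (powerset [set i; j]).
Proof.
move=> ij M; pose P := [set i; j]; pose E (k : nat) : {set 'I_n} :=
  match k %% 4 with 0 => [set i] | 3 => P | _ => set0 end%N.
pose c := #|M :\: P|; exists (symd (E c) (M :&: P)).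
  rewrite powersetE; apply/fintype.subsetP => x; rewrite in_symd !inE => /idP.
  have : (x \in E c) -> x \in P.
    by rewrite /E; case: (c %% 4)%N => [|[|[|[|m]]]]; rewrite !inE // => ->.
  by rewrite !inE; case: (x \in E c) => [->//|_]; case: (x \in M).
right; have EP x : x \in E c -> x \in P.
  by rewrite /E; case: (c %% 4)%N => [|[|[|[|m]]]]; rewrite !inE // => ->.
have -> : symd (symd (E c) (M :&: P)) M = E c :|: (M :\: P).
  apply/setP => x; rewrite !in_symd !inE; have := EP x; rewrite !inE.
  by case: (x \in E c) => [->//|_]; case: (x \in M); case: (x == i); case: (x == j).
have -> : #|E c :|: (M :\: P)| = (#|E c| + c)%N.
  rewrite cardsU (_ : E c :&: (M :\: P) = set0) ?cards0 ?subn0 //.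
  apply/setP => x; rewrite finset.in_setI finset.in_setD finset.in_set0.
  by have := EP x; case: (x \in E c) => // ->.
rewrite /imag_card !inE /E; have := ltn_pmod c (isT : (0 < 4)%N).
have cP : #|P| = 2 by rewrite cards2 ij.
by case cE : (c %% 4)%N => [|[|[|[|m]]]] // _; rewrite ?cards1 ?cards0 ?cP; lia.
Qed.

Lemma subset_card K i : (i <= #|K|)%N -> exists2 A : {set 'I_n}, A \subset K & #|A| = i.
Proof.
move=> iK; exists [set x in take i (enum K)].
  by apply/fintype.subsetP => x; rewrite inE => /mem_take; rewrite mem_enum.
rewrite cardsE (card_uniqP _) ?take_uniq ?enum_uniq // size_take -cardE.
by case: ltngtP iK.
Qed.

Lemma small_set_cover (T : finType) (x0 : T) (X : {set T}) m : (#|X| <= m)%N ->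
  exists f : 'I_m -> T, forall x, x \in X -> exists i, x = f i.
Proof.
move=> Xm; exists (fun i => nth x0 (enum X) i) => x xX.
have lt : (index x (enum X) < m)%N.
  by apply: leq_trans Xm; rewrite cardE index_mem mem_enum.
by exists (Ordinal lt); rewrite /= nth_index // mem_enum.
Qed.

Lemma domination_gt0 (KK : {set {set 'I_n}}) : dominating KK -> (1 <= #|KK|)%N.
Proof. by move=> /(_ set0)[K KKK _]; apply/card_gt0P; exists K. Qed.

Lemma domination_gt1 (KK : {set {set 'I_n}}) : (3 <= n)%N -> dominating KK ->
  (2 <= #|KK|)%N.
Proof.
move=> n3 dom; rewrite ltnNge; apply/negP => KK1.
have [f fP] := small_set_cover (set0 : {set 'I_n}) KK1.
have [L _ L3] : exists2 L : {set 'I_n}, L \subset [set: 'I_n] & #|L| = 3.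
  by apply: subset_card; rewrite cardsT card_ord.
have [K /fP[i ->]] := dom (symd (f ord0) L); rewrite (ord1 i) symdK /imag_card L3.
case=> // /(congr1 (symd (f ord0))); rewrite symdK symdd => L0.
by rewrite L0 cards0 in L3.
Qed.

(** Two sets at symmetric difference K, with |K| = k, are tested against the
    translate of the first one by a set with i elements inside K and j outside:
    its differences with the two sets have i + j and k - i + j elements, and both
    numbers must be nonzero and 0 or 3 modulo 4. The case k = n with n = 1
    modulo 4 admits no such choice. *)
Lemma undominated_sizes (k : nat) : (6 <= n)%N -> (n %% 4 != 1)%N -> (k <= n)%N ->
  exists i j, [/\ (i <= k)%N, (j <= n - k)%N, (0 < i + j)%N, (0 < k - i + j)%N &
    ~~ imag_card (i + j) /\ ~~ imag_card (k - i + j)].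
Proof.
move=> n6 n1 kn; rewrite /imag_card.
have [k0|k0] := leqP k 1.
  by exists 0, 3; rewrite !inE; split; try split; lia.
have [k2|k2] := leqP k 3.
  by exists 1, 2; rewrite !inE; split; try split; lia.
have [k4|k4] := leqP k 5.
  by exists 2, 1; rewrite !inE; split; try split; lia.
have := ltn_pmod k (isT : (0 < 4)%N).
case kE : (k %% 4)%N => [|[|[|[|m]]]] // _.
- by exists 4, 0; rewrite !inE; split; try split; lia.
- by exists 2, 1; rewrite !inE; split; try split; lia.
- by exists 3, 0; rewrite !inE; split; try split; lia.
- by exists 3, 0; rewrite !inE; split; try split; lia.
Qed.

Lemma domination_gt2 (KK : {set {set 'I_n}}) : (6 <= n)%N -> (n %% 4 != 1)%N ->
  dominating KK -> (3 <= #|KK|)%N.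
Proof.
move=> n6 n1 dom; rewrite ltnNge; apply/negP => KK2.
have [f fP] := small_set_cover (set0 : {set 'I_n}) KK2.
have [K KE] : exists K, K = symd (f ord0) (f ord_max) by exists (symd (f ord0) (f
  ord_max)).
have kn : (#|K| <= n)%N by have := max_card (mem K); rewrite card_ord.
have [i [j [ik jk ij0 kij0 [u1 u2]]]] := undominated_sizes n6 n1 kn.
have [X XK Xi] := subset_card ik.
have [Y YK Yj] : exists2 Y : {set 'I_n}, Y \subset ~: K & #|Y| = j.
  by apply: subset_card; have := cardsC K; rewrite card_ord; lia.
have XYd : X :&: Y = set0.
  apply/setP => x; rewrite !inE; apply/negP =>
    /andP[/(fintype.subsetP XK) xK /(fintype.subsetP YK)].
  by rewrite inE xK.
pose L := X :|: Y.
have cL : #|L| = (i + j)%N by rewrite cardsU XYd cards0 subn0 Xi Yj.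
have LK : symd K L = (K :\: X) :|: Y.
  apply/setP => x; rewrite in_symd !inE.
  have hX := fintype.subsetP XK x; have hY := fintype.subsetP YK x.
  rewrite inE in hY; move: hX hY.
  case: (x \in X); case: (x \in Y); case: (x \in K) => // hX hY;
    first [by have := hX isT | by have := hY isT].
have cLK : #|symd K L| = (#|K| - i + j)%N.
  rewrite LK cardsU (_ : _ :&: Y = set0) ?cards0 ?subn0 ?Yj.
    by rewrite cardsD (finset.setIidPr XK) Xi.
  apply/setP => x; rewrite !inE; case: (x \in Y) (fintype.subsetP YK x) =>
    [/(_ isT)|]; rewrite ?andbF //.
  by rewrite inE => /negPf ->; rewrite andbF.
have [K' /fP[l ->]] := dom (symd (f ord0) L).
have [-> | ->] : l = ord0 \/ l = ord_max.
  by case: l => -[|[|//]] l2; [left|right]; apply/val_inj.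
- rewrite symdK cL (negPf u1) => -[]// /(congr1 (symd (f ord0)));
  rewrite symdK symdd => L0.
  by rewrite L0 cards0 in cL; rewrite -cL in ij0.
- have E : symd (f ord_max) (symd (f ord0) L) = symd K L.
    by rewrite KE symdA [symd (f ord_max) _]symdC.
  rewrite E cLK (negPf u2) => -[]// /(congr1 (symd (f ord_max))); rewrite E symdd => L0.
  by rewrite L0 cards0 in cLK; rewrite -cLK in kij0.
Qed.

End Domination.

(** * Quaternions *)
Section Quaternionic.
Variable R : realType.
Local Notation e := (@quat_basis R).
Local Notation conj := (@quat_conj R).
Local Notation comp := (component e).

Let e0 : e set0 = 1.
Proof. by rewrite /quat_basis !inE mulr1. Qed.
Let ej : e [set ord0] = quat_j R.
Proof. by rewrite /quat_basis !inE /= mulr1. Qed.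
Let ei : e [set ord_max] = quat_i R.
Proof. by rewrite /quat_basis !inE /= mul1r. Qed.
Let eji : e [set: 'I_2] = quat_j R * quat_i R.
Proof. by rewrite /quat_basis !inE. Qed.

Lemma quat_expansion (x : quat R) : x = quat0 x *: e set0 + quat2 x *: e [set ord0] +
  quat1 x *: e [set ord_max] - quat3 x *: e [set: 'I_2].
Proof. by rewrite e0 ej ei eji; case: x => a b c d /=; congr Quat; ring. Qed.

Lemma quat_components (x : quat R) :
  [/\ comp set0 x = quat0 x, comp [set ord0] x = quat2 x,
      comp [set ord_max] x = quat1 x & comp [set: 'I_2] x = - quat3 x].
Proof.
have eb := @component_basis_elt R (quat R) _ e (quat_basisP R).
have E : [/\ ((set0 : {set 'I_2}) == [set ord0]) = false,
             ((set0 : {set 'I_2}) == [set ord_max]) = false,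
             ((set0 : {set 'I_2}) == [set: 'I_2]) = false &
             [/\ ([set ord0] == [set ord_max] :> {set 'I_2}) = false,
                 ([set ord0] == [set: 'I_2]) = false &
                 ([set ord_max] == [set: 'I_2]) = false]].
  split; last split; apply/negbTE/eqP => /finset.setP h;
    by [have := h ord0; rewrite !inE|have := h ord_max; rewrite !inE].
have [E1 E2 E3 [E4 E5 E6]] := E.
have cE K : comp K x = quat0 x * (K == set0)%:R + quat2 x * (K == [set ord0])%:R +
    quat1 x * (K == [set ord_max])%:R - quat3 x * (K == [set: 'I_2])%:R.
  by rewrite {1}[x]quat_expansion -scaleNr !componentD !componentZ !eb mulNr.
split; rewrite cE ?eqxx.
- by rewrite E1 E2 E3 !mulr0 !addr0 subr0 mulr1.
- by rewrite eq_sym E1 E4 E5 !mulr0 addr0 subr0 add0r mulr1.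
- by rewrite eq_sym E2 eq_sym E4 E6 !mulr0 !add0r subr0 mulr1.
- by rewrite eq_sym E3 eq_sym E5 eq_sym E6 !mulr0 !add0r mulr1.
Qed.

Lemma quat_imag_unit (b c d : R) : b ^+ 2 + c ^+ 2 + d ^+ 2 = 1 ->
  imag_units conj (Quat 0 b c d).
Proof.
move=> bcd; split; first by congr Quat; rewrite oppr0.
by rewrite [RHS](_ : _ = Quat (- (b ^+ 2 + c ^+ 2 + d ^+ 2)) 0 0 0);
  [congr Quat; ring|rewrite bcd; congr Quat; rewrite oppr0].
Qed.

Lemma quat_set_cases (M : {set 'I_2}) :
  [\/ M = set0, M = [set ord0], M = [set ord_max] | M = [set: 'I_2]].
Proof.
have two (K : {set 'I_2}) : (ord0 \in K) = (ord0 \in M) ->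
    (ord_max \in K) = (ord_max \in M) -> M = K.
  move=> h0 h1; apply/finset.setP => -[[|[|//]] i].
    by rewrite (_ : Ordinal i = ord0) //; exact/val_inj.
  by rewrite (_ : Ordinal i = ord_max) //; exact/val_inj.
case m0 : (ord0 \in M); case m1 : (ord_max \in M).
- by apply: Or44; apply: two; rewrite !inE ?m0 ?m1.
- by apply: Or42; apply: two; rewrite !inE ?m0 ?m1.
- by apply: Or43; apply: two; rewrite !inE ?m0 ?m1.
- by apply: Or41; apply: two; rewrite !inE ?m0 ?m1.
Qed.

(** Multiplying by i, j or k moves any imaginary coordinate to the real part. *)
Lemma quat_reaches (M : {set 'I_2}) : M != set0 -> reaches conj e set0 M.
Proof.
move=> M0.
have [b [c [d [bcd JM]]]] : exists b c d : R, b ^+ 2 + c ^+ 2 + d ^+ 2 = 1 /\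
    exists2 k : R, k != 0 & forall x, comp set0 (Quat 0 b c d * x) = k * comp M x.
  have re b c d x : comp set0 (Quat 0 b c d * x) =
      - (b * quat1 x) - c * quat2 x - d * quat3 x.
    by have [-> _ _ _] := quat_components (Quat 0 b c d * x); case: x => p q r t /=;
      ring.
  have N1 : -1 != 0 :> R by rewrite oppr_eq0 oner_eq0.
  case: (quat_set_cases M) M0 => -> M0.
  - by rewrite eqxx in M0.
  - exists 0, 1, 0; split; first by ring.
    exists (-1) => // x; have [_ -> _ _] := quat_components x; rewrite re; ring.
  - exists 1, 0, 0; split; first by ring.
    exists (-1) => // x; have [_ _ -> _] := quat_components x; rewrite re; ring.
  - exists 0, 0, 1; split; first by ring.
    exists 1; first exact: oner_neq0.
    by move=> x; have [_ _ _ ->] := quat_components x; rewrite re; ring.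
have [k k0 kM] := JM; exists (Quat 0 b c d), k; split=> //.
  exact: quat_imag_unit.
rewrite (_ : - Quat 0 b c d = Quat 0 (- b) (- c) (- d)); last first.
  by congr Quat; rewrite oppr0.
by apply: quat_imag_unit; rewrite !sqrrN.
Qed.

Let s (p : 'I_2 * 'I_2) : {set 'I_2} :=
  (if p.1 == 0 then set0 else [set ord0]) :|:
    (if p.2 == 0 then set0 else [set ord_max]).

Lemma quat_splitting_bij : bijective s.
Proof.
exists (fun K : {set 'I_2} =>
  (if ord0 \in K then 1 else 0, if ord_max \in K then 1 else 0)).
  by move=> [[[|[|//]] i] [[|[|//]] j]]; rewrite /s /= !inE /=; congr (_, _);
    apply/val_inj.
by move=> K; case: (quat_set_cases K) => ->; rewrite /s !inE /=;
  apply/finset.setP => -[[|[|//]] i]; rewrite !inE.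
Qed.

Lemma quat_determining : nash_determining conj e [set set0].
Proof.
apply: (@determining_of_reaching R (quat R) conj _ e (quat_j R) 1
  (fun k => if k == 0 then 1 else quat_i R) s).
- exact: quat_basisP.
- exact: quat_splitting_bij.
- by [].
- by move=> k; rewrite /s /= finset.set0U; case: ifP.
- move=> k; rewrite /s /=; case: ifP => _; first by rewrite finset.setU0 mulr1 ej.
  by rewrite /quat_basis !inE.
- by apply: quat_imag_unit; ring.
move=> M; exists set0; first by rewrite inE.
have [->|M0] := eqVneq M set0.
  exists [set ord0]; split; last by left.
  by apply: quat_reaches; apply/set0Pn; exists ord0; rewrite inE.
by exists M; split; [exact: quat_reaches|right].
Qed.

Lemma quat_determining_gt0 (KK : {set {set 'I_2}}) :
  nash_determining conj e KK -> (1 <= #|KK|)%N.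
Proof.
move=> det; rewrite card_gt0; apply/eqP => KK0; move: det; rewrite KK0.
apply: (@not_determining R (quat R) conj _ e set0 set0).
- exact: quat_basisP.
- exact: e0.
- move=> J [cJ _]; have [-> _ _ _] := quat_components J.
  move: cJ; case: J => a b c d [/eqP aa].
  rewrite /=; move: aa.
  by rewrite -addr_eq0 -mulr2n mulrn_eq0 /= => /eqP.
- move=> J [cJ JJ]; split; last by rewrite mulrNN.
  by rewrite opprK; move: cJ; case: J {JJ} => a b c d [aa]; congr Quat;
    rewrite ?opprK // -aa.
- by move=> K; rewrite inE.
Qed.

End Quaternionic.

(** * The Nash numbers *)
Lemma nash_number_cliffordP (R : realType) (n l : nat) (KK : {set {set 'I_n.+1}}) :
  #|KK| = l -> dominating KK -> (forall X : {set {set 'I_n.+1}}, dominating X ->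
    (l <= #|X|)%N) ->
  nash_number_clifford R n.+1 l.
Proof.
move=> cK dK low; split; first by exists KK => //; exact: determining_of_dominating.
by move=> X /dominating_of_determining/low.
Qed.

Lemma card_empty_full n : #|[set set0; [set: 'I_n.+1]]| = 2%N.
Proof.
rewrite cards2 (_ : (set0 != [set: 'I_n.+1]) = true) //.
by apply/eqP => /finset.setP/(_ ord0); rewrite !inE.
Qed.

Local Close Scope complex_scope.
Local Close Scope ring_scope.

Theorem theorem1p13 (R : realType) (n : nat) (hn : 2 <= n) :
  [/\ nash_number_clifford R 2 1 /\ nash_number_quat R 1,
      nash_number_clifford R 3 2 /\ nash_number_clifford R 4 2,
      (n = 1 %[mod 4] -> nash_number_clifford R n 2)
    & (6 <= n -> (n %% 4) \in [:: 0; 2; 3] ->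
       exists l : nat, nash_number_clifford R n l /\ 3 <= l <= 4)].
Proof.
have two m : (3 <= m.+1)%N -> (m.+1 %% 4 = 1 \/ m.+1 = 3 \/ m.+1 = 4)%N ->
    nash_number_clifford R m.+1 2.
  move=> m3 mm; apply: nash_number_cliffordP (card_empty_full m) _ _.
    exact: dominating_empty_full.
  by move=> X; exact: domination_gt1.
split.
- split; last first.
    split; first by exists [set set0]; [rewrite cards1|exact: quat_determining].
    exact: quat_determining_gt0.
  apply: nash_number_cliffordP (cards1 set0) _ _; first exact: dominating_empty.
  by move=> X; exact: domination_gt0.
- by split; apply: two => //; right; [left|right].
- case: n hn => // m m2 m1; apply: two; last by left; rewrite m1.
  by move: m1; case: m m2 => [|[|[|m]]].
- case: n hn => // m _ m6 mm.
  (* The Nash number is the least size of a dominating family. *)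
  pose P (l : nat) := `[< exists2 X : {set {set 'I_m.+1}}, #|X| = l & dominating X >].
  have P4 : P 4%N.
    apply/asboolP; exists (powerset [set ord0; ord_max]); last first.
      by apply: dominating_pair; case: m m6 {mm P}.
    by rewrite card_powerset cards2; case: m m6 {mm P}.
  have exP : exists l, P l by exists 4%N.
  case: (ex_minnP exP) => l /asboolP[X Xl dX] lmin; exists l; split.
    apply: nash_number_cliffordP Xl dX _ => Y dY.
    by apply: lmin; apply/asboolP; exists Y.
  rewrite (lmin 4%N P4) andbT -Xl; apply: domination_gt2 => //.
  by move: mm; rewrite !inE; case: (m.+1 %% 4)%N => [|[|]].
Qed.
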